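(* Let $F$ be an algebraically closed field of characteristic $p\geq3$ and let $(\lambda|p\mu)\in\mathcal{P}^2(n)$. Then there is an isomorphism of $F\mathfrak{S}_n$-modules $$Y(\lambda|p\mu)\otimes\mathrm{sgn}\cong Y\big(\mathrm{m}(\lambda(0))+p\mu\ \big|\ \lambda-\lambda(0)\big).$$
   Context: $\mathcal{P}^2(n)$ is the set of pairs $(\lambda|\zeta)$ of partitions (possibly empty) with $|\lambda|+|\zeta|=n$; $M(\lambda|\zeta)=\mathrm{Ind}_{\mathfrak{S}_\lambda\times\mathfrak{S}_\zeta}^{\mathfrak{S}_n}(F\boxtimes\mathrm{sgn})$. Dominance on $\mathcal{P}^2(n)$: $(\lambda|\zeta)\unrhd(\alpha|\beta)$ iff for all $k$, $\sum_{i\le k}\lambda_i\ge\sum_{i\le k}\alpha_i$ and $|\lambda|+\sum_{i\le k}\zeta_i\ge|\alpha|+\sum_{i\le k}\beta_i$. For $(\lambda|p\mu)\in\mathcal{P}^2(n)$, $Y(\lambda|p\mu)$ is the unique (up to isomorphism) indecomposable summand of $M(\lambda|p\mu)$ of multiplicity one such that all other indecomposable summands of $M(\lambda|p\mu)$ are summands of some $M(\alpha|p\beta)$ with $(\alpha|p\beta)\rhd(\lambda|p\mu)$. A partition is $p$-restricted if $\lambda_i-\lambda_{i+1}<p$ for all $i$; $\lambda=\sum_{i\ge0}p^i\lambda(i)$ is the unique $p$-adic expansion with $p$-restricted $\lambda(i)$. For $p$-restricted $\nu$, $D_\nu$ denotes the socle of the Specht module $S^\nu$ (these give all simple modules), and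 the Mullineux map $\mathrm{m}$ is the bijection on $p$-restricted partitions of $n$ with $D_\nu\otimes\mathrm{sgn}\cong D_{\mathrm{m}(\nu)}$. *)

(* Defs.v *)
From HB Require Import structures.
From mathcomp Require Import all_boot all_order all_algebra all_fingroup all_solvable all_field all_character.
Set Implicit Arguments.
Unset Strict Implicit.
Unset Printing Implicit Defensive.
Import GRing.Theory.

Definition is_partition (l : seq nat) : bool :=
  sorted geq l && all (fun x => 0 < x)%N l.

Definition prestricted (p : nat) (l : seq nat) : Prop :=
  forall i : nat, (nth 0 l i - nth 0 l i.+1 < p)%N.

Definition padd (s t : seq nat) : seq nat :=
  mkseq (fun i => nth 0 s i + nth 0 t i)%N (maxn (size s) (size t)).
Definition pscale (p : nat) (s : seq nat) : seq nat := map (muln p) s.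

Definition dom2 (l z a b : seq nat) : Prop :=
  forall k : nat,
    (sumn (take k a) <= sumn (take k l))%N /\
    (sumn a + sumn (take k b) <= sumn l + sumn (take k z))%N.
Definition sdom2 (l z a b : seq nat) : Prop :=
  dom2 l z a b /\ (l, z) <> (a, b).

Definition SymG (n : nat) : {group 'S_n} := [set: 'S_n]%G.

Definition sgnF (F : fieldType) n (s : 'S_n) : F := ((-1) ^+ odd_perm s)%R.

(* index of the block of the composition c containing position i,
   blocks being consecutive intervals of sizes c_1, c_2, ... *)
Definition blk (c : seq nat) (i : nat) : nat :=
  count (fun k => sumn (take k.+1 c) <= i)%N (iota 0 (size c)).

(* Young subgroup S_l x S_z, split into its two factors: positions
   0..|l|-1 carry the blocks of l, positions |l|..n-1 the blocks of z. *)
Definition youngL n (l z : seq nat) : {set 'S_n} :=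
  [set s : 'S_n | [forall i : 'I_n, (blk (l ++ z) (s i) == blk (l ++ z) i)
                    && ((sumn l <= i)%N ==> (s i == i))]].
Definition youngR n (l z : seq nat) : {set 'S_n} :=
  [set s : 'S_n | [forall i : 'I_n, (blk (l ++ z) (s i) == blk (l ++ z) i)
                    && ((i < sumn l)%N ==> (s i == i))]].

(* the basis element s of the group algebra F S_n, as a row vector of
   the (right) regular representation *)
Definition gelt (F : fieldType) n (s : 'S_n) :=
  gring_row (regular_repr F (SymG n) s).

Definition Mgen (F : fieldType) n (l z : seq nat) :=
  (\sum_(h1 in youngL n l z) \sum_(h2 in youngR n l z)
     sgnF F h2 *: gelt F (h1 * h2)%g)%R.

(* M(l|z) = Ind_{S_l x S_z}^{S_n} (F [x] sgn), realised (as a right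
   module) as the right ideal sigma . F S_n of the regular module. *)
Definition Mrep (F : fieldType) n (l z : seq nat) :=
  submod_repr (cyclic_mx_module (regular_repr F (SymG n)) (Mgen F n l z)).

(* Specht module S^nu (nu a partition of k), for the row-reading tableau
   t of shape nu: the right ideal a_t b_t F S_k, where a_t is the row
   symmetriser and b_t the column antisymmetriser. *)
Definition colidx (nu : seq nat) (i : nat) : nat := (i - sumn (take (blk nu i) nu))%N.
Definition rowgrp k (nu : seq nat) : {set 'S_k} :=
  [set s : 'S_k | [forall i : 'I_k, blk nu (s i) == blk nu i]].
Definition colgrp k (nu : seq nat) : {set 'S_k} :=
  [set s : 'S_k | [forall i : 'I_k, colidx nu (s i) == colidx nu i]].
Definition Sgen (F : fieldType) k (nu : seq nat) :=
  (\sum_(r in rowgrp k nu) \sum_(c in colgrp k nu)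
     sgnF F c *: gelt F (r * c)%g)%R.
Definition Specht (F : fieldType) (nu : seq nat) :=
  submod_repr (cyclic_mx_module (regular_repr F (SymG (sumn nu))) (Sgen F (sumn nu) nu)).

Lemma sgn_twist_repr (F : fieldType) n d (rG : mx_representation F (SymG n) d) :
  mx_repr (SymG n) (fun s => sgnF F s *: rG s)%R.
Proof.
split=> [|x y Gx Gy].
  by rewrite /sgnF odd_perm1 expr0 scale1r repr_mx1.
rewrite /sgnF odd_permM signr_addb repr_mxM // -scalemxAl -scalemxAr.
by rewrite scalerA.
Qed.
Canonical sgn_twist (F : fieldType) n d (rG : mx_representation F (SymG n) d) :=
  MxRepresentation (@sgn_twist_repr F n d rG).

Definition is_socle (F : fieldType) (gT : finGroupType) (G : {group gT}) d
    (rG : mx_representation F G d) (U : 'M[F]_d) : Prop :=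
  mxmodule rG U /\ inhabited (mx_completely_reducible rG U) /\
  (forall V : 'M[F]_d, mxsimple rG V -> (V <= U)%MS).

(* mullineux F p rho nu  :<->  D_rho (x) sgn ~= D_nu, where D_nu is the
   socle of the Specht module S^nu, i.e. nu = m(rho). *)
Definition mullineux (F : fieldType) (rho nu : seq nat) : Prop :=
  exists (e : sumn nu = sumn rho),
  exists U (modU : mxmodule (Specht F rho) U),
  exists U' (modU' : mxmodule (Specht F nu) U'),
    is_socle (Specht F rho) U /\ is_socle (Specht F nu) U' /\
    mx_rsim (sgn_twist (submod_repr modU))
            (eq_rect _ (fun k => mx_representation F (SymG k) _) (submod_repr modU') _ e).

Definition indecomposable (F : fieldType) (gT : finGroupType) (G : {group gT}) d
    (rG : mx_representation F G d) : Prop :=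
  (0 < d)%N /\
  forall U V : 'M[F]_d, mxmodule rG U -> mxmodule rG V ->
    mxdirect (U + V)%MS -> (U + V == (1%:M)%R)%MS -> (U == 0)%R \/ (V == 0)%R.

Definition is_summand (F : fieldType) (gT : finGroupType) (G : {group gT}) dM dY
    (rM : mx_representation F G dM) (rY : mx_representation F G dY) : Prop :=
  exists U (modU : mxmodule rM U),
    mx_rsim (submod_repr modU) rY /\
    exists V : 'M[F]_dM, mxmodule rM V /\ mxdirect (U + V)%MS /\ (U + V == (1%:M)%R)%MS.

Definition signedYoung (F : fieldType) (p n : nat) (l m : seq nat) d
    (rY : mx_representation F (SymG n) d) : Prop :=
  let rM := Mrep F n l (pscale p m) in
  indecomposable rY /\
  exists (k : nat) (W : 'I_k -> 'M[F]_(\rank (cyclic_mx (regular_repr F (SymG n)) (Mgen F n l (pscale p m)))))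
         (modW : forall i, mxmodule rM (W i)),
    mxdirect (\sum_i W i)%MS /\ ((\sum_i W i)%MS == (1%:M)%R)%MS /\
    (forall i, indecomposable (submod_repr (modW i))) /\
    exists i0 : 'I_k,
      mx_rsim (submod_repr (modW i0)) rY /\
      forall j : 'I_k, j != i0 ->
        ~ mx_rsim (submod_repr (modW j)) rY /\
        exists a b : seq nat,
          [/\ is_partition a, is_partition b, (sumn a + p * sumn b)%N = n,
              sdom2 a (pscale p b) l (pscale p m) &
              is_summand (Mrep F n a (pscale p b)) (submod_repr (modW j))].

(* Main.v *)
(* Idea.  Besides M1 = M(l | p m) and M2 = M(nu + p m | p kap) consider
   the signed permutation module N induced from the Young subgroup of type
   (p kap | p m), the remaining r = |rho| points being left free.  Decompose the
   moved points into blocks of p points, one block for each cell of kap and of m, and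
   let E be the elementary abelian group generated by the p-cycles on the blocks.
   For an endomorphism phi of N only the E-fixed tabloids matter modulo p; keeping
   those coefficients, and projecting with the column (anti)symmetrisers of kap and m
   acting on blocks, turns phi into an element of F S_r, which we let act on
   D = D_rho.  This is a multiplicative map End N -> End D, onto since D is simple.

   If N -> Z -> N has nonzero image, with Z = M(a | p b), then transpositions inside
   a block force the blocks of kap (of m) to lie in rows of a (of p b), and the usual
   dominance arguments for kap, m and for D inside S^rho show that (a | p b) is
   dominated by (l | p m).  Hence if N -> M1 -> N has nonzero image, then so has some
   N -> Y1 -> N; and the natural maps N -> M1 -> N map to the row symmetriser of rho,
   which does not kill D_rho because rho is p-restricted.  The construction
   is symmetric under tensoring with sgn, with D_rho (x) sgn = D_nu, so Y2 (x) sgn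
   has the same property.  As End D is a simple quotient of End N, Fitting's lemma
   gives Y1 = Y2 (x) sgn. *)
Require Import Defs.
From HB Require Import structures.
From mathcomp Require Import all_boot all_order all_algebra all_fingroup all_solvable all_field all_character.
From mathcomp Require Import zify.
Set Implicit Arguments.
Unset Strict Implicit.
Unset Printing Implicit Defensive.
Import GRing.Theory.
Local Open Scope ring_scope.

(** * Row stabilisers and their signs *)

(** Multiplicativity is the delicate point. When a product [phi *m psi] is expanded over cosets, E
    permutes the cosets and leaves the terms unchanged, so orbits of length p sum to zero. A fixed
    coset with nonzero coefficient puts the blocks into rows injectively on every column and with
    the right content, hence comes from a column permutation of the cells and a permutation of the
    free points. The signed sum over the column permutations then rebuilds the column symmetriser in
    front of [psi]. That p is odd enters three times: a p-cycle has sign 1, a swap of two blocks has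
    the sign of a transposition, and 1 differs from -1, so that a clash of signs kills a
    coefficient. D_rho is used only through its simplicity, two dominance bounds (unsigned rows from
    S^rho, signed rows from S^nu after the twist) and two symmetrisers that act on it as nonzero
    maps. *)

Section RowCharacter.
Variables (F : fieldType) (Om : finType) (T : eqType).
Implicit Types (row : Om -> bool * T) (s t u : {perm Om}).

(* The boolean of a row label tells whether the row carries the sign character. *)
Definition rowstab row : {set {perm Om}} :=
  [set s : {perm Om} | [forall i, row (s i) == row i]].

Definition rowsign row s : F := (-1) ^+ restr_perm [set i | (row i).1] s.

Lemma rowstabP row s : reflect (forall i, row (s i) = row i) (s \in rowstab row).
Proof.
by rewrite inE; apply: (iffP forallP) => H i; [apply/eqP | rewrite H].
Qed.

Lemma eq_rowstab row1 row2 : row1 =1 row2 -> rowstab row1 = rowstab row2.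
Proof.
by move=> E; apply/setP=> s; apply/rowstabP/rowstabP => H i; have := H i; rewrite !E.
Qed.

Lemma eq_rowsign row1 row2 s : row1 =1 row2 -> rowsign row1 s = rowsign row2 s.
Proof.
move=> E; rewrite /rowsign; congr (_ ^+ odd_perm (restr_perm _ _)).
by apply/setP=> i; rewrite !inE E.
Qed.

Lemma rowstab_group_set row : group_set (rowstab row).
Proof.
apply/group_setP; split=> [|s t /rowstabP Hs /rowstabP Ht]; apply/rowstabP=> i.
  by rewrite perm1.
by rewrite permM Ht Hs.
Qed.
Canonical rowstab_group row := Group (rowstab_group_set row).

Lemma rowstab_astabs row s :
  s \in rowstab row -> s \in ('N([set i | (row i).1] | 'P))%g.
Proof.
move=> /rowstabP Hs; rewrite !inE /=; apply/subsetP=> i.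
by rewrite !inE apermE Hs.
Qed.

Lemma rowsign1 row : rowsign row 1%g = 1.
Proof. by rewrite /rowsign morph1 odd_perm1. Qed.

Lemma rowsignM row : {in rowstab row &, {morph rowsign row : s t / (s * t)%g >-> s * t}}.
Proof.
move=> s t Hs Ht; rewrite /rowsign morphM ?rowstab_astabs //.
by rewrite odd_permM signr_addb.
Qed.

Lemma rowsign_sqr row s : rowsign row s * rowsign row s = 1.
Proof. by rewrite /rowsign -expr2 sqrr_sign. Qed.

Lemma rowsign_neq0 row s : rowsign row s != 0.
Proof. by rewrite /rowsign signr_eq0. Qed.

Lemma rowsignV row s : s \in rowstab row -> rowsign row s^-1%g = rowsign row s.
Proof. by move=> Hs; rewrite /rowsign morphV ?rowstab_astabs // odd_permV. Qed.

Lemma restr_rowE row s i : s \in rowstab row ->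
  restr_perm [set i | (row i).1] s i = if (row i).1 then s i else i.
Proof.
move=> Hs; case: ifPn => Hi.
  by rewrite restr_permE ?rowstab_astabs // inE.
by rewrite (out_perm (restr_perm_on _ _)) // inE.
Qed.

Lemma rowsignE row s t : s \in rowstab row ->
    (forall i, t i = if (row i).1 then s i else i) ->
  rowsign row s = (-1) ^+ odd_perm t.
Proof.
move=> Hs Ht; rewrite /rowsign; congr (_ ^+ (odd_perm _)); apply/permP=> i.
by rewrite Ht restr_rowE.
Qed.

Lemma rowstab_conj row s t :
  (s \in rowstab (row \o t)) = ((s ^ t)%g \in rowstab row).
Proof.
apply/rowstabP/rowstabP => /= Hs i; last by have := Hs (t i); rewrite permJ.
by rewrite -(permKV t i) permJ Hs.
Qed.

Lemma rowsign_conj row s t : s \in rowstab (row \o t) ->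
  rowsign (row \o t) s = rowsign row (s ^ t)%g.
Proof.
move=> Hs; have Hst := Hs; rewrite rowstab_conj in Hst.
rewrite [RHS]/rowsign -(odd_permJ _ t^-1%g); apply: rowsignE => // i.
rewrite -{1}(permK t i) permJ restr_rowE //=; case: ifP => _; last by rewrite permK.
by rewrite permJ permK.
Qed.

Lemma rowstab_tperm row x y : row x = row y -> tperm x y \in rowstab row.
Proof. by move=> E; apply/rowstabP=> i; case: tpermP => [->|->|]. Qed.

Lemma rowsign_tperm row x y : row x = row y -> x != y ->
  rowsign row (tperm x y) = (-1) ^+ (row x).1.
Proof.
move=> E nxy; have Hs := rowstab_tperm E.
case Ex: (row x).1.
  rewrite (@rowsignE _ _ (tperm x y)) ?odd_tperm ?nxy // => i.
  by case: tpermP => [->|->|]; rewrite -?E ?Ex // if_same.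
rewrite (@rowsignE _ _ 1%g) ?odd_perm1 // => i.
by rewrite perm1; case: tpermP => [->|->|]; rewrite -?E ?Ex // if_same.
Qed.

Lemma rowsignX row s k : s \in rowstab row -> rowsign row (s ^+ k)%g = rowsign row s ^+ k.
Proof.
move=> Hs; elim: k => [|k IH]; first by rewrite rowsign1.
by rewrite expgS exprS rowsignM ?groupX // IH.
Qed.

(** A sign with an odd power equal to 1 is 1. Hence block rotations, of order [p], act without sign
    in every kind of row. *)
Lemma rowsign_odd row s k : s \in rowstab row -> odd k -> (s ^+ k = 1)%g ->
  rowsign row s = 1.
Proof.
move=> Hs ok sk; have := rowsignX k Hs; rewrite sk rowsign1.
rewrite -(odd_double_half k) ok add1n exprS -mul2n exprM expr2 rowsign_sqr.
by rewrite expr1n mulr1.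
Qed.

End RowCharacter.

(** Transpositions generate the group, so the parity of a lifted permutation need only be computed
    on them; applied to [ptp] and [cellp]. *)
Lemma odd_perm_morph (A B : finType) (phi : {perm A} -> {perm B}) :
    (forall s t, phi (s * t)%g = (phi s * phi t)%g) ->
    (forall x y, x != y -> odd_perm (phi (tperm x y))) ->
  forall s, odd_perm (phi s) = odd_perm s.
Proof.
move=> phiM phiT s.
have phi1 : phi 1%g = 1%g by apply: (mulgI (phi 1%g)); rewrite -phiM !mulg1.
have [ts -> Hts] := prod_tpermP s.
elim: ts Hts => [|t ts IH] /=; first by rewrite !big_nil phi1 !odd_perm1.
case/andP=> Ht Hts; rewrite !big_cons phiM !odd_permM IH // phiT //.
by rewrite odd_tperm Ht.
Qed.

(** * Permutations of points and of blocks *)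

Section BlockPermutations.
Variables (r p n : nat) (Q : finType).
Local Notation pos := ('I_r + Q * 'I_p)%type.
Variables (th : pos -> 'I_n) (th' : 'I_n -> pos).
Hypotheses (thK : cancel th th') (th'K : cancel th' th).

Fact lft_inj (s : {perm pos}) : injective (th \o s \o th').
Proof.
move=> i j /= /(can_inj thK) /perm_inj; exact: (can_inj th'K).
Qed.
Definition lft s : 'S_n := perm (@lft_inj s).

Lemma lftE s o : lft s (th o) = th (s o).
Proof. by rewrite permE /= thK. Qed.

Definition pt_fun (y : 'S_r) (o : pos) : pos :=
  match o with inl i => inl (y i) | inr a => inr a end.
Definition cell_fun (c : {perm Q}) (o : pos) : pos :=
  match o with inl i => inl i | inr a => inr (c a.1, a.2) end.
Definition rot_fun (q : Q) (o : pos) : pos :=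
  match o with inl i => inl i
             | inr a => inr (a.1, if a.1 == q then ordS a.2 else a.2) end.

Fact pt_fun_inj y : injective (pt_fun y).
Proof. by move=> [i|a] [j|b] //= [] /perm_inj->. Qed.
Fact cell_fun_inj c : injective (cell_fun c).
Proof. by move=> [i|[q i]] [j|[q' j]] //= [] /perm_inj-> ->. Qed.
Fact rot_fun_inj q : injective (rot_fun q).
Proof.
move=> [i|[q1 i]] [j|[q2 j]] //= [] ->.
by case: eqP => _ => [/(can_inj (@ordSK _))|] ->.
Qed.

(** [ptp] embeds the symmetric group of the free points, [cellp] moves whole blocks without changing
    the position inside them, and the [rotp q] generate the elementary abelian group E. *)
Definition ptp y : 'S_n := lft (perm (@pt_fun_inj y)).
Definition cellp c : 'S_n := lft (perm (@cell_fun_inj c)).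
Definition rotp q : 'S_n := lft (perm (@rot_fun_inj q)).

Lemma ptpE y o : ptp y (th o) = th (pt_fun y o).
Proof. by rewrite lftE permE. Qed.
Lemma cellpE c o : cellp c (th o) = th (cell_fun c o).
Proof. by rewrite lftE permE. Qed.
Lemma rotpE q o : rotp q (th o) = th (rot_fun q o).
Proof. by rewrite lftE permE. Qed.

Lemma eq_on_th (s t : 'S_n) : (forall o, s (th o) = t (th o)) -> s = t.
Proof. by move=> st; apply/permP=> i; rewrite -(th'K i). Qed.

Lemma ptpM y z : ptp (y * z)%g = (ptp y * ptp z)%g.
Proof. by apply: eq_on_th => -[i|a]; rewrite permM !ptpE //= permM. Qed.
Lemma ptp1 : ptp 1%g = 1%g.
Proof. by apply: eq_on_th => -[i|a]; rewrite ptpE /= !perm1. Qed.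
Lemma ptpV y : ptp y^-1%g = (ptp y)^-1%g.
Proof. by apply: (mulgI (ptp y)); rewrite -ptpM !mulgV ptp1. Qed.
Lemma cellpM c d : cellp (c * d)%g = (cellp c * cellp d)%g.
Proof. by apply: eq_on_th => -[i|a]; rewrite permM !cellpE //= permM. Qed.
Lemma cellp1 : cellp 1%g = 1%g.
Proof. by apply: eq_on_th => -[i|[q j]]; rewrite cellpE /= !perm1. Qed.
Lemma cellpV c : cellp c^-1%g = (cellp c)^-1%g.
Proof. by apply: (mulgI (cellp c)); rewrite -cellpM !mulgV cellp1. Qed.

Lemma ptp_cellp y c : (ptp y * cellp c = cellp c * ptp y)%g.
Proof. by apply: eq_on_th => -[i|a]; rewrite !permM ?ptpE ?cellpE /= ?ptpE ?cellpE. Qed.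
Lemma ptp_rotp y q : (ptp y * rotp q = rotp q * ptp y)%g.
Proof. by apply: eq_on_th => -[i|a]; rewrite !permM ?ptpE ?rotpE /= ?ptpE ?rotpE. Qed.
Lemma cellp_rotp c q : (cellp c * rotp (c q) = rotp q * cellp c)%g.
Proof.
apply: eq_on_th => -[i|[q1 j]]; rewrite !permM ?cellpE ?rotpE /= ?cellpE ?rotpE //=.
by rewrite (inj_eq perm_inj).
Qed.

Lemma rotpC q q' : (rotp q * rotp q' = rotp q' * rotp q)%g.
Proof.
apply: eq_on_th => -[i|[q1 j]]; rewrite !permM ?rotpE /= ?rotpE //=.
by do 2![case: eqP].
Qed.

Lemma rotpX q k i (lt_ip : (i < p)%N) (lt_kp : ((i + k) %% p < p)%N) :
  (rotp q ^+ k)%g (th (inr (q, Ordinal lt_ip))) = th (inr (q, Ordinal lt_kp)).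
Proof.
elim: k lt_kp => [|k IH] lt_kp.
  by rewrite expg0 perm1; congr (th (inr (_, _))); apply: val_inj; rewrite /= addn0 modn_small.
have lt_kp' : ((i + k) %% p < p)%N by exact: ltn_pmod (leq_ltn_trans (leq0n _) lt_ip).
rewrite expgSr permM (IH lt_kp') rotpE /= eqxx; congr (th (inr (_, _))).
by apply: val_inj; rewrite /= -addn1 modnDml addn1 addnS.
Qed.

Lemma rotp_order q : (rotp q ^+ p = 1)%g.
Proof.
apply: eq_on_th => -[i|[q1 [j lt_jp]]]; rewrite perm1.
  by elim: {1}p => [|k IH]; [exact: perm1 | by rewrite expgSr permM IH rotpE].
have [->|nq] := eqVneq q1 q.
  have lt_kp : ((j + p) %% p < p)%N by rewrite modnDr ltn_pmod // (leq_ltn_trans (leq0n _) lt_jp).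
  rewrite (rotpX q lt_jp lt_kp); congr (th (inr (_, _))).
  by apply: val_inj; rewrite /= modnDr modn_small.
by elim: {1}p => [|k IH]; [exact: perm1 | by rewrite expgSr permM IH rotpE /= (negPf nq)].
Qed.

Lemma odd_ptp y : odd_perm (ptp y) = odd_perm y.
Proof.
apply: (odd_perm_morph ptpM) => i j nij.
have -> : ptp (tperm i j) = tperm (th (inl i)) (th (inl j)).
  apply: eq_on_th => o; rewrite ptpE; case: o => [k|a] /=.
    by case: (tpermP i j k) => [->|->|/eqP ni /eqP nj]; rewrite ?tpermL ?tpermR //
       tpermD // (inj_eq (can_inj thK)) eq_sym.
  by rewrite tpermD // (inj_eq (can_inj thK)).
by rewrite odd_tperm (inj_eq (can_inj thK)).
Qed.

Lemma cellp_tperm q q' : q != q' ->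
  cellp (tperm q q') = (\prod_(j < p) tperm (th (inr (q, j))) (th (inr (q', j))))%g.
Proof.
move=> nq; pose st j := tperm (th (inr (q, j))) (th (inr (q', j))).
have stl j i : st j (th (inl i)) = th (inl i).
  by rewrite tpermD // (inj_eq (can_inj thK)).
have str j q1 k : st j (th (inr (q1, k))) =
    th (inr (if j == k then tperm q q' q1 else q1, k)).
  have [->|njk] := eqVneq j k; last first.
    by rewrite tpermD // (inj_eq (can_inj thK)); apply: contraNneq njk => -[_ ->].
  case: (tpermP q q' q1) => [->|->|n1 n2]; rewrite /st ?tpermL ?tpermR //.
  by rewrite tpermD // (inj_eq (can_inj thK)); apply/eqP => -[] /esym.
(* Partial products over any duplicate-free list of positions, so that the transpositions can be
   multiplied in one at a time. *)
have gen (js : seq 'I_p) o : uniq js ->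
  (\prod_(j <- js) st j)%g (th o) =
  th (match o with inl i => inl i
       | inr a => inr (if a.2 \in js then tperm q q' a.1 else a.1, a.2) end).
  elim: js o => [|j js IH] o /=.
    by move=> _; case: o => [i|[q1 k]]; rewrite big_nil perm1.
  case/andP=> nj ujs; rewrite big_cons permM; case: o => [i|[q1 k]].
    by rewrite stl IH.
  rewrite str IH //= inE (eq_sym k); have [<-|njk] //= := eqVneq j k.
  by rewrite (negPf nj).
apply: eq_on_th => o; rewrite gen ?index_enum_uniq // cellpE.
by case: o => // -[q1 j] /=; rewrite mem_index_enum.
Qed.

(** A swap of two blocks is a product of [p] transpositions, hence odd; so a sign read on points
    agrees with the sign read on cells. *)
Lemma odd_cellp c : odd p -> odd_perm (cellp c) = odd_perm c.
Proof.
move=> op; apply: (odd_perm_morph cellpM) => q q' nq.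
rewrite cellp_tperm // (big_morph (@odd_perm _) (@odd_permM _) (odd_perm1 _)).
rewrite (eq_bigr (fun=> true)) => [|j _]; last first.
  rewrite odd_tperm (inj_eq (can_inj thK)); apply: contraNneq nq => -[->] //.
rewrite big_const card_ord.
have iter_addb k : iter k (addb true) false = odd k by elim: k => //= k ->.
by rewrite iter_addb.
Qed.

End BlockPermutations.

Section LiftedSigns.
Variables (F : fieldType) (r p n : nat) (Q : finType).
Local Notation pos := ('I_r + Q * 'I_p)%type.
Variables (th : pos -> 'I_n) (th' : 'I_n -> pos).
Hypotheses (thK : cancel th th') (th'K : cancel th' th).
Variables (T : eqType) (row : 'I_n -> bool * T).
Local Notation ptp := (ptp thK th'K).
Local Notation cellp := (cellp thK th'K).
Local Notation rotp := (rotp thK th'K).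
Local Notation ptrow := (fun i => row (th (inl i))).

Lemma rowstab_th (s : 'S_n) :
  (forall o, row (s (th o)) = row (th o)) -> s \in rowstab row.
Proof. by move=> H; apply/rowstabP=> i; rewrite -(th'K i). Qed.

Lemma rowstab_ptp y : (ptp y \in rowstab row) = (y \in rowstab ptrow).
Proof.
apply/idP/rowstabP => [/rowstabP H i|H].
  by have := H (th (inl i)); rewrite ptpE.
by apply: rowstab_th => -[i|a]; rewrite ptpE //= H.
Qed.

Lemma rowsign_ptp y : y \in rowstab ptrow ->
  rowsign F row (ptp y) = rowsign F ptrow y.
Proof.
move=> Hy; rewrite [RHS]/rowsign -(odd_ptp thK th'K); apply: rowsignE.
  by rewrite rowstab_ptp.
move=> i; rewrite -(th'K i); case: (th' i) => [k|a]; rewrite !ptpE /= ?if_same //.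
by rewrite restr_rowE //; case: ifP.
Qed.

Lemma rowstab_cell_swap q q' : odd p -> q != q' ->
    (forall j k, row (th (inr (q, j))) = row (th (inr (q', k)))) ->
  cellp (tperm q q') \in rowstab row /\
  (forall j, rowsign F row (cellp (tperm q q')) = (-1) ^+ (row (th (inr (q, j)))).1).
Proof.
move=> op nq E.
have Hc : cellp (tperm q q') \in rowstab row.
  apply: rowstab_th => -[i|[q1 j]]; rewrite cellpE //=.
  by case: tpermP => [->|->|//]; rewrite (E j j).
split=> // j; case Ej: (row (th (inr (q, j)))).1.
  rewrite (@rowsignE _ _ _ _ _ (cellp (tperm q q'))) //.
    by rewrite (odd_cellp thK th'K _ op) odd_tperm nq.
  move=> i; rewrite -(th'K i); case: (th' i) => [k|[q1 k]]; rewrite !cellpE /= ?if_same //.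
  by case: tpermP => [->|->|_ _]; rewrite ?if_same // -?(E j k) ?Ej // (E k k) -(E j k) Ej.
rewrite (@rowsignE _ _ _ _ _ 1%g) ?odd_perm1 // => i; rewrite perm1.
rewrite -(th'K i); case: (th' i) => [k|[q1 k]]; rewrite !cellpE /= ?if_same //.
by case: tpermP => [->|->|_ _]; rewrite ?if_same // -?(E j k) ?Ej // (E k k) -(E j k) Ej.
Qed.

Lemma rowstab_rotp q : (rotp q \in rowstab row) ->
  forall j k, row (th (inr (q, j))) = row (th (inr (q, k))).
Proof.
move=> /rowstabP H; suff E (j : 'I_p) (p_gt0 : (0 < p)%N) :
    row (th (inr (q, j))) = row (th (inr (q, Ordinal p_gt0))).
  move=> j k; have p_gt0 : (0 < p)%N by apply: leq_ltn_trans (ltn_ord j).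
  by rewrite !(E _ p_gt0).
case: j => m; elim: m => [|m IH] lt_mp; first by congr (row (th (inr (_, _)))); apply: val_inj.
rewrite -(IH (ltnW lt_mp)) -(H (th (inr (q, Ordinal (ltnW lt_mp))))) rotpE /= eqxx.
by congr (row (th (inr (_, _)))); apply: val_inj; rewrite /= modn_small.
Qed.

Lemma rotp_rowstab q : (forall j k, row (th (inr (q, j))) = row (th (inr (q, k)))) ->
  rotp q \in rowstab row.
Proof.
move=> E; apply: rowstab_th => -[i|[q1 j]]; rewrite rotpE //=.
by case: eqP => // ->; apply: E.
Qed.

Lemma rowsign_rotp q : odd p -> rotp q \in rowstab row -> rowsign F row (rotp q) = 1.
Proof. by move=> op Hq; apply: (rowsign_odd F Hq op); apply: rotp_order. Qed.

End LiftedSigns.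

(** * Dominance and rigidity of fillings *)

Section Diagram.
Variables (P : finType) (C : eqType) (row : P -> nat) (col : P -> C) (f : P -> nat).
Hypothesis col_init : forall x i, (i <= row x)%N ->
  exists2 y, col y = col x & row y = i.
Hypothesis f_colinj : forall x y, col x = col y -> f x = f y -> x = y.

(** If the column reaches row [k], it has [k] cells in the rows before, while [f], being injective
    on it, takes at most [k] values below [k]. A shorter column is counted entirely on the right. *)
Lemma column_count x0 k :
  (#|[set x | (col x == col x0) && (f x < k)%N]|
     <= #|[set x | (col x == col x0) && (row x < k)%N]|)%N.
Proof.
have [/existsP[x /andP[/eqP cx kx]] | /existsPn nx] :=
  boolP [exists x, (col x == col x0) && (k <= row x)%N]; last first.
  apply/subset_leq_card/subsetP=> x; rewrite !inE => /andP[cx _].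
  by have := nx x; rewrite cx -ltnNge.
apply: (@leq_trans k).
  (* [inord] needs a nonempty target, so [k = 0] is treated apart. *)
  case: k kx => [|k] _; first by rewrite leqn0 cards_eq0; apply/eqP/setP=> y; rewrite !inE andbF.
  rewrite -[X in (_ <= X)%N](card_ord k.+1) -(card_in_imset (f := fun x => inord (f x) : 'I_k.+1)).
    exact: max_card.
  move=> y z; rewrite !inE => /andP[/eqP cy ky] /andP[/eqP cz kz] /(congr1 val) /=.
  by rewrite !inordK // => /f_colinj -> //; rewrite cy cz.
have ex (i : 'I_k) : exists y, (col y == col x0) && (row y == i).
  have [|y cy ry] := @col_init x i; first by apply: leq_trans kx; apply: ltnW.
  by exists y; rewrite cy cx ry !eqxx.
rewrite -[X in (X <= _)%N](card_ord k) -(card_imset (f := fun i => xchoose (ex i))).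
  apply/subset_leq_card/subsetP=> y /imsetP[i _ ->]; rewrite inE.
  by have /andP[-> /eqP->] := xchooseP (ex i); rewrite ltn_ord.
move=> i j eqij; apply: ord_inj; have /andP[_ /eqP ri] := xchooseP (ex i).
by have /andP[_ /eqP rj] := xchooseP (ex j); rewrite -ri -rj eqij.
Qed.

(** Column labels live in a mere [eqType], so sums over columns are indexed by chosen
    representatives, the fixed points of [colrep]. *)
Let colrep x := odflt x [pick y | col y == col x].

Let colrepE x : col (colrep x) = col x.
Proof. by rewrite /colrep; case: pickP => //= y /eqP. Qed.

Let colrep_eq x y : (colrep x == colrep y) = (col x == col y).
Proof.
apply/eqP/eqP => [|E]; first by move/(congr1 col); rewrite !colrepE.
rewrite /colrep E; case: pickP => //= /(_ y); by rewrite eqxx.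
Qed.

Lemma card_columns (A : pred C) (g : P -> nat) k :
  #|[set x | A (col x) && (g x < k)%N]| =
  \sum_(x0 | (colrep x0 == x0) && A (col x0)) #|[set x | (col x == col x0) && (g x < k)%N]|.
Proof.
rewrite -sum1_card (partition_big colrep (fun x0 => (colrep x0 == x0) && A (col x0))) /=.
  apply: eq_bigr => x0 /andP[/eqP cx0 Ax0]; rewrite -sum1_card; apply: eq_bigl => x.
  rewrite !inE -{1}cx0 colrep_eq; case: eqP => [->|_]; by rewrite ?andbF // Ax0 andbT.
by move=> x; rewrite inE => /andP[Ax _]; rewrite colrepE Ax -{2}[x]/x colrep_eq colrepE eqxx.
Qed.

Lemma diagram_dominance (A : pred C) k :
  (#|[set x | A (col x) && (f x < k)%N]| <= #|[set x | A (col x) && (row x < k)%N]|)%N.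
Proof. by rewrite !card_columns; apply: leq_sum => x0 _; apply: column_count. Qed.

(** Equal totals turn the columnwise inequalities into equalities, so on each column [f] takes
    exactly the row numbers of that column. This is the classical fact that a column-injective
    filling whose content is the shape is a column permutation of the row filling. *)
Lemma diagram_rigidity :
    (forall k, #|[set x | (f x < k)%N]| = #|[set x | (row x < k)%N]|) ->
  exists c : {perm P}, forall x, col (c x) = col x /\ row (c x) = f x.
Proof.
move=> eqfr.
have eqcol x0 k : #|[set x | (col x == col x0) && (f x < k)%N]|
     = #|[set x | (col x == col x0) && (row x < k)%N]|.
  pose cnt (g : P -> nat) x0 := #|[set x | (col x == col x0) && (g x < k)%N]|.
  have tot (g : P -> nat) : #|[set x | (g x < k)%N]| = \sum_(x0 | colrep x0 == x0) cnt g x0.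
    by have /= := card_columns predT g k; under eq_bigl do rewrite andbT.
  have := eqfr k; rewrite !tot => eqS.
  have /leqif_sum : forall x0, colrep x0 == x0 ->
      (cnt f x0 <= cnt row x0 ?= iff (cnt f x0 == cnt row x0))%N.
    by move=> y _; split=> //; apply: column_count.
  move=> [_]; rewrite eqS eqxx => /esym /forall_inP H.
  have := H (colrep x0); rewrite colrep_eq colrepE eqxx => /(_ isT) /eqP.
  by rewrite /cnt colrepE.
(* If row [f x] were missing from the column of [x], the row counts below [f x] and below [(f x).+1]
   would agree, whereas [x] itself separates the two counts for [f]. *)
have ex x : exists y, (col y == col x) && (row y == f x).
  apply/existsP; apply: contraT => /existsPn nx.
  have := eqcol x (f x).+1.
  have -> : [set y | (col y == col x) && (row y < (f x).+1)%N] =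
            [set y | (col y == col x) && (row y < f x)%N].
    by apply/setP=> y; rewrite !inE ltnS leq_eqVlt; have := nx y; case: eqP => //= _ /negPf->.
  rewrite -eqcol => /eqP; rewrite eq_sym eqn_leq => /andP[_].
  rewrite leqNgt => /negP[]; apply: proper_card; apply/properP; split.
    by apply/subsetP=> y; rewrite !inE => /andP[-> /ltnW]; rewrite ltnS.
  by exists x; rewrite !inE eqxx ?ltnSn ?ltnn.
pose c x := xchoose (ex x).
have cP x : col (c x) = col x /\ row (c x) = f x.
  by have /andP[/eqP-> /eqP->] := xchooseP (ex x).
have c_inj : injective c.
  move=> x y cxy; have [cx rx] := cP x; have [cy ry] := cP y.
  by apply: f_colinj; rewrite -?cx -?cy -?rx -?ry cxy.
by exists (perm c_inj) => x; rewrite permE.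
Qed.

End Diagram.

(** * Column reversal of a diagram and its factorisations *)

Section ColumnReversal.
Local Open Scope nat_scope.
Variables (P : finType) (row col : P -> nat).
Hypothesis rowcol_inj : forall x y, row x = row y -> col x = col y -> x = y.
Hypothesis col_init : forall x i, i <= row x -> exists2 y, col y = col x & row y = i.

Definition collen x := #|[set y | col y == col x]|.

Lemma eq_collen x y : col x = col y -> collen x = collen y.
Proof. by rewrite /collen => ->. Qed.

Lemma row_lt_collen x : row x < collen x.
Proof.
have ex (i : 'I_(row x).+1) : exists y, (col y == col x) && (row y == i).
  have [|y cy ry] := @col_init x i; first by rewrite -ltnS.
  by exists y; rewrite cy ry !eqxx.
rewrite /collen -[X in X <= _](card_ord (row x).+1).
rewrite -(card_imset (f := fun i => xchoose (ex i))).
  apply/subset_leq_card/subsetP=> y /imsetP[i _ ->]; rewrite inE.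
  by have /andP[-> _] := xchooseP (ex i).
move=> i j eqij; apply: ord_inj; have /andP[_ /eqP ri] := xchooseP (ex i).
by have /andP[_ /eqP rj] := xchooseP (ex j); rewrite -ri -rj eqij.
Qed.

Lemma collen_row x i : i < collen x -> exists2 y, col y = col x & row y = i.
Proof.
move=> Hi; have [/existsP[y /andP[/eqP cy iy]] | /existsPn nx] :=
  boolP [exists y, (col y == col x) && (i <= row y)].
  by have [z cz rz] := col_init iy; exists z; rewrite ?cz.
have [y _] : exists2 y, col y = col x & row y = 0 by apply: (@col_init x 0).
case: i => [|i] in Hi nx *; first by have := nx x; rewrite eqxx.
suff : collen x <= i.+1 by rewrite leqNgt Hi.
rewrite -[X in _ <= X](card_ord i.+1) /collen.
rewrite -(card_in_imset (f := fun z => inord (row z) : 'I_i.+1)); first exact: max_card.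
move=> z t; rewrite !inE => /eqP cz /eqP ct /(congr1 val) /=.
have := nx z; have := nx t; rewrite cz ct !eqxx /= -!ltnNge => lt_t lt_z.
by rewrite !inordK // => /rowcol_inj -> //; rewrite cz ct.
Qed.

Lemma column_reversal_exists :
  exists w : {perm P}, forall x, col (w x) = col x /\ row (w x) = collen x - (row x).+1.
Proof.
have ex x : exists y, (col y == col x) && (row y == collen x - (row x).+1).
  have [|y cy ry] := @collen_row x (collen x - (row x).+1).
    by have := row_lt_collen x; lia.
  by exists y; rewrite cy ry !eqxx.
pose w x := xchoose (ex x).
have wP x : col (w x) = col x /\ row (w x) = collen x - (row x).+1.
  by have /andP[/eqP-> /eqP->] := xchooseP (ex x).
have w_inj : injective w.
  move=> x y E; have [cx rx] := wP x; have [cy ry] := wP y.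
  have cxy : col x = col y by rewrite -cx E.
  apply: rowcol_inj => //; have := row_lt_collen x; have := row_lt_collen y.
  by move: rx ry; rewrite E (eq_collen cxy) => ->; lia.
by exists (perm w_inj) => x; rewrite permE.
Qed.

Variable w : {perm P}.
Hypothesis wP : forall x, col (w x) = col x /\ row (w x) = collen x - (row x).+1.

Lemma reversal_involutive x : w (w x) = x.
Proof.
have [c1 r1] := wP x; have [c2 r2] := wP (w x).
apply: rowcol_inj; last by rewrite c2.
by rewrite r2 r1 (eq_collen c1); have := row_lt_collen x; lia.
Qed.

(* Induction on the row [i]: a cell sent to a shorter column would have to land, in
   its row, among the cells of columns of that length, and these places are already
   taken by the images of cells of rows above [i]. *)
Lemma factor_reversal (r c r' : {perm P}) :
    (forall x, row (r x) = row x) -> (forall x, col (c x) = col x) ->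
    (forall x, row (r' x) = row x) -> (r * c * r' = w)%g ->
  forall x, collen (r x) = collen x.
Proof.
move=> Hr Hc Hr' Hw; pose q := (r'^-1)%g.
have Hq x : row (q x) = row x by rewrite -{2}(permKV r' x) Hr'.
have qw x : collen (q (w x)) = collen (r x).
  by rewrite -Hw !permM permK; apply: eq_collen; rewrite Hc.
have cw x : collen (w x) = collen x by apply: eq_collen; case: (wP x).
suff main i : forall x, row x = i -> collen (r x) = collen x by move=> x; apply: main.
elim/ltn_ind: i => i IH.
have ge x : row x = i -> collen x <= collen (r x).
  move=> rx; rewrite leqNgt; apply/negP => lt_len.
  pose z := q (w x); have rz : row z = collen x - i.+1 by rewrite Hq (wP x).2 rx.
  have lz : collen z = collen (r x) by apply: qw.
  pose B := [set z' | (row z' == row z) && (collen z' == collen z)].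
  have qB z' : z' \in B -> q z' \in B.
    rewrite !inE Hq => /andP[/eqP rz' /eqP lz']; rewrite rz' eqxx; apply/eqP.
    rewrite -{1}(reversal_involutive z') qw -lz' -(cw z'); apply: IH (erefl _).
    by rewrite (wP z').2 lz' rz' rz lz; have := row_lt_collen z; rewrite rz lz; lia.
  have imB : [set q z' | z' in B] = B.
    apply/eqP; rewrite eqEcard card_imset ?leqnn ?andbT; last exact: perm_inj.
    by apply/subsetP=> _ /imsetP[z' Hz' ->]; apply: qB.
  have : z \in B by rewrite inE !eqxx.
  rewrite -imB => /imsetP[z' Hz' /perm_inj Ez']; move: Hz'; rewrite -Ez' inE => /andP[_].
  by rewrite cw lz eq_sym (ltn_eqF lt_len).
(* [r] permutes row [i], so the column lengths have the same sum before and after [r], and the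
   inequalities [ge] must be equalities. *)
have := leqif_sum (P := fun x => row x == i) (E1 := collen) (E2 := fun x => collen (r x))
  (C := fun x => collen x == collen (r x)).
case=> [x /eqP rx|_]; first by split=> //; apply: ge.
rewrite [X in X == _](reindex_inj (@perm_inj _ r)) /=.
rewrite (eq_bigl (fun x => row x == i)) => [|x]; last by rewrite Hr.
by rewrite eqxx => /esym/forall_inP H x rx; apply/esym/eqP/H/eqP.
Qed.

End ColumnReversal.

(** By Cauchy there would be an element of order [p]; it has an orbit of [p] points, all carrying
    the same label. *)
Lemma rowstab_order_prime p (P : finType) (T : eqType) (lab : P -> bool * T) :
    prime p -> (forall x, #|[set y | lab y == lab x]| < p)%N ->
  ~~ (p %| #|rowstab lab|)%N.
Proof.
move=> p_pr Hfib; apply/negP => /(Cauchy p_pr)[s /rowstabP Hs os].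
have [/forallP fix_s|/forallPn[x nx]] := boolP [forall x, s x == x].
  have s1 : s = 1%g by apply/permP=> x; rewrite perm1; apply/eqP.
  by move: os p_pr; rewrite s1 order1 => <-.
have := Hfib x; rewrite ltnNge => /negP[].
have -> : p = #|porbit s x|.
  have [_ /(_ #|porbit s x|)] := primeP p_pr.
  rewrite {1}porbitE -{1}os dvdn_orbit => /(_ isT)/orP[/eqP c1|/eqP->//].
  by case/negP: nx; have := iter_porbit s x; rewrite c1 /= => ->.
apply/subset_leq_card/subsetP=> y /porbitP[i ->]; rewrite inE.
elim: i => [|i IH]; first by rewrite expg0 perm1.
by rewrite expgSr permM Hs.
Qed.

(** * Sums over cosets *)

Section CosetSums.
Variables (gT : finGroupType) (K : {group gT}) (V : zmodType) (f : gT -> V).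
Hypothesis fK : forall s h, h \in K -> f (s * h)%g = f s.
Local Notation cosets := (lcosets K [set: gT]).

Lemma coset_const s t : s \in (t *: K)%g -> f s = f t.
Proof. by case/lcosetP=> h Hh ->; apply: fK. Qed.

Lemma coset_repr s : f (repr (s *: K)%g) = f s.
Proof. by apply: coset_const; apply: mem_repr (lcoset_refl _ _). Qed.

Lemma lcosets_lcoset s A : ((s *: A)%g \in cosets) = (A \in cosets).
Proof.
suff imp t B : B \in cosets -> (t *: B)%g \in cosets.
  by apply/idP/idP=> [/(imp s^-1%g)|/imp//]; rewrite -lcosetM mulVg lcoset1.
by case/lcosetsP=> x _ ->; apply/lcosetsP; exists (t * x)%g; rewrite ?inE // lcosetM.
Qed.

Lemma mem_cosets s : (s *: K)%g \in cosets.
Proof. by apply/lcosetsP; exists s; rewrite ?inE. Qed.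

Lemma coset_sum_shift t :
  \sum_(A in cosets) f (t * repr A)%g = \sum_(A in cosets) f (repr A).
Proof.
rewrite [RHS](reindex_inj (@lcoset_inj _ t)) /=.
rewrite [RHS](eq_bigl (fun A => A \in cosets)) => [|A]; last by rewrite lcosets_lcoset.
apply: eq_bigr => A /lcosetsP[x _ ->]; rewrite -lcosetM coset_repr.
by apply: coset_const; rewrite lcosetM mem_lcoset mulKg (mem_repr x) ?lcoset_refl.
Qed.

Lemma coset_sum1 t : (forall s, s \notin (t *: K)%g -> f s = 0) ->
  \sum_(A in cosets) f (repr A) = f t.
Proof.
move=> f0; rewrite (bigD1 (t *: K)%g) ?mem_cosets //= coset_repr.
rewrite big1 ?addr0 // => A /andP[/lcosetsP[x _ ->] nx]; rewrite coset_repr f0 //.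
by apply: contraNN nx => /lcoset_eqP ->.
Qed.

(* Cosets moved by a permutation of order [p] contribute multiples of [p]. *)
Lemma sum_fixed_points (I : finType) (g : I -> V) p (pi : I -> I) (S : pred I) :
    prime p -> (forall v : V, v *+ p = 0) -> (forall i, iter p pi i = i) ->
    (forall i, S (pi i) = S i) -> (forall i, S i -> g (pi i) = g i) ->
  \sum_(i | S i) g i = \sum_(i | S i && (pi i == i)) g i.
Proof.
move=> p_pr pV pi_p S_pi g_pi; rewrite (bigID (fun i => pi i == i)) /= -[RHS]addr0.
congr (_ + _).
have pi_inj : injective pi.
  have p_gt0 := prime_gt0 p_pr; move=> i j Eij; rewrite -(pi_p i) -(pi_p j).
  by rewrite -(prednK p_gt0) !iterSr Eij.
pose P := perm pi_inj.
have PX k i : (P ^+ k)%g i = iter k pi i.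
  by elim: k => [|k IH]; rewrite ?expg0 ?perm1 // expgSr permM IH permE.
have Pp : (#[P]%g %| p)%N by rewrite order_dvdn; apply/eqP/permP=> i; rewrite PX perm1.
have inv_orb (T : Type) (h : I -> T) : (forall i, h (pi i) = h i) ->
    forall i j, i \in porbit P j -> h i = h j.
  move=> h_pi i j /porbitP[k ->]; rewrite PX.
  by elim: k => //= k <-.
rewrite (partition_big_imset (porbit P)) big1 //= => _ /imsetP[x /andP[Sx nx] ->].
rewrite (eq_bigl (mem (porbit P x))) => [|i]; last first.
  rewrite eq_porbit_mem andb_idl // => Hi.
  rewrite unfold_in /= (inv_orb _ S S_pi _ _ Hi) Sx /=; apply: contraNN nx => /eqP ni.
  have : porbit P i = [set i].
    apply/setP=> j; rewrite inE; apply/idP/eqP => [|->]; last exact: porbit_id.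
    by case/porbitP=> k ->; rewrite PX; elim: k => //= k ->.
  move/setP/(_ x); rewrite inE porbit_sym Hi => /esym/eqP ->; exact/eqP.
rewrite (eq_bigr (fun=> g x)) => [|i Hi]; last first.
  have := inv_orb _ (fun i => if S i then g i else 0) _ _ _ Hi.
  rewrite (inv_orb _ S S_pi _ _ Hi) Sx; apply=> j; rewrite S_pi.
  by case: ifP => // /g_pi.
have [] := primeP p_pr; move=> _ /(_ #|porbit P x|).
have -> : (#|porbit P x| %| p)%N by rewrite porbitE; apply: dvdn_trans (dvdn_orbit _ _ _) _.
case/(_ isT)/orP => /eqP Ec; last by rewrite sumr_const Ec pV.
case/negP: nx; have := iter_porbit P x; rewrite Ec /= permE => ->; exact: eqxx.
Qed.

(** The elements of [es] are imposed one at a time; commutation lets each of them permute the cosets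
    fixed by the others. *)
Lemma coset_sum_fixed p (es : seq gT) :
    prime p -> (forall v : V, v *+ p = 0) ->
    {in es, forall e, (e ^+ p = 1)%g} -> {in es &, forall e e', (e * e' = e' * e)%g} ->
    {in es, forall e s, f (e * s)%g = f s} ->
  \sum_(A in cosets) f (repr A) =
  \sum_(A in cosets | all (fun e => (e *: A)%g == A) es) f (repr A).
Proof.
move=> p_pr pV; elim: es => [|e es IH] ep ec fe.
  by apply: eq_bigl => A; rewrite andbT.
rewrite IH; last 3 first.
- by move=> e' He'; apply: ep; rewrite inE He' orbT.
- by move=> e' e'' He' He''; apply: ec; rewrite inE ?He' ?He'' orbT.
- by move=> e' He'; apply: fe; rewrite inE He' orbT.
rewrite (@sum_fixed_points _ (fun A => f (repr A)) p (fun A => (e *: A)%g)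
           (fun A => (A \in cosets) && all (fun e0 => (e0 *: A)%g == A) es)) //.
- by apply: eq_bigl => A /=; case: (A \in _) => //=; rewrite andbC.
- move=> A; have -> : forall k, iter k (fun B => (e *: B)%g) A = (e ^+ k *: A)%g.
    by elim=> [|k IHk] /=; rewrite ?expg0 ?lcoset1 // IHk expgS lcosetM.
  by rewrite ep ?mem_head // lcoset1.
- move=> A; rewrite lcosets_lcoset; congr (_ && _); apply: eq_in_all => e' He'.
  rewrite -lcosetM -ec ?inE ?eqxx ?He' ?orbT // lcosetM.
  by rewrite (inj_eq (@lcoset_inj _ e)).
- move=> A /andP[/lcosetsP[x _ ->] _]; rewrite -lcosetM !coset_repr.
  by rewrite fe ?mem_head.
Qed.
End CosetSums.

(** * Signed permutation modules *)

Section Intertwiners.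
Variables (F : fieldType) (gT : finGroupType) (G : {group gT}).

(** Modules act on row vectors, so [B *m C] means [B] followed by [C], and [f *m g] below is a
    composite N -> Z -> N. *)
Definition intertwines d1 d2 (r1 : mx_representation F G d1)
    (r2 : mx_representation F G d2) (B : 'M[F]_(d1, d2)) :=
  forall g, g \in G -> r1 g *m B = B *m r2 g.

Lemma intertwinesM d1 d2 d3 (r1 : mx_representation F G d1)
    (r2 : mx_representation F G d2) (r3 : mx_representation F G d3) B C :
  intertwines r1 r2 B -> intertwines r2 r3 C -> intertwines r1 r3 (B *m C).
Proof. by move=> hB hC g Gg; rewrite mulmxA hB // -!mulmxA hC. Qed.

Lemma intertwines1 d (r : mx_representation F G d) : intertwines r r 1%:M.
Proof. by move=> g _; rewrite mulmx1 mul1mx. Qed.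

Lemma intertwinesX d (r : mx_representation F G d) (B : 'M_d) k :
  intertwines r r B -> intertwines r r (B ^+ k).
Proof.
move=> hB; elim: k => [|k IH]; first exact: intertwines1.
by rewrite exprS; exact: intertwinesM hB IH.
Qed.
End Intertwiners.

Section SymmetricGroupRepr.
Variables (F : fieldType) (n d : nat) (rG : mx_representation F (SymG n) d).

Lemma SymG_in (g : 'S_n) : g \in SymG n. Proof. by rewrite inE. Qed.

Lemma reprM (g h : 'S_n) : rG (g * h)%g = rG g *m rG h.
Proof. by rewrite repr_mxM ?SymG_in. Qed.

Lemma reprVM (g : 'S_n) : rG g^-1%g *m rG g = 1%:M.
Proof. by rewrite -reprM mulVg repr_mx1. Qed.

End SymmetricGroupRepr.

Section MonomialModules.
Variables (F : fieldType) (n : nat) (T : eqType).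
Implicit Type row : 'I_n -> bool * T.

(* [rG] is the induced module of [rowsign row] from [rowstab row]: [v] spans the
   inducing line and [e] is the coordinate along [v]. *)
Definition monomial row d (rG : mx_representation F (SymG n) d)
    (v : 'rV[F]_d) (e : 'cV[F]_d) : Prop :=
  [/\ {in rowstab row, forall h, v *m rG h = rowsign F row h *: v},
      forall g, v *m rG g *m e = (if g \in rowstab row then rowsign F row g else 0)%:M
    & forall k (B : 'M[F]_(d, k)), (forall g, v *m rG g *m B = 0) -> B = 0].

Variables (d : nat) (rG : mx_representation F (SymG n) d).
Variables (row : 'I_n -> bool * T) (v : 'rV[F]_d) (e : 'cV[F]_d).

Hypothesis mon : monomial row rG v e.

(** The third clause of [monomial] allows testing the identity on the translates of [v], where the
    second clause gives both sides. *)
Lemma monomial_coord : {in rowstab row, forall h, rG h *m e = rowsign F row h *: e}.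
Proof.
case: mon => mv me msp h Hh; apply/eqP; rewrite -subr_eq0; apply/eqP/msp => g.
rewrite mulmxBr mulmxA -(mulmxA v) -reprM me -scalemxAr me groupMr //.
case: ifP => Hg; last by rewrite raddf0 scaler0 subrr.
by rewrite rowsignM // scale_scalar_mx mulrC subrr.
Qed.

Local Notation cosets := (lcosets (rowstab row) [set: 'S_n]).

Section FromInduced.
Variables (d' d2 : nat) (r' : mx_representation F (SymG n) d')
  (r2 : mx_representation F (SymG n) d2) (eta : 'cV[F]_d') (u : 'rV[F]_d2).
Hypothesis eta_eq : {in rowstab row, forall h, r' h *m eta = rowsign F row h *: eta}.
Hypothesis u_eq : {in rowstab row, forall h, u *m r2 h = rowsign F row h *: u}.

(** [frob_hom] is the relative trace of the rank-one map [eta *m u]. Both forms of Frobenius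
    reciprocity are instances: with [eta = e] it is the map out of the induced module sending [v] to
    [u], with [u = v] the map into it whose coordinate along [v] is [eta]. *)
Definition frob_term s := r' s *m eta *m (u *m r2 s^-1%g).
Definition frob_hom := \sum_(A in cosets) frob_term (repr A).

Lemma frob_termK s h : h \in rowstab row -> frob_term (s * h)%g = frob_term s.
Proof.
move=> Hh; rewrite /frob_term invMg repr_mxM ?SymG_in // repr_mxM ?SymG_in //.
rewrite -(mulmxA (r' s)) eta_eq // (mulmxA u) u_eq ?groupV // rowsignV //.
by rewrite -scalemxAr -!scalemxAl -scalemxAr scalerA rowsign_sqr scale1r.
Qed.

Lemma frob_intertwines : intertwines r' r2 frob_hom.
Proof.
move=> g _; rewrite /frob_hom -[in RHS](coset_sum_shift frob_termK g).
rewrite mulmx_sumr mulmx_suml; apply: eq_bigr => A _.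
rewrite /frob_term invMg !repr_mxM ?SymG_in // !mulmxA.
by rewrite -(mulmxA _ (r2 g^-1%g) (r2 g)) reprVM mulmx1.
Qed.
End FromInduced.

Lemma frob_eval d2 (r2 : mx_representation F (SymG n) d2) (u : 'rV_d2) :
    {in rowstab row, forall h, u *m r2 h = rowsign F row h *: u} ->
  v *m frob_hom rG r2 e u = u.
Proof.
case: (mon) => mv me msp hu; rewrite mulmx_sumr.
rewrite (@coset_sum1 _ _ _ (fun s => v *m frob_term rG r2 e u s) _ 1%g).
- by rewrite /frob_term !mulmxA me group1 rowsign1 mul1mx invg1 repr_mx1 mulmx1.
- by move=> s h Hh; rewrite frob_termK //; apply: monomial_coord.
move=> s; rewrite lcoset1 => /negPf Hs.
by rewrite /frob_term !mulmxA me Hs raddf0 !mul0mx.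
Qed.

Lemma frob_coeval d' (r' : mx_representation F (SymG n) d') (eta : 'cV_d') :
    {in rowstab row, forall h, r' h *m eta = rowsign F row h *: eta} ->
  frob_hom r' rG eta v *m e = eta.
Proof.
case: (mon) => mv me msp hu; rewrite mulmx_suml.
rewrite (@coset_sum1 _ _ _ (fun s => frob_term r' rG eta v s *m e) _ 1%g).
- by rewrite /frob_term -mulmxA me invg1 group1 rowsign1 mulmx1 repr_mx1 mul1mx.
- by move=> s h Hh; rewrite frob_termK //; apply: mv.
move=> s; rewrite lcoset1 => Hs.
by rewrite /frob_term -mulmxA me groupV (negPf Hs) raddf0 mulmx0.
Qed.

(** A resolution of the identity over the cosets; inserted in the middle of a composite through Z,
    it splits the composite into one term per coset. *)
Lemma monomial_expand : 1%:M = frob_hom rG rG e v.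
Proof.
case: (mon) => mv me msp; apply/esym/eqP; rewrite -subr_eq0; apply/eqP/msp => g.
rewrite mulmxBr mulmx1 -mulmxA (frob_intertwines monomial_coord mv) ?SymG_in //.
by rewrite mulmxA frob_eval // subrr.
Qed.

End MonomialModules.

Section MonomialConstructions.
Variables (F : fieldType) (n : nat) (T : eqType).
Implicit Type row : 'I_n -> bool * T.

Lemma eq_monomial d (rG : mx_representation F (SymG n) d) row1 row2 v e :
  row1 =1 row2 -> monomial row1 rG v e -> monomial row2 rG v e.
Proof.
move=> E [mv me msp]; split=> // [h|g]; rewrite -(eq_rowstab E) -?(eq_rowsign _ _ E) //.
exact: mv.
Qed.

Lemma monomial_conj d (rG : mx_representation F (SymG n) d) row v e (t : 'S_n) :
  monomial row rG v e -> monomial (row \o t) rG (v *m rG t^-1%g) (rG t *m e).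
Proof.
case=> mv me msp; split=> [h Hh|g|k B HB].
- have Hht := Hh; rewrite rowstab_conj in Hht.
  rewrite rowsign_conj // -mulmxA -reprM.
  have -> : (t^-1 * h = h ^ t * t^-1)%g by rewrite conjgE -!mulgA mulgV mulg1.
  by rewrite reprM mulmxA mv // scalemxAl.
- rewrite !mulmxA -(mulmxA v) -reprM -(mulmxA v) -reprM me.
  have -> : (t^-1 * g * t = g ^ t)%g by rewrite conjgE mulgA.
  by rewrite -rowstab_conj; case: ifP => // Hg; rewrite rowsign_conj.
- by apply: msp => g; have := HB (t * g)%g; rewrite -(mulmxA v) -reprM mulKg.
Qed.

Definition swap_row row i := (~~ (row i).1, (row i).2).

Lemma rowstab_swap row : rowstab (swap_row row) = rowstab row.
Proof.
apply/setP=> s; rewrite !inE; apply: eq_forallb => i.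
by rewrite /swap_row; case: (row _) (row _) => a b [a' b'] /=;
   rewrite /eq_op /= (inj_eq negb_inj).
Qed.

(** A row-preserving [s] is the product of its restrictions to the signed and to the unsigned rows,
    and [sgnF] is the product of their two signs. *)
Lemma rowsign_swap row s : s \in rowstab row ->
  rowsign F (swap_row row) s = sgnF F s * rowsign F row s.
Proof.
move=> Hs; pose s1 := restr_perm [set i | (row i).1] s.
pose s2 := restr_perm [set i | (swap_row row i).1] s.
have Hs' : s \in rowstab (swap_row row) by rewrite rowstab_swap.
have E1 : (s1 * s2 = s)%g.
  apply/permP=> i; have si : row (s i) = row i by move/rowstabP: Hs.
  rewrite permM /s1 restr_rowE //; case: ifP => ri; rewrite /s2 restr_rowE //.
    by rewrite /swap_row /= si ri.
  by rewrite /swap_row /= ri.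
rewrite -{2}E1 /sgnF odd_permM signr_addb.
by rewrite /rowsign -/s1 -/s2 mulrAC -expr2 sqrr_sign mul1r.
Qed.

Lemma monomial_twist d (rG : mx_representation F (SymG n) d) row v e :
  monomial row rG v e -> monomial (swap_row row) (sgn_twist rG) v e.
Proof.
case=> mv me msp; split=> [h|g|k B HB].
- rewrite rowstab_swap => Hh /=.
  by rewrite -scalemxAr mv // scalerA rowsign_swap.
- rewrite /= -scalemxAr -scalemxAl me rowstab_swap scale_scalar_mx.
  by case: ifP => Hg; rewrite ?mulr0 ?rowsign_swap.
- apply: msp => g; have /= := HB g; rewrite -scalemxAr -scalemxAl.
  by move/eqP; rewrite scaler_eq0 signr_eq0 => /eqP.
Qed.

Section Regular.
Local Notation R := (regular_repr F (SymG n)).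

Definition gcoef (g : 'S_n) : 'cV[F]_#|SymG n| := delta_mx (gring_index (SymG n) g) 0.

Lemma gelt_coef g h : gelt F g *m gcoef h = (g == h)%:R%:M.
Proof.
rewrite /gelt /gring_row rowK gring_indexK // mul1g mul_delta_mx_cond.
rewrite (inj_in_eq (can_in_inj (@gring_indexK _ (SymG n)))) ?SymG_in //.
by case: eqP => _; rewrite ?mulr0n ?raddf0 //; apply/matrixP=> i j; rewrite !mxE !ord1.
Qed.

Lemma geltM g h : gelt F g *m R h = gelt F (g * h)%g.
Proof. by rewrite /gelt -gring_row_mul reprM. Qed.

Lemma gcoefM g h : R g *m gcoef h = gcoef (h * g^-1)%g.
Proof.
apply/row_matrixP=> i; rewrite rowE -rowE.
rewrite row_mul rowK -[i in RHS]gring_valK.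
have := gelt_coef (enum_val i * g)%g h.
rewrite /gelt /gring_row rowK gring_indexK // mul1g => ->.
have := gelt_coef (enum_val i) (h * g^-1)%g.
rewrite /gelt /gring_row rowK gring_indexK // mul1g rowE => ->.
by rewrite -[in RHS](inj_eq (mulIg g)) mulgKV.
Qed.

Lemma row_gcoefP (u : 'rV[F]_#|SymG n|) : (forall h, u *m gcoef h = 0) -> u = 0.
Proof.
move=> u0; apply/rowP=> i; have := u0 (enum_val i).
rewrite /gcoef gring_valK -colE => /matrixP/(_ 0 0); by rewrite !mxE.
Qed.

Lemma cyclic_spanP d (rG : mx_representation F (SymG n) d) (s u : 'rV_d) :
  (u <= cyclic_mx rG s)%MS -> exists a : 'S_n -> F, u = \sum_g a g *: (s *m rG g).
Proof.
case/cyclic_mxP=> A /envelop_mxP[a ->] ->; exists a.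
rewrite mulmx_sumr; apply: eq_big => [g|g _]; first by rewrite SymG_in.
by rewrite -scalemxAr.
Qed.

Definition rowgen row := \sum_(h in rowstab row) rowsign F row h *: gelt F h.

Lemma rowgen_mul row h : h \in rowstab row ->
  rowgen row *m R h = rowsign F row h *: rowgen row.
Proof.
move=> Hh; rewrite /rowgen mulmx_suml scaler_sumr.
rewrite [RHS](reindex_inj (mulIg h)) /=; apply: eq_big => [g|g Hg].
  by rewrite groupMr.
by rewrite -scalemxAl geltM scalerA rowsignM // mulrA mulrC mulrA rowsign_sqr mul1r.
Qed.

Lemma rowgen_coef row g : rowgen row *m gcoef g =
  (if g \in rowstab row then rowsign F row g else 0)%:M.
Proof.
rewrite /rowgen mulmx_suml (eq_bigr (fun h => (rowsign F row h * (h == g)%:R)%:M)).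
  rewrite -raddf_sum /=; congr (_%:M); case: ifP => Hg.
    rewrite (bigD1 g) //= eqxx mulr1 big1 ?addr0 // => h /andP[_ /negPf->].
    by rewrite mulr0.
  by rewrite big1 // => h Hh; case: eqP Hh => [->|_]; rewrite ?Hg ?mulr0.
by move=> h _; rewrite -scalemxAl gelt_coef scale_scalar_mx.
Qed.

(** The coordinate along the generator is the coefficient at the identity of the group. *)
Lemma regular_monomial row :
  let U := cyclic_mx R (rowgen row) in
  monomial row (submod_repr (cyclic_mx_module R (rowgen row)))
    (in_submod U (rowgen row)) (val_submod (1%:M : 'M_(\rank U)) *m gcoef 1%g).
Proof.
set s := rowgen row; move=> U; have sU : (s <= U)%MS by apply: cyclic_mx_id.
have tr g : in_submod U s *m submod_repr (cyclic_mx_module R s) g = in_submod U (s *m R g).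
  by apply: esym; apply: (in_submodJ (cyclic_mx_module R s) g sU).
split=> [h Hh|g|k B HB].
- by rewrite tr rowgen_mul // linearZ.
- rewrite tr mulmxA -val_submodE in_submodK; last first.
    by rewrite mxmodule_trans ?cyclic_mx_module ?SymG_in.
  rewrite -mulmxA gcoefM mul1g rowgen_coef groupV.
  by case: ifP => // Hg; rewrite rowsignV.
apply/row_matrixP=> i; rewrite row0 -[B]mul1mx row_mul -[matrix.row i _]val_submodK.
have [|a ->] := @cyclic_spanP _ R s (val_submod (matrix.row i (1%:M : 'M_(\rank U)))).
  exact: val_submodP.
rewrite linear_sum mulmx_suml big1 // => g _.
by rewrite linearZ /= -tr -scalemxAl HB scaler0.
Qed.

End Regular.
End MonomialConstructions.

(** * Compositions and the modules M(l|z) *)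

Section Blocks.
Local Open Scope nat_scope.

Lemma blk_cons x c i : blk (x :: c) i = if i < x then 0 else (blk c (i - x)).+1.
Proof.
rewrite /blk /= (iotaDl 1 0) count_map take0 addn0; case: ltnP => xi /=.
  rewrite (@eq_count _ _ pred0) ?count_pred0 // => k /=.
  by rewrite leqNgt ltn_addr.
congr _.+1; apply: eq_count => k /=; by rewrite leq_subRL.
Qed.

Lemma blk_cat c d i :
  blk (c ++ d) i = if i < sumn c then blk c i else size c + blk d (i - sumn c).
Proof.
elim: c i => [|x c IH] i /=; first by rewrite subn0.
rewrite !blk_cons IH; case: (ltnP i x) => xi; first by rewrite ltn_addr.
by rewrite ltn_subLR // subnDA; case: ifP.
Qed.

Lemma blk_lt c i : i < sumn c -> blk c i < size c.
Proof.
elim: c i => [|x c IH] i //=; rewrite blk_cons; case: (ltnP i x) => // xi Hi.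
by rewrite ltnS; apply: IH; rewrite ltn_subLR.
Qed.

Lemma colidx_cons x c i :
  colidx (x :: c) i = if i < x then i else colidx c (i - x).
Proof.
rewrite /colidx blk_cons; case: ifP => _ /=; first by rewrite subn0.
by rewrite subnDA.
Qed.

Lemma colidx_lt c i : i < sumn c -> colidx c i < nth 0 c (blk c i).
Proof.
elim: c i => [|x c IH] i //=; rewrite blk_cons colidx_cons.
by case: (ltnP i x) => //= xi Hi; rewrite IH // ltn_subLR.
Qed.

Lemma blk_colidx_inj c i j : blk c i = blk c j -> colidx c i = colidx c j -> i = j.
Proof.
elim: c i j => [|x c IH] i j; first by rewrite /colidx /= !subn0.
rewrite !blk_cons !colidx_cons; case: (ltnP i x) => xi; case: (ltnP j x) => xj //.
by move=> [] /IH E /E; lia.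
Qed.

Lemma cell_exists c a b : b < nth 0 c a ->
  exists2 i, i < sumn c & blk c i = a /\ colidx c i = b.
Proof.
elim: c a => [|x c IH] [|a] //= Hb.
  by exists b; rewrite ?ltn_addr // blk_cons colidx_cons Hb.
have [i Hi [bi ci]] := IH a Hb; exists (x + i); first by rewrite ltn_add2l.
by rewrite blk_cons colidx_cons ltnNge leq_addr /= addKn bi ci.
Qed.

Lemma card_ord_count m (P : pred nat) : #|[set i : 'I_m | P i]| = count P (iota 0 m).
Proof.
by rewrite -sum1dep_card -(big_mkord P (fun=> 1)) /index_iota subn0 sum1_count.
Qed.

Lemma card_blk c j : #|[set i : 'I_(sumn c) | blk c i == j]| = nth 0 c j.
Proof.
rewrite (card_ord_count _ (fun i => blk c i == j)).
elim: c j => [|x c IH] j /=; first by rewrite nth_nil.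
have iotax : iota x (sumn c) = map (addn x) (iota 0 (sumn c)) by rewrite -iotaDl addn0.
rewrite iotaD count_cat add0n iotax count_map.
rewrite (@eq_in_count _ _ (fun=> 0 == j)) => [|i]; last first.
  by rewrite mem_iota /= blk_cons => ->.
rewrite (@eq_count _ (preim _ _) (fun i => (blk c i).+1 == j)) => [|i /=]; last first.
  by rewrite blk_cons ltnNge leq_addr /= addKn.
case: j => [|j] /=.
  by rewrite count_predT size_iota (@eq_count _ _ pred0) ?count_pred0 ?addn0.
by rewrite count_pred0 add0n -IH; apply: eq_count.
Qed.

Lemma card_blk_lt c k : #|[set i : 'I_(sumn c) | blk c i < k]| = sumn (take k c).
Proof.
elim: k => [|k IH].
  by rewrite take0; apply/eqP; rewrite cards_eq0; apply/eqP/setP=> i; rewrite !inE.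
have -> : sumn (take k.+1 c) = sumn (take k c) + nth 0 c k.
  elim: c {IH} k => [|x c IH] [|k] //=; first by rewrite take0 addn0.
  by rewrite IH addnA.
rewrite -IH -card_blk -cardsUI -[LHS]addn0; congr (_ + _).
  by apply: eq_card => i; rewrite !inE ltnS leq_eqVlt orbC.
apply/esym/eqP; rewrite cards_eq0; apply/eqP/setP=> i; rewrite !inE.
by case: ltngtP.
Qed.

Lemma card_blk_ge c k : #|[set i : 'I_(sumn c) | k <= blk c i]| = sumn (drop k c).
Proof.
apply/eqP; rewrite -(eqn_add2l (sumn (take k c))) -sumn_cat cat_take_drop -card_blk_lt.
rewrite -[in X in _ == X](card_ord (sumn c)) -cardsT -cardsUI -[X in _ == X]addn0.
apply/eqP; congr (_ + _).
  by apply: eq_card => i; rewrite !inE ltnNge orNb.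
by apply/eqP; rewrite cards_eq0; apply/eqP/setP=> i; rewrite !inE ltnNge andNb.
Qed.

End Blocks.

Lemma equal_fibres_perm n (T : eqType) (f g : 'I_n -> T) :
    (forall x, #|[set i | f i == x]| = #|[set i | g i == x]|) ->
  exists t : 'S_n, f =1 g \o t.
Proof.
move=> fg; have /tuple_permP[t Ht] :
    perm_eq [tuple f i | i < n] [tuple g i | i < n].
  have cnt (h : 'I_n -> T) x : count_mem x [tuple h i | i < n] = #|[set i | h i == x]|.
    by rewrite /= count_map -sum1_count -sum1dep_card big_enum_cond.
  by apply/allP=> x _; apply/eqP; rewrite [LHS]cnt [RHS]cnt fg.
exists t => i /=; have /val_inj/(congr1 (fun s => tnth s i)) := Ht.
by rewrite !tnth_mktuple.
Qed.

Section SignedYoungPermutation.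
Variables (F : fieldType) (n : nat) (l z : seq nat).
Hypothesis size_lz : (sumn l + sumn z)%N = n.

Definition std_row (i : 'I_n) : bool * nat :=
  if (i < sumn l)%N then (false, blk l i) else (true, blk z (i - sumn l)).

Lemma std_row_eq (i j : 'I_n) : (std_row i == std_row j) =
  (blk (l ++ z) i == blk (l ++ z) j).
Proof.
rewrite /std_row !blk_cat; case: ltnP => li; case: ltnP => lj; rewrite /eq_op //=.
- by apply/esym/negbTE; have := blk_lt li; lia.
- by apply/esym/negbTE; have := blk_lt lj; lia.
- by rewrite [RHS]eqn_add2l.
Qed.

Lemma std_row_neg i : (std_row i).1 = (sumn l <= i)%N.
Proof. by rewrite /std_row; case: ltnP. Qed.

Lemma mem_youngL s : (s \in youngL n l z) =
  (s \in rowstab std_row) && [forall i, (std_row i).1 ==> (s i == i)].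
Proof.
rewrite !inE; apply/forallP/andP => [H|[/forallP H1 /forallP H2] i].
  split; apply/forallP=> i; have /andP[] := H i.
    by rewrite std_row_eq.
  by rewrite std_row_neg.
by rewrite -std_row_eq H1 -std_row_neg H2.
Qed.

Lemma mem_youngR s : (s \in youngR n l z) =
  (s \in rowstab std_row) && [forall i, ~~ (std_row i).1 ==> (s i == i)].
Proof.
rewrite !inE; apply/forallP/andP => [H|[/forallP H1 /forallP H2] i].
  split; apply/forallP=> i; have /andP[] := H i.
    by rewrite std_row_eq.
  by rewrite std_row_neg ltnNge.
by rewrite -std_row_eq H1 ltnNge -std_row_neg H2.
Qed.

(** Restriction to the unsigned and to the signed points identifies the row stabiliser with the
    product of [youngL] and [youngR], and only the second factor contributes a sign. *)
Lemma Mgen_rowgen : Mgen F n l z = rowgen F std_row.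
Proof.
rewrite /Mgen /rowgen pair_big_dep /=.
pose sgnset b := [set i | (std_row i).1 == b].
have stsgnset b s : s \in rowstab std_row -> s \in ('N(sgnset b | 'P))%g.
  move=> /rowstabP Hs; rewrite !inE /=; apply/subsetP=> i.
  by rewrite !inE apermE Hs.
have resE b s i : s \in rowstab std_row ->
    restr_perm (sgnset b) s i = if (std_row i).1 == b then s i else i.
  move=> Hs; case: ifPn => Hi; first by rewrite restr_permE ?stsgnset // /sgnset inE.
  by rewrite (out_perm (restr_perm_on _ _)) // /sgnset inE.
have inL s : s \in rowstab std_row -> restr_perm (sgnset false) s \in youngL n l z.
  move=> Hs; rewrite mem_youngL; apply/andP; split.
    apply/rowstabP=> i; rewrite resE //; case: ifP => // _; exact/rowstabP.
  by apply/forallP=> i; rewrite resE //; case: (std_row i).1; rewrite /= ?eqxx.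
have inR s : s \in rowstab std_row -> restr_perm (sgnset true) s \in youngR n l z.
  move=> Hs; rewrite mem_youngR; apply/andP; split.
    apply/rowstabP=> i; rewrite resE //; case: ifP => // _; exact/rowstabP.
  by apply/forallP=> i; rewrite resE //; case: (std_row i).1; rewrite /= ?eqxx.
rewrite (reindex_onto (fun s => (restr_perm (sgnset false) s, restr_perm (sgnset true) s))
           (fun u => (u.1 * u.2)%g)) /=; last first.
  case=> a b /= /andP[]; rewrite mem_youngL mem_youngR.
  case/andP=> Ha /forallP a1 /andP[Hb /forallP b1].
  have Hab : (a * b)%g \in rowstab std_row by rewrite groupM.
  have ra i : std_row (a i) = std_row i by apply/rowstabP.
  congr (_, _); apply/permP=> i; rewrite resE // permM.
    case E: (std_row i).1 => /=; first by have := a1 i; rewrite E => /eqP.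
    by have := b1 (a i); rewrite ra E => /eqP.
  case E: (std_row i).1 => /=; first by have := a1 i; rewrite E => /eqP ->.
  by have := b1 i; rewrite E => /eqP ->.
have resM s : s \in rowstab std_row ->
    (restr_perm (sgnset false) s * restr_perm (sgnset true) s = s)%g.
  move=> Hs; apply/permP=> i; have si : std_row (s i) = std_row i by apply/rowstabP.
  rewrite permM [restr_perm (sgnset false) s i]resE //.
  by case E: (std_row i).1; rewrite /= resE // ?si E.
apply: eq_big => [s|s /andP[_ /eqP Es]].
  apply/andP/idP => [[/andP[Ls Rs] /eqP <-]|Hs]; last by rewrite resM // inL ?inR.
  by move: Ls Rs; rewrite mem_youngL mem_youngR => /andP[? _] /andP[? _]; rewrite groupM.
by rewrite Es /rowsign /sgnF /sgnset; congr (_ ^+ odd_perm (restr_perm _ _) *: _);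
  apply/setP=> i; rewrite !inE eqb_id.
Qed.

Lemma card_std_row (P : pred (bool * nat)) : #|[set i | P (std_row i)]| =
  (count (fun i => P (false, blk l i)) (iota 0 (sumn l)) +
   count (fun i => P (true, blk z i)) (iota 0 (sumn z)))%N.
Proof.
rewrite (card_ord_count _ (fun i => P (if (i < sumn l)%N then (false, blk l i)
                        else (true, blk z (i - sumn l)%N)))) -size_lz.
have iotal : iota (sumn l) (sumn z) = map (addn (sumn l)) (iota 0 (sumn z)).
  by rewrite -iotaDl addn0.
rewrite iotaD count_cat add0n iotal count_map; congr (_ + _)%N.
  by apply: eq_in_count => i; rewrite mem_iota /= => ->.
by apply: eq_count => i /=; rewrite ltnNge leq_addr /= addKn.
Qed.

Lemma card_std_side b (P : pred nat) :
  #|[set i | ((std_row i).1 == b) && P (std_row i).2]| =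
  #|[set i : 'I_(sumn (if b then z else l)) | P (blk (if b then z else l) i)]|.
Proof.
rewrite (card_std_row (fun x => (x.1 == b) && P x.2)) /=.
case: b; rewrite (card_ord_count _ (fun i => P (blk _ i))).
  by rewrite (@eq_count _ _ pred0) ?count_pred0 // add0n; apply: eq_count.
by rewrite addnC (@eq_count _ _ pred0) ?count_pred0 // add0n; apply: eq_count.
Qed.

Lemma Mrep_std_monomial : exists v e, monomial std_row (Mrep F n l z) v e.
Proof. by rewrite /Mrep Mgen_rowgen; do 2!eexists; exact: regular_monomial. Qed.

(** Only the row sizes matter, because labellings with equal fibres are conjugate. This allows
    labels adapted to the division into blocks. *)
Lemma Mrep_monomial (row : 'I_n -> bool * nat) :
    (forall b j, #|[set i | row i == (b, j)]| = nth 0%N (if b then z else l) j) ->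
  exists v e, monomial row (Mrep F n l z) v e.
Proof.
move=> Hrow; have [t Ht] : exists t : 'S_n, row =1 std_row \o t.
  apply: equal_fibres_perm => -[b j]; rewrite Hrow -card_blk.
  by rewrite -(card_std_side b (pred1 j)); apply: eq_card => i; rewrite !inE.
have [v [e mon]] := Mrep_std_monomial.
exists (v *m Mrep F n l z t^-1%g), (Mrep F n l z t *m e).
by apply: (eq_monomial (fun i => esym (Ht i))); apply: monomial_conj.
Qed.

End SignedYoungPermutation.

(** * The map from End N to End D *)

(** The signed row symmetriser is locked so that its sum unfolds only on demand, through
    [sigma_mxE]. *)
Fact sigma_key : unit. Proof. by []. Qed.
Definition sigma_mx (F : fieldType) (k : nat) (T : eqType) (row : 'I_k -> bool * T) d
    (rG : mx_representation F (SymG k) d) :=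
  locked_with sigma_key (\sum_(h in rowstab row) rowsign F row h *: rG h).

Lemma sigma_mxE (F : fieldType) (k : nat) (T : eqType) (row : 'I_k -> bool * T) d
    (rG : mx_representation F (SymG k) d) :
  sigma_mx row rG = \sum_(h in rowstab row) rowsign F row h *: rG h.
Proof. by rewrite /sigma_mx locked_withE. Qed.

(** On each right coset of the stabiliser the weights are proportional to the signs, so the partial
    sum is a multiple of the symmetriser times a group element. *)
Lemma sum_equivariant (F : fieldType) (k : nat) (T : eqType) (row : 'I_k -> bool * T) d
    (rG : mx_representation F (SymG k) d) (w : 'S_k -> F) :
    {in rowstab row, forall h x, w (h * x)%g = rowsign F row h * w x} ->
  sigma_mx row rG = 0 -> \sum_x w x *: rG x = 0.
Proof.
rewrite sigma_mxE => wM sg0; rewrite (partition_big_imset (fun x => rowstab row :* x)%g) big1 //= => B.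
case/imsetP=> t _ ->; rewrite (reindex_inj (mulIg t)) /=.
rewrite (eq_bigl (mem (rowstab row))) => [|h]; last first.
  by rewrite (sameP eqP rcoset_eqP) mem_rcoset mulgK.
rewrite (eq_bigr (fun h => (w t *: (rowsign F row h *: rG h)) *m rG t)) => [|h Hh].
  by rewrite -mulmx_suml -scaler_sumr [X in _ *: X]sg0 scaler0 mul0mx.
by rewrite wM // reprM scalerA mulrC scalemxAl.
Qed.

Lemma mulmx11 (F : fieldType) (a b : 'M[F]_1) : (a *m b) 0 0 = a 0 0 * b 0 0.
Proof. by rewrite mxE big_ord1. Qed.

Lemma odd_pchar_two (F : fieldType) p : p \in [pchar F] -> odd p -> 2%:R != 0 :> F.
Proof.
move=> charF p_odd; rewrite -(dvdn_pcharf charF).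
by apply: contraL p_odd; rewrite dvdn_prime2 ?(pcharf_prime charF) // => /eqP ->.
Qed.

Section Core.
Variables (F : fieldType) (p n r : nat) (Q : finType).
Hypotheses (charF : p \in [pchar F]) (p_odd : odd p).
Local Notation pos := ('I_r + Q * 'I_p)%type.
Variables (th : pos -> 'I_n) (th' : 'I_n -> pos).
Hypotheses (thK : cancel th th') (th'K : cancel th' th).
Local Notation ptp := (ptp thK th'K).
Local Notation cellp := (cellp thK th'K).
Local Notation rotp := (rotp thK th'K).

Variables (qs : Q -> bool) (qrow qcol : Q -> nat).
Local Notation qlab q := (qs q, qcol q).
Hypothesis cell_inj : forall x y, qrow x = qrow y -> qlab x = qlab y -> x = y.
Hypothesis cell_init : forall x i, (i <= qrow x)%N ->
  exists2 y, qlab y = qlab x & qrow y = i.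

(** The rows of N: each free point is a row by itself, and a block lies in the row of its cell, so
    the block rows have the sizes of the rows of p kap and p m. *)
Definition base_row (i : 'I_n) : bool * ('I_r + nat) :=
  match th' i with inl k => (false, inl k) | inr a => (qs a.1, inr (qrow a.1)) end.
Local Notation rowN := base_row.

(** The side is negated because columns carry the character opposite to that of the rows: cells in
    unsigned rows are antisymmetrised along columns, cells in signed rows are symmetrised. *)
Definition col_row (q : Q) := (~~ qs q, qcol q).
Local Notation C := (rowstab col_row).
Local Notation eps := (rowsign F col_row).

Variables (dN : nat) (rN : mx_representation F (SymG n) dN) (vN : 'rV[F]_dN) (eN : 'cV[F]_dN).
Hypothesis monN : monomial rowN rN vN eN.

Variables (dD : nat) (rD : mx_representation F (SymG r) dD).

Let p_pr : prime p. Proof. by case/andP: charF. Qed.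
Let p_gt0 : (0 < p)%N. Proof. exact: prime_gt0. Qed.
Let j0 : 'I_p := Ordinal p_gt0.

Lemma base_row_th o : rowN (th o) =
  match o with inl k => (false, inl k) | inr a => (qs a.1, inr (qrow a.1)) end.
Proof. by rewrite /base_row thK. Qed.

Lemma sign_neq1 : (1 : F) != -1.
Proof.
by rewrite -subr_eq0 opprK; apply: odd_pchar_two charF p_odd.
Qed.

Lemma sgnb_inj : injective (fun b : bool => (-1) ^+ b : F).
Proof.
by move=> [] [] //= /eqP; rewrite expr0 expr1 ?[_ == 1]eq_sym (negPf sign_neq1).
Qed.

Definition vcol := \sum_(c in C) eps c *: (vN *m rN (cellp c)).

Lemma vcol_push g a :
    {in C, forall c, (g ^ (cellp c)^-1)%g \in rowstab rowN /\
                     rowsign F rowN (g ^ (cellp c)^-1)%g = a} ->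
  vcol *m rN g = a *: vcol.
Proof.
case: monN => mv _ _ H; rewrite mulmx_suml scaler_sumr; apply: eq_bigr => c Hc.
have [Hg <-] := H c Hc.
rewrite -scalemxAl -mulmxA -reprM.
have -> : (cellp c * g = g ^ (cellp c)^-1 * cellp c)%g.
  by rewrite conjgE invgK !mulgA mulgKV.
by rewrite reprM mulmxA mv // -scalemxAl !scalerA mulrC.
Qed.

Lemma vcol_cell c : c \in C -> vcol *m rN (cellp c) = eps c *: vcol.
Proof.
move=> Hc; rewrite /vcol mulmx_suml scaler_sumr.
rewrite [RHS](reindex_inj (mulIg c)) /=; apply: eq_big => [d|d Hd].
  by rewrite groupMr.
by rewrite -scalemxAl -mulmxA -reprM -cellpM scalerA rowsignM // mulrA mulrC mulrA rowsign_sqr mul1r.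
Qed.

Lemma base_rotp q : rotp q \in rowstab rowN.
Proof. by apply: rotp_rowstab => j k; rewrite !base_row_th. Qed.

Lemma vcol_rot q : vcol *m rN (rotp q) = vcol.
Proof.
rewrite (@vcol_push _ 1) ?scale1r // => c Hc.
have -> : (rotp q ^ (cellp c)^-1 = rotp (c^-1 q))%g.
  by rewrite conjgE invgK mulgA -{1}(permKV c q) cellp_rotp mulgK.
by split; [apply: base_rotp | apply: rowsign_rotp => //; apply: base_rotp].
Qed.

Lemma qs_cell c q : c \in C -> qs (c q) = qs q.
Proof. by move/rowstabP/(_ q) => [] /negb_inj. Qed.

Lemma vcol_swap q j k : j != k ->
  vcol *m rN (tperm (th (inr (q, j))) (th (inr (q, k)))) = (-1) ^+ (qs q) *: vcol.
Proof.
move=> njk; apply: vcol_push => c Hc; rewrite tpermJ -cellpV !cellpE /=.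
have E : rowN (th (inr (c^-1%g q, j))) = rowN (th (inr (c^-1%g q, k))).
  by rewrite !base_row_th.
split; first exact: rowstab_tperm.
rewrite rowsign_tperm // ?base_row_th /= ?qs_cell ?groupV //.
by rewrite (inj_eq (can_inj thK)); apply: contraNneq njk => -[->].
Qed.

(* [Dmap] reads off the block-fixing tabloids only; [vcol] carries the column
   (anti)symmetrisers of [kap] and [m] acting on blocks. *)
Definition Xcoef (phi : 'M[F]_dN) x : F := (vcol *m phi *m rN (ptp x) *m eN) 0 0.
Definition Dmap (phi : 'M[F]_dN) : 'M[F]_dD := \sum_x Xcoef phi x *: rD x.

Lemma Dmap_add a b : Dmap (a + b) = Dmap a + Dmap b.
Proof.
rewrite /Dmap -big_split; apply: eq_bigr => x _.
by rewrite /Xcoef mulmxDr !mulmxDl mxE scalerDl.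
Qed.

Lemma Dmap_scale c a : Dmap (c *: a) = c *: Dmap a.
Proof.
rewrite /Dmap scaler_sumr; apply: eq_bigr => x _.
by rewrite /Xcoef -scalemxAr -!scalemxAl mxE scalerA.
Qed.

(** * Endomorphisms of N that factor through a monomial module Z *)

Section Through.
Variables (T : eqType) (rowZ : 'I_n -> bool * T).
Variables (dZ : nat) (rZ : mx_representation F (SymG n) dZ) (vZ : 'rV[F]_dZ) (eZ : 'cV[F]_dZ).
Hypothesis monZ : monomial rowZ rZ vZ eZ.
Variables (f : 'M[F]_(dN, dZ)) (g : 'M[F]_(dZ, dN)).
Hypotheses (homf : intertwines rN rZ f) (homg : intertwines rZ rN g).

(** [zcoef s] is the coordinate of [vcol *m f] along the translate of [vZ] by the inverse of [s];
    [wcoef s x] is the coefficient that [g] gives to this translate at the free-point permutation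
    [x]. *)
Definition zcoef s : F := (vcol *m f *m rZ s *m eZ) 0 0.
Definition wcoef s x : F := (vZ *m rZ s^-1%g *m g *m rN (ptp x) *m eN) 0 0.
Definition wsum s := \sum_x wcoef s x *: rD x.

Lemma Dmap_cosets :
  Dmap (f *m g) = \sum_(A in lcosets (rowstab rowZ) [set: 'S_n]) zcoef (repr A) *: wsum (repr A).
Proof.
rewrite /Dmap; under eq_bigr => x _.
  have -> : Xcoef (f *m g) x = \sum_(A in lcosets (rowstab rowZ) [set: 'S_n])
      zcoef (repr A) * wcoef (repr A) x.
    rewrite /Xcoef -[f]mulmx1 (monomial_expand monZ) mulmx_sumr mulmx_suml.
    rewrite mulmx_sumr !mulmx_suml summxE; apply: eq_bigr => A _.
    rewrite /frob_term /zcoef /wcoef.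
    by rewrite -mulmx11 !mulmxA.
  rewrite scaler_suml; over.
rewrite exchange_big; apply: eq_bigr => A _.
by rewrite scaler_sumr; apply: eq_bigr => x _; rewrite scalerA.
Qed.

Lemma zcoefK s h : h \in rowstab rowZ -> zcoef (s * h)%g = rowsign F rowZ h * zcoef s.
Proof.
move=> Hh; rewrite /zcoef reprM mulmxA -(mulmxA _ (rZ h)) (monomial_coord monZ) //.
by rewrite -scalemxAr mxE.
Qed.

Lemma wcoefK s h x : h \in rowstab rowZ -> wcoef (s * h)%g x = rowsign F rowZ h * wcoef s x.
Proof.
case: monZ => mv _ _ Hh; rewrite /wcoef invMg reprM (mulmxA vZ) mv ?groupV //.
by rewrite -!scalemxAl mxE rowsignV.
Qed.

Lemma zcoef_left u a s : vcol *m rN u = a *: vcol -> zcoef (u * s)%g = a * zcoef s.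
Proof.
move=> Hu; rewrite /zcoef reprM mulmxA -(mulmxA _ f) -homf ?SymG_in // mulmxA Hu.
by rewrite -!scalemxAl mxE.
Qed.

(** Rotations fix [vcol] and the coordinate [eN] and commute with [ptp], so a term is constant along
    the E-orbit of its coset. *)
Lemma term_rotp q s : zcoef (rotp q * s)%g *: wsum (rotp q * s)%g = zcoef s *: wsum s.
Proof.
rewrite (@zcoef_left _ 1) ?vcol_rot ?scale1r ?mul1r //; congr (_ *: _).
apply: eq_bigr => x _; congr (_ *: _); rewrite /wcoef invMg reprM.
rewrite !mulmxA -(mulmxA _ (rZ _) g) homg ?SymG_in // !mulmxA -(mulmxA _ (rN _) (rN _)) -reprM.
have -> : ((rotp q)^-1 * ptp x = ptp x * (rotp q)^-1)%g.
  by apply: (mulgI (rotp q)); rewrite mulKVg mulgA -ptp_rotp mulgK.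
rewrite reprM mulmxA -(mulmxA _ (rN (rotp q)^-1%g)) (monomial_coord monN) ?groupV ?base_rotp //.
by rewrite rowsignV ?base_rotp // rowsign_rotp ?base_rotp // scale1r.
Qed.

Lemma term_coset s h : h \in rowstab rowZ ->
  zcoef (s * h)%g *: wsum (s * h)%g = zcoef s *: wsum s.
Proof.
move=> Hh; rewrite zcoefK // /wsum !scaler_sumr; apply: eq_bigr => x _.
by rewrite wcoefK // !scalerA mulrACA rowsign_sqr mul1r.
Qed.

Lemma Dmap_fixed :
  Dmap (f *m g) = \sum_(A in lcosets (rowstab rowZ) [set: 'S_n] |
      [forall q, (rotp q ^ repr A)%g \in rowstab rowZ]) zcoef (repr A) *: wsum (repr A).
Proof.
rewrite Dmap_cosets.
rewrite (@coset_sum_fixed _ _ _ (fun s => zcoef s *: wsum s) term_coset p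
   [seq rotp q | q : Q]) //.
- apply: eq_bigl => A; apply: andb_id2l => HA.
  have AE : A = (repr A *: rowstab rowZ)%g.
    case/lcosetsP: HA => x _ ->; apply/lcoset_eqP; rewrite lcoset_sym.
    by apply: (mem_repr x); apply: lcoset_refl.
  have memE q : (rotp q *: A == A)%g = ((rotp q ^ repr A)%g \in rowstab rowZ).
    by rewrite {1 2}AE -lcosetM (sameP eqP lcoset_eqP) mem_lcoset conjgE.
  apply/allP/forallP => [H q|H _ /mapP[q _ ->]]; last by rewrite memE.
  by rewrite -memE; apply: H; apply: map_f; rewrite mem_enum.
- by move=> v; rewrite -scaler_nat (pcharf0 charF) scale0r.
- by move=> _ /mapP[q _ ->]; apply: rotp_order.
- by move=> _ _ /mapP[q _ ->] /mapP[q' _ ->]; apply: rotpC.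
- by move=> _ /mapP[q _ ->] s; apply: term_rotp.
Qed.

Lemma fixed_block s q : (rotp q ^ s)%g \in rowstab rowZ ->
  forall j k, rowZ (s (th (inr (q, j)))) = rowZ (s (th (inr (q, k)))).
Proof. by rewrite -rowstab_conj; apply: rowstab_rotp. Qed.

(** A transposition inside the block multiplies [vcol] by the sign of its side, and [zcoef s] by the
    sign of the row of Z containing the block. As 1 differs from -1, a nonzero coefficient forces
    the two to agree. *)
Lemma block_side s q j : zcoef s != 0 -> (rotp q ^ s)%g \in rowstab rowZ ->
  (rowZ (s (th (inr (q, j))))).1 = qs q.
Proof.
move=> nz Hq; have [k njk] : exists k : 'I_p, j != k.
  have := prime_gt1 p_pr; rewrite -{1}(card_ord p) => /card_gt1P[x [y [_ _ nxy]]].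
  by have [->|nx] := eqVneq j x; [exists y | exists x].
pose t := tperm (th (inr (q, j))) (th (inr (q, k))).
have := zcoef_left s (vcol_swap q njk); rewrite -/t.
have -> : (t * s = s * t ^ s)%g by rewrite conjgE mulKVg.
have Et := fixed_block Hq j k.
rewrite tpermJ zcoefK ?rowstab_tperm // rowsign_tperm //.
  by move/(mulIf nz)/sgnb_inj.
by rewrite (inj_eq perm_inj) (inj_eq (can_inj thK)); apply: contraNneq njk => -[->].
Qed.

(** Swapping two blocks of one column gives the column sign on [vcol]; if they shared a row of Z, it
    would also give the opposite sign, that of the row. *)
Lemma block_colinj s q q' j : zcoef s != 0 ->
    (forall q, (rotp q ^ s)%g \in rowstab rowZ) -> qlab q = qlab q' ->
  rowZ (s (th (inr (q, j)))) = rowZ (s (th (inr (q', j)))) -> q = q'.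
Proof.
move=> nz Hfix [qsE qcE] E; apply/eqP; apply: contraT => nq.
have EE k l : (rowZ \o s) (th (inr (q, k))) = (rowZ \o s) (th (inr (q', l))).
  by rewrite /= (fixed_block (Hfix q) k j) (fixed_block (Hfix q') l j).
have [Hc signc] := rowstab_cell_swap F thK th'K p_odd nq EE.
have tC : tperm q q' \in C by apply: rowstab_tperm; rewrite /col_row qsE qcE.
have := zcoef_left s (vcol_cell tC).
have -> : (cellp (tperm q q') * s = s * cellp (tperm q q') ^ s)%g.
  by rewrite conjgE mulKVg.
rewrite zcoefK -?rowstab_conj // -rowsign_conj // (signc j) => /(mulIf nz).
rewrite rowsign_tperm //; last by rewrite /col_row qsE qcE.
by move/sgnb_inj; rewrite /= block_side //; case: (qs q).
Qed.

(** The stabiliser in Z of the rows holding the free points acts on the weights [wcoef s] by its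
    signs, so [wsum s] contains the corresponding symmetriser as a factor. *)
Lemma wsum_neq0 s : wsum s != 0 -> sigma_mx (fun i => rowZ (s (th (inl i)))) rD != 0.
Proof.
apply: contraNneq => sg0; apply/eqP; apply: sum_equivariant sg0 => h Hh x.
have Hh' : ptp h \in rowstab (rowZ \o s) by rewrite rowstab_ptp.
case: monZ => mv _ _.
rewrite /wcoef ptpM reprM !mulmxA -(mulmxA _ g) -homg ?SymG_in // mulmxA.
rewrite -(mulmxA vZ) -reprM.
have -> : (s^-1 * ptp h = ptp h ^ s * s^-1)%g by rewrite conjgE -!mulgA mulgV mulg1.
rewrite reprM mulmxA mv -?rowstab_conj // -rowsign_conj // rowsign_ptp //.
by rewrite -!scalemxAl mxE.
Qed.

Lemma Dmap_neq0 : Dmap (f *m g) != 0 ->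
  exists s : 'S_n,
  [/\ forall q j k, rowZ (s (th (inr (q, j)))) = rowZ (s (th (inr (q, k)))),
      forall q j, (rowZ (s (th (inr (q, j))))).1 = qs q,
      forall q q' j, qlab q = qlab q' ->
        rowZ (s (th (inr (q, j)))) = rowZ (s (th (inr (q', j)))) -> q = q'
    & sigma_mx (fun i => rowZ (s (th (inl i)))) rD != 0].
Proof.
rewrite Dmap_fixed => nz.
have [A /andP[_ /forallP HA] nzA] : exists2 A,
    (A \in lcosets (rowstab rowZ) [set: 'S_n]) &&
      [forall q, (rotp q ^ repr A)%g \in rowstab rowZ] &
    zcoef (repr A) *: wsum (repr A) != 0.
  apply/exists_inP; apply: contraNT nz => /exists_inPn H.
  by rewrite big1 // => A HA; apply/eqP; have := H A HA; rewrite negbK.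
move: nzA; rewrite scaler_eq0 negb_or => /andP[nz1 nz2].
exists (repr A); split=> [q|q j|q q' j|]; [exact: fixed_block | exact: block_side | |].
  exact: block_colinj.
exact: wsum_neq0.
Qed.

End Through.
Lemma card_blocks (P : pred 'I_n) (s : 'S_n) :
    (forall q j k, P (s (th (inr (q, j)))) = P (s (th (inr (q, k))))) ->
  #|[set i | P i]| =
    (#|[set i | P (s (th (inl i)))]| + p * #|[set q | P (s (th (inr (q, j0))))]|)%N.
Proof.
move=> Pc; rewrite -!sum1dep_card.
have bij_sth : bijective (fun o => s (th o)).
  exists (fun i => th' (s^-1%g i)) => i; first by rewrite permK thK.
  by rewrite th'K permKV.
rewrite (reindex (fun o => s (th o))) /=; last exact: onW_bij.
rewrite big_mkcond big_sumType /= -!big_mkcond /=; congr addn.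
rewrite big_distrr /= big_mkcond [RHS]big_mkcond /=.
rewrite (eq_bigr (fun a => if P (s (th (inr (a.1, a.2)))) then 1 else 0)%N) => [|[q j] //].
rewrite -(pair_bigA _ (fun q j => if P (s (th (inr (q, j)))) then 1 else 0)%N) /=.
apply: eq_bigr => q _; rewrite (eq_bigr (fun=> if P (s (th (inr (q, j0)))) then 1 else 0)%N).
  by rewrite sum_nat_const card_ord; case: ifP; rewrite ?muln1 ?muln0.
by move=> j _; rewrite (Pc q j j0).
Qed.

Lemma base_row_point i k : (rowN i).2 = inl k -> i = th (inl k).
Proof. by rewrite -{2}(th'K i) /base_row; case: (th' i) => [l [->]|[]]. Qed.

Lemma base_stab_point h k : h \in rowstab rowN -> h (th (inl k)) = th (inl k).
Proof. by move/rowstabP=> H; apply: base_row_point; rewrite H base_row_th. Qed.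

Lemma base_stab_block h q j : h \in rowstab rowN ->
  exists q' j', [/\ h (th (inr (q, j))) = th (inr (q', j')), qs q' = qs q & qrow q' = qrow q].
Proof.
move/rowstabP/(_ (th (inr (q, j)))); rewrite base_row_th /=.
rewrite -[h _]th'K base_row_th; case: (th' _) => [//|[q' j'] /= [E1 E2]].
by exists q', j'.
Qed.

(** * Multiplicativity on End N *)

Section Product.
Variables phi psi : 'M[F]_dN.
Hypotheses (homphi : intertwines rN rN phi) (hompsi : intertwines rN rN psi).
Local Notation zc := (zcoef rN eN phi).
Local Notation ws := (wsum rN vN psi).
Local Notation cosets := (lcosets (rowstab rowN) [set: 'S_n]).

(** A block has more than one point, so it cannot lie in the one-point row of a free point; hence
    free points go to free points. The blocks then fill the rows with the right content and
    injectively on columns, and rigidity supplies the column permutation. *)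
Lemma good_coset s : zc s != 0 -> (forall q, (rotp q ^ s)%g \in rowstab rowN) ->
  exists2 u : {perm Q} * 'S_r, u.1 \in C & s \in (cellp u.1 * ptp u.2 *: rowstab rowN)%g.
Proof.
move=> nz Hfix.
have [j1 nj1] : exists j1 : 'I_p, j0 != j1.
  have := prime_gt1 p_pr; rewrite -{1}(card_ord p) => /card_gt1P[x [y [_ _ nxy]]].
  by have [->|nx] := eqVneq j0 x; [exists y | exists x].
have blockc := fun q => fixed_block (Hfix q).
have nopt q j k : (rowN (s (th (inr (q, j))))).2 <> inl k.
  move=> E; have E0 : (rowN (s (th (inr (q, j0))))).2 = inl k by rewrite (blockc q _ j).
  have E1 : (rowN (s (th (inr (q, j1))))).2 = inl k by rewrite (blockc q _ j).
  have := base_row_point E0; rewrite -(base_row_point E1) => /perm_inj/(can_inj thK) [] /eqP.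
  by rewrite (negPf nj1).
(* By [nopt] the default 0 is never taken; nor is the default [k] in [g] below. *)
pose m q := if (rowN (s (th (inr (q, j0))))).2 is inr a then a else 0%N.
have mE q j : rowN (s (th (inr (q, j)))) = (qs q, inr (m q)).
  rewrite (blockc q j j0) /m; have := block_side monN homphi j0 nz (Hfix q).
  have := nopt q j0; by case: (rowN _) => b [k|a] /= H E; [have := H k | rewrite E].
pose g k := if th' (s^-1%g (th (inl k))) is inl i then i else k.
have gE k : s (th (inl (g k))) = th (inl k).
  rewrite /g; case E: (th' _) => [i|[q j]].
    by rewrite -E th'K permKV.
  case: (@nopt q j k); rewrite -E th'K permKV base_row_th //.
have g_inj : injective g.
  by move=> k l E; have := gE k; rewrite E gE => /(can_inj thK) [].
pose y := (perm g_inj)^-1%g.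
have yE i : s (th (inl i)) = th (inl (y i)).
  by rewrite -[th (inl (y i))]gE; congr (s (th (inl _))); rewrite -{1}(permKV (perm g_inj) i) permE.
(* The points of N in block rows numbered below [k] are counted twice, in the positions given by [s]
   and in the original ones; both times they form whole blocks. *)
have cnt k : #|[set q | (m q < k)%N]| = #|[set q | (qrow q < k)%N]|.
  pose P i := if (rowN i).2 is inr a then (a < k)%N else false.
  have P1 : #|[set i | P i]| = (p * #|[set q | (m q < k)%N]|)%N.
    rewrite (@card_blocks P s) => [|q j l]; last by rewrite /P !mE.
    rewrite [X in (X + _)%N](_ : _ = 0%N) ?add0n; last first.
      by apply/eqP; rewrite cards_eq0; apply/eqP/setP=> i; rewrite !inE /P yE base_row_th.
    by congr (_ * _)%N; apply: eq_card => q; rewrite !inE /P mE.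
  have P2 : #|[set i | P i]| = (p * #|[set q | (qrow q < k)%N]|)%N.
    rewrite (@card_blocks P 1%g) => [|q j l]; last by rewrite /P !perm1 !base_row_th.
    rewrite [X in (X + _)%N](_ : _ = 0%N) ?add0n; last first.
      by apply/eqP; rewrite cards_eq0; apply/eqP/setP=> i; rewrite !inE /P perm1 base_row_th.
    by congr (_ * _)%N; apply: eq_card => q; rewrite !inE /P perm1 base_row_th.
  by apply/eqP; rewrite -(eqn_pmul2l p_gt0) -P1 P2.
have m_colinj x z : qlab x = qlab z -> m x = m z -> x = z.
  move=> Ec Em; have [qsE _] := Ec.
  apply: (block_colinj monN homphi nz Hfix Ec (j := j0)); by rewrite !mE qsE Em.
have [c cE] := @diagram_rigidity Q _ qrow (fun q => qlab q) m cell_init m_colinj cnt.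
have cC : c \in C by apply/rowstabP=> q; have [[]] := cE q; rewrite /col_row => -> ->.
exists (c, y) => //=; rewrite mem_lcoset; apply/rowstabP=> i.
rewrite permM; set i' := ((cellp c * ptp y)^-1)%g i.
have -> : i = (cellp c * ptp y)%g i' by rewrite permKV.
rewrite permM -[i']th'K; case: (th' i') => [k|[q j]].
  by rewrite cellpE ptpE /= yE !base_row_th.
rewrite cellpE ptpE /= mE base_row_th /=; have [[-> _] ->] := cE q; by [].
Qed.

(** Up to inverting [c], the signed sum over column permutations is the one that defines [vcol]; so
    the second factor [psi] again sees [vcol] and not just [vN]. *)
Lemma wsum_cells y :
  \sum_(c in C) eps c *: ws (cellp c * ptp y)%g =
  \sum_x Xcoef psi (y^-1 * x)%g *: rD x.
Proof.
rewrite /wsum; under eq_bigr do rewrite scaler_sumr.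
rewrite exchange_big; apply: eq_bigr => x _ /=.
under eq_bigr do rewrite scalerA; rewrite -scaler_suml; congr (_ *: _).
rewrite /Xcoef ptpM ptpV reprM !mulmxA -(mulmxA vcol) -hompsi ?SymG_in // mulmxA.
rewrite /vcol !mulmx_suml summxE [RHS](reindex_inj invg_inj) /=.
apply: eq_big => [c|c Hc]; first by rewrite groupV.
rewrite -!scalemxAl mxE rowsignV // /wcoef cellpV.
by rewrite -[in RHS](mulmxA vN) -reprM -invMg ptp_cellp.
Qed.

Lemma Dmap_mul : Dmap (phi *m psi) = Dmap phi *m Dmap psi.
Proof.
pose rep (u : {perm Q} * 'S_r) := (cellp u.1 * ptp u.2)%g.
pose D : {set {perm Q} * 'S_r} := [set u | u.1 \in C].
pose im := [set (rep u *: rowstab rowN)%g | u in D].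
have rotp_rep q u : (rotp q ^ rep u)%g \in rowstab rowN.
  have -> : (rotp q ^ rep u = rotp (u.1 q))%g.
    rewrite /rep conjgM [(rotp q ^ _)%g]conjgE -cellp_rotp mulKg.
    by rewrite conjgE -ptp_rotp mulKg.
  exact: base_rotp.
(* Fixed cosets that have no representative [rep u] contribute zero, by [good_coset]. *)
rewrite (Dmap_fixed monN homphi hompsi) (bigID (mem im)) /= addrC big1 ?add0r; last first.
  move=> A /andP[/andP[HA /forallP Hfix] nA]; have [-> | nz] := eqVneq (zc (repr A)) 0.
    by rewrite scale0r.
  have [u Hu Au] := good_coset nz Hfix; case/negP: nA; apply/imsetP; exists u.
    by rewrite in_set.
  have AE : A = (repr A *: rowstab rowN)%g.
    case/lcosetsP: HA => x _ ->; apply/lcoset_eqP; rewrite lcoset_sym.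
    by apply: (mem_repr x); apply: lcoset_refl.
  by rewrite AE; apply/lcoset_eqP.
pose term s := zc s *: ws s.
have termK s h : h \in rowstab rowN -> term (s * h)%g = term s by apply: term_coset.
rewrite (eq_bigl (mem im)) => [|A]; last first.
  rewrite andb_idl // => /imsetP[u _ ->]; rewrite mem_cosets; apply/forallP=> q.
  have : repr (rep u *: rowstab rowN)%g \in (rep u *: rowstab rowN)%g.
    by apply: (mem_repr (rep u)); apply: lcoset_refl.
  by case/lcosetP=> h Hh ->; rewrite conjgM groupJ ?rotp_rep.
(* Distinct pairs give distinct cosets: [c] and [c'] keep every cell in its column, so agreement of
   the rows makes them equal. *)
rewrite big_imset /=; last first.
  move=> [c y] [c' y']; rewrite [_ \in D]in_set [(c', _) \in D]in_set /= => Hc Hc' /esym/lcoset_eqP.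
  rewrite mem_lcoset => /rowstabP H.
  have {H} E i : rowN (rep (c', y') i) = rowN (rep (c, y) i).
    by have := H (rep (c, y) i); rewrite -permM mulKVg.
  congr (_, _); apply/permP.
    move=> q; have := E (th (inr (q, j0))); rewrite /rep !permM !cellpE !ptpE !base_row_th /=.
    move=> [_ Eq]; apply: cell_inj => //.
    by move/rowstabP/(_ q): Hc; move/rowstabP/(_ q): Hc' => [/negb_inj-> ->] [/negb_inj-> ->].
  by move=> k; have := E (th (inl k)); rewrite /rep !permM !cellpE !ptpE !base_row_th /= => -[].
rewrite (eq_bigr (fun u => term (rep u))) => [|u _]; last exact: (coset_repr termK).
rewrite (eq_bigl (fun u => (u.1 \in C) && true)) => [|u]; last by rewrite in_set andbT.
rewrite -(pair_big_dep (mem C) (fun _ _ => true) (fun c y => term (rep (c, y)))) /=.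
rewrite exchange_big /= /Dmap mulmx_suml; apply: eq_bigr => y _.
rewrite (eq_bigr (fun c => Xcoef phi y *: (eps c *: ws (cellp c * ptp y)%g))) => [|c Hc].
  rewrite -scaler_sumr wsum_cells -scalemxAl; congr (_ *: _).
  rewrite mulmx_sumr (reindex_inj (mulgI y)) /=; apply: eq_bigr => x _.
  by rewrite mulKg reprM -scalemxAr.
rewrite /term /rep /= (zcoef_left eN homphi (ptp y) (vcol_cell Hc)) scalerA; congr (_ *: _).
by rewrite mulrC.
Qed.

End Product.
Lemma base_stab_ptp h x : h \in rowstab rowN -> (h * ptp x = ptp x * h)%g.
Proof.
move=> Hh; apply: (eq_on_th th'K) => -[i|[q j]]; rewrite !permM ptpE /=.
  by rewrite (base_stab_point i Hh) (base_stab_point (x i) Hh) ptpE.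
by have [q' [j' [-> _ _]]] := base_stab_block q j Hh; rewrite ptpE.
Qed.

(** The preimage sends [vN] to its translate by the inverse of [ptp x]; the inverse makes
    composition from left to right match the product in the group. *)
Lemma Dmap_translate x : exists2 a, intertwines rN rN a & Dmap a = rD x.
Proof.
case: (monN) => mv me _.
have ux : {in rowstab rowN, forall h,
    vN *m rN (ptp x^-1)%g *m rN h = rowsign F rowN h *: (vN *m rN (ptp x^-1)%g)}.
  move=> h Hh; rewrite -mulmxA -reprM -base_stab_ptp // reprM mulmxA mv //.
  by rewrite scalemxAl.
exists (frob_hom rowN rN rN eN (vN *m rN (ptp x^-1)%g)).
  by apply: frob_intertwines => //; apply: monomial_coord monN.
have homa := frob_intertwines (monomial_coord monN) ux.
set a := frob_hom _ _ _ _ _ in homa *.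
have va : vN *m a = vN *m rN (ptp x^-1)%g by apply: frob_eval monN _ _ _ ux.
suff Xa y : Xcoef a y = (y == x)%:R.
  rewrite /Dmap (bigD1 x) //= big1 ?addr0 => [|y /negPf nyx]; rewrite Xa ?eqxx ?scale1r //.
  by rewrite nyx scale0r.
have Xc c : vN *m rN (cellp c) *m a *m rN (ptp y) *m eN =
    vN *m rN (cellp c * ptp (x^-1 * y))%g *m eN.
  rewrite -(mulmxA vN) homa ?SymG_in // mulmxA va -!(mulmxA vN) -!reprM.
  by rewrite ptp_cellp ptpM mulgA.
rewrite /Xcoef /vcol !mulmx_suml summxE (bigD1 1%g) ?group1 //= big1 ?addr0.
  rewrite -!scalemxAl mxE Xc me rowsign1 mul1r cellp1 mul1g rowstab_ptp.
  have [->|nyx] := eqVneq y x; first by rewrite mulVg group1 ptp1 rowsign1 mxE mulr1n.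
  rewrite ifN ?mxE ?mul0rn //; apply: contraNN nyx => /rowstabP H.
  apply/eqP; apply: (mulgI x^-1%g); rewrite mulVg; apply/permP=> i; rewrite perm1.
  by have := H i; rewrite !base_row_th => -[].
move=> c /andP[Hc nc]; rewrite -!scalemxAl mxE Xc me ifN ?mxE ?mul0rn ?mulr0 //.
apply: contraNN nc => /rowstabP H; apply/eqP/permP=> q; rewrite perm1.
have := H (th (inr (q, j0))); rewrite permM cellpE ptpE !base_row_th /= => -[_ Eq].
by apply: cell_inj => //; move/rowstabP/(_ q): Hc => [/negb_inj-> ->].
Qed.

Lemma Dmap_onto Y : (Y \in enveloping_algebra_mx rD)%MS ->
  exists2 a, intertwines rN rN a & Dmap a = Y.
Proof.
have D0 : Dmap 0 = 0 by have := Dmap_scale 0 0; rewrite !scale0r.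
case/envelop_mxP=> c ->; apply: (big_ind (fun M => exists2 a, intertwines rN rN a & Dmap a = M)).
- by exists 0 => // g _; rewrite mulmx0 mul0mx.
- move=> _ _ [a homa <-] [b homb <-]; exists (a + b); last exact: Dmap_add.
  by move=> g Gg; rewrite mulmxDr mulmxDl homa ?homb.
move=> x _; have [a homa <-] := Dmap_translate x.
exists (c x *: a); last exact: Dmap_scale.
by move=> g Gg; rewrite -scalemxAr -scalemxAl homa.
Qed.

(** * Natural maps between N and a module with coarser rows *)

Section Natural.
Variables (row1 : 'I_n -> bool * nat).
Hypothesis row1_block : forall q j, row1 (th (inr (q, j))) = (qs q, qrow q).
Variables (d1 : nat) (r1 : mx_representation F (SymG n) d1) (v1 : 'rV[F]_d1) (e1 : 'cV[F]_d1).
Hypothesis mon1 : monomial row1 r1 v1 e1.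

(** Elements stabilising the rows of N fix every free point, so giving these points other labels
    keeps the element in the stabiliser with the same sign. *)
Lemma base_stab_sub h : h \in rowstab rowN ->
  h \in rowstab row1 /\ rowsign F row1 h = rowsign F rowN h.
Proof.
move=> Hh; have H1 : h \in rowstab row1.
  apply: (rowstab_th th'K) => -[k|[q j]]; first by rewrite base_stab_point.
  have [q' [j' [-> E1 E2]]] := base_stab_block q j Hh.
  by rewrite !row1_block E1 E2.
split=> //; rewrite [RHS]/rowsign; apply: rowsignE => // i; rewrite restr_rowE //.
rewrite -(th'K i); case: (th' i) => [k|[q j]]; last by rewrite base_row_th row1_block.
by rewrite base_stab_point // !if_same.
Qed.

(** [f] sends [vN] to [v1], and [g] followed by the coordinate [eN] is [e1]. Only [c = 1] survives
    in [vcol], since a column permutation of the cells that also preserves rows is trivial; what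
    remains is the sign on the stabiliser of the labels of the free points. *)
Lemma Dmap_natural : exists f g, [/\ intertwines rN r1 f, intertwines r1 rN g
  & Dmap (f *m g) = sigma_mx (fun i => row1 (th (inl i))) rD].
Proof.
case: (monN) => mv me _; case: (mon1) => mv1 me1 _.
have u1 : {in rowstab rowN, forall h, v1 *m r1 h = rowsign F rowN h *: v1}.
  by move=> h /base_stab_sub[H1 <-]; apply: mv1.
have eta1 : {in rowstab rowN, forall h, r1 h *m e1 = rowsign F rowN h *: e1}.
  by move=> h /base_stab_sub[H1 <-]; apply: monomial_coord mon1 _ H1.
pose f := frob_hom rowN rN r1 eN v1; pose g := frob_hom rowN r1 rN e1 vN.
have homf : intertwines rN r1 f by apply: frob_intertwines (monomial_coord monN) u1.
have homg : intertwines r1 rN g by apply: frob_intertwines eta1 mv.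
have vf : vN *m f = v1 by apply: frob_eval monN _ _ _ u1.
have ge : g *m eN = e1 by apply: frob_coeval monN _ _ _ eta1.
exists f, g; split=> //; rewrite /Dmap sigma_mxE [RHS]big_mkcond /=.
apply: eq_bigr => x _; suff -> : Xcoef (f *m g) x =
    if ptp x \in rowstab row1 then rowsign F row1 (ptp x) else 0.
  rewrite rowstab_ptp; case: ifP => Hx; last by rewrite scale0r.
  by rewrite rowsign_ptp.
rewrite /Xcoef mulmxA -(mulmxA _ g) -homg ?SymG_in // -!mulmxA ge !mulmxA.
rewrite /vcol !mulmx_suml summxE (bigD1 1%g) ?group1 //= big1 ?addr0.
  by rewrite rowsign1 scale1r cellp1 repr_mx1 mulmx1 vf me1 mxE mulr1n.
move=> c /andP[Hc nc]; rewrite -!scalemxAl mxE -(mulmxA vN) homf ?SymG_in // mulmxA vf.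
rewrite -(mulmxA v1) -reprM me1 ifN ?raddf0 ?mxE ?mulr0 //.
apply: contraNN nc => /rowstabP H; apply/eqP/permP=> q; rewrite perm1.
have := H (th (inr (q, j0))); rewrite permM cellpE ptpE /= !row1_block => -[_ Eq].
apply: cell_inj => //; by move/rowstabP/(_ q): Hc => [/negb_inj-> ->].
Qed.

End Natural.

(** A nonzero value places blocks and free points in the rows of Z. The first bound adds diagram
    dominance for the blocks to [dcount] for the free points; the second discards the free points
    and uses dominance for the complementary cells. *)
Lemma Dmap_counts (rowZ : 'I_n -> bool * nat) dZ (rZ : mx_representation F (SymG n) dZ)
    vZ eZ (f : 'M_(dN, dZ)) (g : 'M_(dZ, dN)) (dcount : bool -> nat -> nat) :
    monomial rowZ rZ vZ eZ -> intertwines rN rZ f -> intertwines rZ rN g ->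
    (forall row : 'I_r -> bool * nat, sigma_mx row rD != 0 -> forall b k,
       (#|[set i | ((row i).1 == b) && ((row i).2 < k)%N]| <= dcount b k)%N) ->
    Dmap (f *m g) != 0 ->
  forall b k,
    (#|[set i | ((rowZ i).1 == b) && ((rowZ i).2 < k)%N]| <=
       dcount b k + p * #|[set q | (qs q == b) && (qrow q < k)%N]|)%N /\
    (p * #|[set q | (qs q == b) && (k <= qrow q)%N]| <=
       #|[set i | ((rowZ i).1 == b) && (k <= (rowZ i).2)%N]|)%N.
Proof.
move=> monZ homf homg Dcount /(Dmap_neq0 monZ homf homg)[s [Hc Hs Hinj nzs]] b k.
pose m q := (rowZ (s (th (inr (q, j0))))).2.
have m_colinj x z : qlab x = qlab z -> m x = m z -> x = z.
  move=> E Em; apply: (Hinj _ _ j0 E); rewrite [LHS]surjective_pairing.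
  by rewrite [RHS]surjective_pairing !Hs -!/(m _) Em; case: E => ->.
have dom := diagram_dominance (col := fun q => qlab q) cell_init m_colinj
  (fun l => l.1 == b) k.
split.
  rewrite (@card_blocks (fun i => ((rowZ i).1 == b) && ((rowZ i).2 < k)%N) s) => [|q j l].
    rewrite leq_add ?leq_mul2l; first by [].
      exact: (Dcount _ nzs b k).
    rewrite (leq_trans _ dom) ?orbT // subset_leq_card //.
    by apply/subsetP=> q; rewrite !inE Hs.
  by rewrite (Hc q j l).
rewrite (@card_blocks (fun i => ((rowZ i).1 == b) && (k <= (rowZ i).2)%N) s) => [|q j l].
  rewrite (leq_trans _ (leq_addl _ _)) // leq_mul2l; apply/orP; right.
  have tot (h : Q -> nat) : (#|[set q | (qs q == b) && (h q < k)%N]| +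
      #|[set q | (qs q == b) && (k <= h q)%N]|)%N = #|[set q | qs q == b]|.
    rewrite -cardsUI -[RHS]addn0; congr (_ + _)%N.
      by apply: eq_card => q; rewrite !inE -andb_orr ltnNge orNb andbT.
    apply/eqP; rewrite cards_eq0; apply/eqP/setP=> q; rewrite !inE ltnNge.
    by case: leqP; rewrite ?andbF.
  have -> : #|[set q | ((rowZ (s (th (inr (q, j0))))).1 == b)
      && (k <= (rowZ (s (th (inr (q, j0))))).2)%N]| = #|[set q | (qs q == b) && (k <= m q)%N]|.
    by apply: eq_card => q; rewrite !inE Hs.
  rewrite -(leq_add2l #|[set q | (qs q == b) && (m q < k)%N]|) tot -(tot qrow).
  by rewrite leq_add2r.
by rewrite (Hc q j l).
Qed.

End Core.

(** * Socles of Specht modules *)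

Section Symmetrizers.
Variables (F : fieldType) (k : nat).

Section Absorb.
Variables (T : eqType) (row : 'I_k -> bool * T) (d : nat).
Variable rG : mx_representation F (SymG k) d.

Lemma sigma_mxMr h : h \in rowstab row ->
  sigma_mx row rG *m rG h = rowsign F row h *: sigma_mx row rG.
Proof.
move=> Hh; rewrite !sigma_mxE mulmx_suml scaler_sumr [RHS](reindex_inj (mulIg h)) /=.
apply: eq_big => [g|g Hg]; first by rewrite groupMr.
by rewrite -scalemxAl -reprM scalerA rowsignM // mulrA mulrC mulrA rowsign_sqr mul1r.
Qed.

Lemma sigma_mxMl h : h \in rowstab row ->
  rG h *m sigma_mx row rG = rowsign F row h *: sigma_mx row rG.
Proof.
move=> Hh; rewrite !sigma_mxE mulmx_sumr scaler_sumr [RHS](reindex_inj (mulgI h)) /=.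
apply: eq_big => [g|g Hg]; first by rewrite groupMl.
by rewrite -scalemxAr -reprM scalerA rowsignM // mulrA rowsign_sqr mul1r.
Qed.

Lemma sigma_mx_intertwines d' (rG' : mx_representation F (SymG k) d') B :
  intertwines rG rG' B -> sigma_mx row rG *m B = B *m sigma_mx row rG'.
Proof.
move=> hB; rewrite !sigma_mxE mulmx_suml mulmx_sumr; apply: eq_bigr => h _.
by rewrite -scalemxAl hB ?SymG_in // scalemxAr.
Qed.
End Absorb.

Lemma rowsign_nonneg (T : eqType) (row : 'I_k -> bool * T) s :
  (forall i, (row i).1 = false) -> s \in rowstab row -> rowsign F row s = 1.
Proof.
move=> Hr Hs; rewrite (@rowsignE _ _ _ _ _ 1%g) ?odd_perm1 // => i.
by rewrite Hr perm1.
Qed.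

Lemma rowsign_neg (T : eqType) (row : 'I_k -> bool * T) s :
  (forall i, (row i).1 = true) -> s \in rowstab row -> rowsign F row s = sgnF F s.
Proof. by move=> Hr Hs; apply: rowsignE => // i; rewrite Hr. Qed.

End Symmetrizers.

Section SpechtModules.
Variables (F : fieldType) (p : nat).
Hypotheses (charF : p \in [pchar F]) (p_odd : odd p).
Variable nu : seq nat.
Hypothesis nu_part : is_partition nu.
Local Notation k := (sumn nu).
Local Notation R := (regular_repr F (SymG k)).

Definition row_lab (i : 'I_k) := (false, blk nu i).
Definition col_lab (i : 'I_k) := (true, colidx nu i).

Lemma nu_nonincr i j : (i <= j)%N -> (nth 0 nu j <= nth 0 nu i)%N.
Proof.
move=> ij; have [lt_j|ge_j] := ltnP j (size nu); last by rewrite nth_default.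
case/andP: nu_part => srt _.
have geq_trans : transitive geq by move=> a b c /= ba ac; apply: leq_trans ac ba.
have geq_refl : reflexive geq by move=> a /=.
by apply: (sorted_leq_nth geq_trans geq_refl 0%N srt) => //; rewrite inE //; apply: leq_ltn_trans lt_j.
Qed.

Lemma specht_cell_inj (x y : 'I_k) :
  blk nu x = blk nu y -> colidx nu x = colidx nu y -> x = y.
Proof. by move=> rxy cxy; apply: ord_inj; apply: blk_colidx_inj rxy cxy. Qed.

Lemma specht_cell (a b : nat) : (b < nth 0 nu a)%N ->
  exists2 x : 'I_k, colidx nu x = b & blk nu x = a.
Proof. by case/cell_exists=> i Hi [bi ci]; exists (Ordinal Hi). Qed.

Lemma specht_col_init (x : 'I_k) i : (i <= blk nu x)%N ->
  exists2 y : 'I_k, colidx nu y = colidx nu x & blk nu y = i.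
Proof.
move=> Hi; apply: specht_cell; apply: leq_trans (nu_nonincr Hi).
exact: colidx_lt.
Qed.

Lemma opp_eq0 d1 d2 (X : 'M[F]_(d1, d2)) : X = - X -> X = 0.
Proof.
move/eqP; rewrite -subr_eq0 opprK -mulr2n -scaler_nat scaler_eq0.
by rewrite (negPf (odd_pchar_two charF p_odd)) => /eqP.
Qed.

Section InRepresentation.
Variables (d : nat) (rG : mx_representation F (SymG k) d).
Local Notation Amx := (sigma_mx row_lab rG).
Local Notation Bmx := (sigma_mx col_lab rG).

(** Otherwise the transposition of [i] and [j] is absorbed with sign -1 on the left and +1 on the
    right, and the product equals its own opposite. *)
Lemma col_sigma_inj (T : eqType) (row : 'I_k -> bool * T) (y : 'S_k) :
    Bmx *m rG y *m sigma_mx row rG != 0 ->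
  forall i j : 'I_k, colidx nu i = colidx nu j -> row (y i) = row (y j) ->
    (row (y i)).1 = false -> i = j.
Proof.
move=> nz i j cij rij ni; apply/eqP; apply: contraNT nz => nij; apply/eqP/opp_eq0.
have Hc : tperm i j \in rowstab col_lab by apply: rowstab_tperm; rewrite /col_lab cij.
have Hr : (tperm i j ^ y)%g \in rowstab row by rewrite tpermJ rowstab_tperm.
have Er : sigma_mx row rG = rG (tperm i j ^ y)%g *m sigma_mx row rG.
  by rewrite sigma_mxMl // tpermJ rowsign_tperm ?(inj_eq perm_inj) // ni expr0 scale1r.
rewrite {1}Er mulmxA -(mulmxA Bmx) -reprM conjgE mulKVg reprM mulmxA.
rewrite sigma_mxMr // rowsign_tperm //; last by rewrite /col_lab cij.
by rewrite /= expr1 scaleN1r !mulNmx.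
Qed.

Lemma col_sigma_dominance (row : 'I_k -> bool * nat) (y : 'S_k) :
    Bmx *m rG y *m sigma_mx row rG != 0 ->
  forall m, (#|[set i | ((row i).1 == false) && ((row i).2 < m)%N]| <= sumn (take m nu))%N.
Proof.
move=> nz m; have inj := col_sigma_inj nz.
(* Points outside the unsigned rows below [m] get distinct values from [m] on, which keeps [f]
   injective on columns without affecting the counts below [m]. *)
pose f i := if ((row (y i)).1 == false) && ((row (y i)).2 < m)%N then (row (y i)).2
            else (m + i)%N.
have f_lt i : (f i < m)%N = ((row (y i)).1 == false) && ((row (y i)).2 < m)%N.
  rewrite /f; case E: (_ && _); first by case/andP: E.
  by rewrite ltnNge leq_addr.
have f_inj (i j : 'I_k) : colidx nu i = colidx nu j -> f i = f j -> i = j.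
  move=> cij fij; have := f_lt i; rewrite fij f_lt.
  case Ei: (((row (y i)).1 == false) && _) => Ej.
    case/andP: (Ei) => /eqP i1 _; case/andP: (Ej) => /eqP j1 _.
    apply: inj => //; move: fij; rewrite /f Ei Ej => E2.
    by rewrite [LHS]surjective_pairing [RHS]surjective_pairing i1 j1 E2.
  by move: fij; rewrite /f Ei Ej => /addnI/ord_inj.
have := @diagram_dominance _ _ (fun i : 'I_k => blk nu i) (fun i : 'I_k => colidx nu i) f
  specht_col_init f_inj predT m.
rewrite -card_blk_lt; apply: leq_trans.
rewrite -(card_preimset _ (@perm_inj _ y)).
by apply: subset_leq_card; apply/subsetP=> i; rewrite !inE f_lt.
Qed.

(** If the product is nonzero, rigidity writes [g] as a column permutation times a row permutation,
    and both are absorbed up to sign. *)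
Lemma col_row_scalar g : exists c : F, Bmx *m rG g *m Amx = c *: (Bmx *m Amx).
Proof.
have [->|nz] := eqVneq (Bmx *m rG g *m Amx) 0; first by exists 0; rewrite scale0r.
have inj := col_sigma_inj nz.
have [||c Hc] := @diagram_rigidity _ _ (fun i : 'I_k => blk nu i)
    (fun i : 'I_k => colidx nu i) (fun i => blk nu (g i)) specht_col_init.
- by move=> i j cij rij; apply: inj => //; rewrite /row_lab rij.
- move=> m; rewrite -[RHS](card_preimset _ (@perm_inj _ g)).
  by apply: eq_card => i; rewrite !inE.
have cC : c \in rowstab col_lab by apply/rowstabP=> i; rewrite /col_lab; case: (Hc i) => ->.
have hR : (c^-1 * g)%g \in rowstab row_lab.
  apply/rowstabP=> i; rewrite permM /row_lab; have [_ <-] := Hc (c^-1%g i).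
  by rewrite permKV.
exists (rowsign F col_lab c).
rewrite -{1}(mulKVg c g) reprM mulmxA sigma_mxMr // -mulmxA sigma_mxMl //.
by rewrite (@rowsign_nonneg _ _ _ row_lab) // scale1r -scalemxAl.
Qed.

End InRepresentation.

(** Cyclicity of the trace form: the coefficient of [h] in a product of [r] and [y] is the identity
    coefficient of [y], the inverse of [h], then [r]. *)
Lemma coef_swap r y h :
  gelt F r *m R y *m gcoef F h = gelt F y *m R h^-1%g *m R r *m gcoef F 1%g.
Proof.
rewrite !geltM !gelt_coef; congr (_%:R%:M); congr (nat_of_bool _).
apply/eqP/eqP => [<-|E]; first by rewrite invMg mulgA mulgV mul1g mulVg.
have := congr1 (fun z => r * z * r^-1 * h)%g E.
by rewrite /= mulg1 mulgV mul1g -!mulgA mulKVg mulVg mulg1.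
Qed.

Local Notation A := (sigma_mx row_lab R).
Local Notation B := (sigma_mx col_lab R).
Local Notation E_R := (enveloping_algebra_mx R).

Lemma row_lab_sign r : r \in rowstab row_lab -> rowsign F row_lab r = 1.
Proof. by apply: rowsign_nonneg. Qed.

Lemma sigma_row : A = \sum_(r in rowstab row_lab) R r.
Proof. by rewrite sigma_mxE; apply: eq_bigr => r Hr; rewrite row_lab_sign // scale1r. Qed.

Lemma sigma_envelop (T : eqType) (row : 'I_k -> bool * T) : (sigma_mx row R \in E_R)%MS.
Proof.
by apply/envelop_mxP; exists (fun g => if g \in rowstab row then rowsign F row g else 0);
   rewrite sigma_mxE big_mkcond /=; apply: eq_big => [g|g _]; rewrite ?SymG_in //;
   case: ifP => //; rewrite scale0r.
Qed.

Lemma span_swap Y h : (Y \in E_R)%MS ->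
  gelt F 1%g *m A *m Y *m gcoef F h = gelt F 1%g *m Y *m R h^-1%g *m A *m gcoef F 1%g.
Proof.
case/envelop_mxP=> a ->.
rewrite !mulmx_sumr !mulmx_suml; apply: eq_bigr => y _.
rewrite sigma_row !mulmx_sumr !mulmx_suml; apply: eq_bigr => r _.
rewrite -!scalemxAr -!scalemxAl; congr (_ *: _).
have e1 z : gelt F 1%g *m R z = gelt F z by rewrite geltM mul1g.
by rewrite !e1 coef_swap.
Qed.

Lemma col_row_span Y g : (Y \in E_R)%MS -> exists c : F, B *m Y *m R g *m A = c *: (B *m A).
Proof.
case/envelop_mxP=> a ->; rewrite mulmx_sumr !mulmx_suml.
apply: (big_ind (fun M => exists c : F, M = c *: (B *m A))).
- by exists 0; rewrite scale0r.
- by move=> _ _ [c ->] [c' ->]; exists (c + c'); rewrite scalerDl.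
move=> y _; have [c Hc] := col_row_scalar R (y * g)%g.
by exists (a y * c); rewrite -scalemxAr -!scalemxAl -(mulmxA B) -reprM Hc scalerA.
Qed.

(** By cyclicity each coefficient of A B Y is an identity coefficient of some B Y g A, so one of
    these is nonzero; by [col_row_span] it is a multiple of B A. *)
Lemma col_row_detect Y : (Y \in E_R)%MS -> gelt F 1%g *m A *m B *m Y != 0 ->
  exists g, exists2 c : F, c != 0 & B *m Y *m R g *m A = c *: (B *m A).
Proof.
move=> EY nz; have EBY : (B *m Y \in E_R)%MS by rewrite envelop_mxM // sigma_envelop.
have [/existsP[g Hg]|/existsPn H] := boolP [exists g, B *m Y *m R g *m A != 0].
  have [c Hc] := col_row_span g EY; exists g, c => //.
  by apply: contraNneq Hg => c0; rewrite Hc c0 scale0r.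
case/eqP: nz; apply: row_gcoefP => h; rewrite -(mulmxA _ B) span_swap //.
transitivity (gelt F 1%g *m (B *m Y *m R h^-1%g *m A) *m gcoef F 1%g).
  by rewrite !mulmxA.
by have := H h^-1%g; rewrite negbK => /eqP ->; rewrite mulmx0 mul0mx.
Qed.

Section Restricted.
Hypothesis nu_res : prestricted p nu.

Let clen := collen (fun i : 'I_k => colidx nu i).
Definition len_lab (i : 'I_k) := (false, (blk nu i, clen i)).

(** With rows counted from 0, the columns of length [m] have indices from [nth 0 nu m] up to, but
    excluding, [nth 0 nu m.-1]; p-restriction bounds their number, and a row meets each of them at
    most once. *)
Lemma card_len_fibre x : (#|[set y | len_lab y == len_lab x]| < p)%N.
Proof.
pose m := clen x; have lt_m : (blk nu x < m)%N.
  exact: (row_lt_collen (row := fun i : 'I_k => blk nu i) specht_col_init).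
have bound y : clen y = m -> (nth 0 nu m <= colidx nu y < nth 0 nu m.-1)%N.
  move=> ym; apply/andP; split.
    rewrite leqNgt; apply/negP => /specht_cell[z cz rz].
    have := row_lt_collen (row := fun i : 'I_k => blk nu i) specht_col_init z.
    by rewrite rz (eq_collen cz) -/(clen y) ym ltnn.
  have [|z <- <-] := collen_row (row := fun i : 'I_k => blk nu i) specht_cell_inj
     specht_col_init (x := y) (i := m.-1).
    by rewrite -/(clen y) ym; lia.
  exact: colidx_lt.
have := nu_res m.-1; rewrite prednK; last by lia.
apply: leq_ltn_trans; set a := nth 0%N nu m.-1 in bound *; set b := nth 0%N nu m in bound *.
have [->|] := eqVneq #|[set y | len_lab y == len_lab x]| 0%N; first by [].
rewrite cards_eq0 => /set0Pn[y0]; rewrite inE => /eqP[_ y0m].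
have ab : (0 < a - b)%N by have := bound y0 y0m; lia.
rewrite -[X in (_ <= X)%N](card_ord (a - b)) -(prednK ab).
rewrite -(card_in_imset (f := fun y : 'I_k => inord (colidx nu y - b) : 'I_(a - b).-1.+1)).
  exact: max_card.
move=> y z; rewrite !inE => /eqP[ry ym] /eqP[rz zm] /(congr1 val) /=.
have := bound y ym; have := bound z zm => bz b_y.
rewrite !inordK ?prednK //; try lia.
move=> E; apply: specht_cell_inj; first by rewrite ry rz.
by lia.
Qed.

(* The coefficient at the column reversal [w] is the sign of [w] times the number of
   row permutations preserving column lengths, which is prime to [p] since at most
   [p - 1] columns have a given length. *)
Lemma row_col_row_neq0 : gelt F 1%g *m A *m B *m A != 0.
Proof.
have [w wP] := column_reversal_exists (row := fun i : 'I_k => blk nu i) specht_cell_inj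
  specht_col_init.
have wC : w \in rowstab col_lab by apply/rowstabP=> i; rewrite /col_lab (wP i).1.
suff E : gelt F 1%g *m A *m B *m A *m gcoef F w =
   (rowsign F col_lab w * #|rowstab len_lab|%:R)%:M.
  apply: contraTneq isT => z; have /matrixP/(_ 0 0) := E.
  rewrite z mul0mx !mxE mulr1n => /esym/eqP; rewrite mulf_eq0 (negPf (rowsign_neq0 _ _ _)).
  by rewrite -(dvdn_pcharf charF) (negPf (rowstab_order_prime (pcharf_prime charF) card_len_fibre)).
have sub0 : rowstab len_lab \subset rowstab row_lab.
  by apply/subsetP=> s /rowstabP H; apply/rowstabP=> i; have := H i; rewrite /len_lab /row_lab => -[->].
have -> : gelt F 1%g *m A *m B *m A *m gcoef F w = \sum_(r in rowstab row_lab)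
    (\sum_(c in rowstab col_lab) \sum_(r' in rowstab row_lab)
       rowsign F col_lab c * ((r * c * r')%g == w)%:R)%:M.
  rewrite {1}sigma_row mulmx_sumr !mulmx_suml; apply: eq_bigr => r _.
  rewrite geltM mul1g [B]sigma_mxE mulmx_sumr !mulmx_suml raddf_sum; apply: eq_bigr => c _ /=.
  rewrite sigma_row mulmx_sumr mulmx_suml raddf_sum; apply: eq_bigr => r' _ /=.
  by rewrite -scalemxAr geltM -!scalemxAl geltM gelt_coef scale_scalar_mx.
(* By [factor_reversal], a row permutation that changes some column length is the first factor of no
   factorisation of [w]. *)
rewrite (bigID (mem (rowstab len_lab))) /= [X in _ + X]big1 ?addr0; last first.
  move=> r /andP[/rowstabP Hr nr]; rewrite big1 ?raddf0 // => c /rowstabP Hc.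
  rewrite big1 // => r' /rowstabP Hr'; case: eqP => [Ew|_]; last by rewrite mulr0.
  case/negP: nr; apply/rowstabP=> i; rewrite /len_lab.
  have [-> ] := Hr i; congr (_, (_, _)).
  apply: (factor_reversal (row := fun i : 'I_k => blk nu i) specht_cell_inj specht_col_init wP _ _ _ Ew).
  - by move=> x; have [] := Hr x.
  - by move=> x; have [] := Hc x.
  - by move=> x; have [] := Hr' x.
rewrite (eq_bigr (fun=> (rowsign F col_lab w)%:M)) => [|r /andP[Rr R0r]]; last first.
  (* For such [r] exactly one pair completes the factorisation: [c = w] and the conjugate [r0]. It
     is unique because a permutation preserving both rows and columns is trivial. *)
  congr (_%:M); pose r0 := (r^-1 ^ w)%g.
  have r0R : r0 \in rowstab row_lab.
    apply/rowstabP=> i; rewrite -(permKV w i) permJ /row_lab (wP _).2.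
    set z := (w^-1)%g i; have R0r' : r^-1%g \in rowstab len_lab by rewrite groupV.
    by have /rowstabP/(_ z)[-> E] := R0r'; rewrite -/(clen _) E (wP z).2.
  have r0M : (r * w * r0 = w)%g by rewrite /r0 conjgE !mulgA mulgK mulgV mul1g.
  clearbody r0.
  rewrite (bigD1 w) //= (bigD1 r0) //= r0M eqxx mulr1 !big1 ?addr0 // => [c /andP[Hc nc]|r' /andP[Hr' nr']].
    rewrite big1 // => r' Hr'; case: eqP => [E|_]; last by rewrite mulr0.
    have Ez : (w^-1 * c = r0 * r'^-1)%g.
      have E1 : (c * r' = w * r0)%g by apply: (mulgI r); rewrite !mulgA r0M E.
      by apply: (mulIg r'); rewrite -mulgA E1 mulKg mulgKV.
    have zC : (w^-1 * c)%g \in rowstab col_lab by rewrite groupM ?groupV.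
    have zR : (w^-1 * c)%g \in rowstab row_lab by rewrite Ez groupM ?groupV.
    case/negP: nc; apply/eqP/(mulgI w^-1%g); rewrite mulVg; apply/permP=> i; rewrite perm1.
    by move/rowstabP/(_ i): zC => [E1]; move/rowstabP/(_ i): zR => [E2]; apply: specht_cell_inj.
  case: eqP => [E|_]; last by rewrite mulr0.
  by case/negP: nr'; apply/eqP/(mulgI (r * w)%g); rewrite E r0M.
rewrite (eq_bigl (mem (rowstab len_lab))) => [|r]; last first.
  by rewrite andb_idl // => /(subsetP sub0).
by rewrite sumr_const -raddfMn mulr_natr.
Qed.

Lemma Sgen_sigma : Sgen F k nu = gelt F 1%g *m A *m B.
Proof.
have -> : Sgen F k nu = \sum_(r in rowstab row_lab) \sum_(c in rowstab col_lab)
    rowsign F col_lab c *: gelt F (r * c)%g.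
  apply: eq_big => [r|r _]; first by rewrite !inE; apply: eq_forallb => i; rewrite /eq_op /=.
  have eqC : colgrp k nu = rowstab col_lab.
    by apply/setP=> c; rewrite !inE; apply: eq_forallb => i; rewrite /eq_op /=.
  by rewrite eqC; apply: eq_bigr => c Hc; rewrite (@rowsign_neg _ _ _ col_lab).
rewrite sigma_row mulmx_sumr mulmx_suml; apply: eq_bigr => r _.
rewrite sigma_mxE mulmx_sumr; apply: eq_bigr => c _.
by rewrite -scalemxAr !geltM mul1g.
Qed.

Local Notation V0 := (cyclic_mx R (Sgen F k nu)).
Local Notation rS := (Specht F nu).

Lemma val_specht (v : 'rV[F]_(\rank V0)) :
  exists2 Y, (Y \in E_R)%MS & val_submod v = gelt F 1%g *m A *m B *m Y.
Proof.
have [a ->] := cyclic_spanP (val_submodP v); exists (\sum_g a g *: R g).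
  by apply/envelop_mxP; exists a; apply: eq_bigl => g; rewrite SymG_in.
by rewrite mulmx_sumr; apply: eq_bigr => g _; rewrite -scalemxAr Sgen_sigma.
Qed.

Lemma val_specht_intertwines : intertwines rS R (val_submod 1%:M).
Proof.
move=> g Gg; rewrite -val_submodE -[rS g]mul1mx.
exact: (val_submodJ (cyclic_mx_module R (Sgen F k nu)) 1%:M Gg).
Qed.

Lemma module_sigma d (rG : mx_representation F (SymG k) d) (T : eqType)
    (row : 'I_k -> bool * T) m1 m2 (V : 'M_(m1, d)) (v : 'M_(m2, d)) :
  mxmodule rG V -> (v <= V)%MS -> (v *m sigma_mx row rG <= V)%MS.
Proof.
move=> modV vV; rewrite sigma_mxE mulmx_sumr summx_sub // => h _.
by rewrite -scalemxAr scalemx_sub // mxmodule_trans ?SymG_in.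
Qed.

Definition specht_gen : 'rV[F]_(\rank V0) := in_submod V0 (gelt F 1%g *m A *m B *m A).

Lemma val_specht_gen : val_submod specht_gen = gelt F 1%g *m A *m B *m A.
Proof.
by apply: in_submodK; rewrite module_sigma ?cyclic_mx_module // -Sgen_sigma cyclic_mx_id.
Qed.

Lemma specht_gen_neq0 : specht_gen != 0.
Proof. by rewrite -val_submod_eq0 val_specht_gen row_col_row_neq0. Qed.

(** A nonzero vector A B Y of the submodule is moved by a suitable [g] and the row symmetriser to a
    nonzero multiple of A B A. So the single vector [specht_gen] lies in all nonzero submodules. *)
Lemma specht_gen_min m (V : 'M_(m, \rank V0)) :
  mxmodule rS V -> V != 0 -> (specht_gen <= V)%MS.
Proof.
move=> modV nzV; have [Y EY Ev] := val_specht (nz_row V).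
have nzY : gelt F 1%g *m A *m B *m Y != 0 by rewrite -Ev val_submod_eq0 nz_row_eq0.
have [g [c nzc Hc]] := col_row_detect EY nzY.
suff E : nz_row V *m rS g *m sigma_mx row_lab rS = c *: specht_gen.
  rewrite -[specht_gen](scalerK nzc) -E scalemx_sub // module_sigma //.
  by rewrite mxmodule_trans ?SymG_in // nz_row_sub.
apply: (@val_submod_inj _ _ V0); rewrite linearZ /= val_specht_gen val_submodE.
rewrite -mulmxA (sigma_mx_intertwines _ val_specht_intertwines) mulmxA.
rewrite -(mulmxA _ (rS g)) val_specht_intertwines ?SymG_in // mulmxA -val_submodE Ev.
transitivity (gelt F 1%g *m A *m (B *m Y *m R g *m A)); first by rewrite !mulmxA.
by rewrite Hc -scalemxAr mulmxA.
Qed.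

(** The submodule generated by [specht_gen] is simple; a nonzero complement to it in the socle would
    contain [specht_gen] as well. *)
Lemma specht_socle_simple U : is_socle rS U -> mxsimple rS U.
Proof.
case=> modU [[redU] maxU]; pose J := cyclic_mx rS specht_gen.
have simJ : mxsimple rS J.
  split; [exact: cyclic_mx_module | by rewrite cyclic_mx_eq0 specht_gen_neq0 |].
  by move=> V modV _ nzV; apply: cyclic_mx_sub => //; apply: specht_gen_min.
have JU := maxU J simJ.
have [W modW defU dx] := redU J (cyclic_mx_module _ _) JU.
have W0 : W = 0.
  apply/eqP; apply: contraT => nzW; have gW := specht_gen_min modW nzW.
  have gJ : (specht_gen <= J)%MS by apply: cyclic_mx_id.
  have : (specht_gen <= J :&: W)%MS by rewrite sub_capmx gJ.
  by rewrite (mxdirect_addsP dx) submx0 (negPf specht_gen_neq0).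
apply: (mx_iso_simple _ simJ); apply: eqmx_iso.
by apply: eqmx_trans defU; rewrite W0; apply: eqmx_sym; apply: addsmx0.
Qed.

(** Dominance holds because vectors of the Specht module have the form A B Y, so a symmetriser
    acting as nonzero has some B g sigma nonzero. *)
Lemma specht_socle_facts U (modU : mxmodule rS U) : is_socle rS U ->
  [/\ mx_irreducible (submod_repr modU),
      (forall row : 'I_k -> bool * nat, sigma_mx row (submod_repr modU) != 0 ->
        forall m, (#|[set i | ((row i).1 == false) && ((row i).2 < m)%N]|
                     <= sumn (take m nu))%N)
    & sigma_mx row_lab (submod_repr modU) != 0].
Proof.
move=> socU; have simU := specht_socle_simple socU.
pose D := submod_repr modU.
pose iota : 'M_(\rank U, _) := val_submod (val_submod (1%:M : 'M_(\rank U))).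
have iotaE (u : 'rV_(\rank U)) : u *m iota = val_submod (val_submod u).
  by rewrite /iota [val_submod (val_submod u)]val_submodE (val_submodE u)
    [val_submod (val_submod 1%:M)]val_submodE mulmxA.
have iota_hom : intertwines D R iota.
  rewrite /iota [val_submod (val_submod 1%:M)]val_submodE.
  apply: intertwinesM val_specht_intertwines => g Gg.
  by rewrite -val_submodE -[D g]mul1mx; apply: (val_submodJ modU 1%:M Gg).
have iota_inj (u : 'rV[F]_(\rank U)) : u *m iota = 0 -> u = 0.
  by rewrite iotaE => /eqP; rewrite !val_submod_eq0 => /eqP.
split; first exact/submod_mx_irr.
- move=> row nz m.
  have [/existsP[g Hg]|/existsPn H] := boolP [exists g, B *m R g *m sigma_mx row R != 0].
    exact: col_sigma_dominance Hg m.
  case/eqP: nz; apply/row_matrixP=> i; rewrite row0 rowE; apply: iota_inj.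
  rewrite -mulmxA (sigma_mx_intertwines _ iota_hom) mulmxA iotaE.
  have [Y /envelop_mxP[a ->] ->] := val_specht (val_submod (delta_mx 0 i)).
  rewrite mulmx_sumr mulmx_suml big1 // => g _.
  rewrite -scalemxAr -scalemxAl; have := H g; rewrite negbK => /eqP Hg.
  have -> : gelt F 1%g *m A *m B *m R g *m sigma_mx row R =
      gelt F 1%g *m A *m (B *m R g *m sigma_mx row R) by rewrite !mulmxA.
  by rewrite Hg mulmx0 scaler0.
(* With Y = A: the row symmetriser sends the translate by [g] of A B A, a vector of the socle, to a
   nonzero multiple of A B A. *)
have [g [c nzc Hc]] := col_row_detect (sigma_envelop row_lab) row_col_row_neq0.
have jU : (specht_gen <= U)%MS by apply: specht_gen_min => //; case: simU.
apply: contraNneq row_col_row_neq0 => z.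
have : in_submod U specht_gen *m D g *m sigma_mx row_lab D *m iota = 0.
  by rewrite z mulmx0 mul0mx.
rewrite -mulmxA (sigma_mx_intertwines _ iota_hom) mulmxA -(mulmxA _ (D g)) iota_hom ?SymG_in //.
rewrite mulmxA iotaE in_submodK // val_specht_gen.
have -> : gelt F 1%g *m A *m B *m A *m R g *m A =
    gelt F 1%g *m A *m (B *m A *m R g *m A) by rewrite !mulmxA.
rewrite Hc -scalemxAr mulmxA => /eqP; rewrite scaler_eq0 (negPf nzc) => /eqP E.
exact/eqP.
Qed.

End Restricted.
End SpechtModules.

(** * Indecomposable summands *)

Section Indecomposables.
Variables (F : fieldType) (gT : finGroupType) (G : {group gT}).

(** The rank can drop at most [d] times, and once it is stationary all later images coincide. *)
Lemma power_image_stable d (B : 'M[F]_d) :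
  exists m, (B ^+ m.+1 <= B ^+ (m.+1 + m.+1))%MS.
Proof.
have step m : (exists2 i, (i < m)%N & \rank (B ^+ i.+1) = \rank (B ^+ i))
    \/ (\rank (B ^+ m) + m <= d)%N.
  elim: m => [|m [[i im Hi]|IH]]; first by right; rewrite addn0 rank_leq_row.
    by left; exists i => //; apply: ltnW.
  have [E|ne] := eqVneq (\rank (B ^+ m.+1)) (\rank (B ^+ m)); first by left; exists m.
  right; rewrite addnS -addSn (leq_trans _ IH) // leq_add2r ltn_neqAle ne /=.
  by rewrite exprS mxrankM_maxr.
have [[m _ Em]|] := step d.+1; last first.
  by rewrite addnS ltnNge leq_addl.
exists m; have eqBm : (B ^+ m <= B ^+ m.+1)%MS.
  by rewrite -(geq_leqif (mxrank_leqif_sup _)) ?Em // exprS submxMl.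
have stable j : (B ^+ m <= B ^+ (m + j))%MS.
  elim: j => [|j IH]; first by rewrite addn0.
  by apply: submx_trans eqBm _; rewrite exprSr addnS exprSr submxMr.
apply: (@submx_trans _ _ _ _ _ _ (B ^+ m)); first by rewrite exprS submxMl.
by rewrite addSnnS; apply: stable.
Qed.

(* Fitting: [V] is the direct sum of the kernel and the image of a high power. *)
Lemma indecomposable_unit d (r : mx_representation F G d) (B : 'M_d) :
    indecomposable r -> intertwines r r B -> (forall m, B ^+ m != 0) ->
  B \in unitmx.
Proof.
move=> [d_gt0 indr] homB nzB; have [m Hm] := power_image_stable B.
pose X := B ^+ m.+1; have homX : intertwines r r X by apply: intertwinesX.
have modK : mxmodule r (kermx X).
  by apply/mxmoduleP=> g Gg; apply/sub_kermxP; rewrite -mulmxA homX // mulmxA mulmx_ker mul0mx.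
have modX : mxmodule r X by apply/mxmoduleP=> g Gg; rewrite -homX // submxMl.
have full : (kermx X + X == 1%:M)%MS.
  rewrite submx1 /=; have /submxP[Z defX] : (X <= X *m X)%MS.
    by move: Hm; rewrite exprD.
  rewrite -[X in (X <= _)%MS](subrK (Z *m X)) addmx_sub_adds ?submxMl //.
  by apply/sub_kermxP; rewrite mulmxBl mul1mx -mulmxA -defX subrr.
have dir : mxdirect (kermx X + X).
  by rewrite mxdirectE /= (eqmxP full) mxrank1 mxrank_ker subnK // rank_leq_row.
have [/eqP K0|/eqP X0] := indr _ _ modK modX dir full; last first.
  by have := nzB m.+1; rewrite -/X X0 eqxx.
have : X \in unitmx by rewrite -row_free_unit -kermx_eq0 K0.
by rewrite /X exprS unitmx_mul => /andP[].
Qed.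

(** [u *m w] and [w *m u] are nilpotent together, so by Fitting both are invertible, and then [u] is
    an isomorphism. *)
Lemma nonnilpotent_rsim d1 d2 (r1 : mx_representation F G d1) (r2 : mx_representation F G d2) u w :
    indecomposable r1 -> indecomposable r2 -> intertwines r1 r2 u -> intertwines r2 r1 w ->
    (forall m, (u *m w) ^+ m != 0) ->
  mx_rsim r1 r2.
Proof.
move=> ind1 ind2 homu homw nz.
have shift m : (u *m w) ^+ m.+1 = u *m (w *m u) ^+ m *m w.
  elim: m => [|m IH]; first by rewrite expr1 mulmx1.
  by rewrite exprS IH exprS [(u *m w) * _]mulmxA; rewrite -!mulmxE !mulmxA.
have uwU : u *m w \in unitmx by apply: indecomposable_unit ind1 (intertwinesM homu homw) nz.
have wuU : w *m u \in unitmx.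
  apply: indecomposable_unit ind2 (intertwinesM homw homu) _ => m.
  by apply: contraNneq (nz m.+1) => z; rewrite shift z mulmx0 mul0mx.
have freeu : row_free u.
  by apply/row_freeP; exists (w *m invmx (u *m w)); rewrite mulmxA mulmxV.
have freew : row_free w.
  by apply/row_freeP; exists (u *m invmx (w *m u)); rewrite mulmxA mulmxV.
have d12 : d1 = d2.
  apply/eqP; rewrite eqn_leq -{1}(eqP freeu) rank_leq_col.
  by rewrite -{1}(eqP freew) rank_leq_col.
exact: MxReprSim d12 freeu homu.
Qed.

Lemma rsim_inverse d1 d2 (r1 : mx_representation F G d1) (r2 : mx_representation F G d2) :
    mx_rsim r1 r2 ->
  exists B C, [/\ intertwines r1 r2 B, intertwines r2 r1 C, B *m C = 1%:M & C *m B = 1%:M].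
Proof.
case=> B d12; case: d2 / d12 r2 B => r2 B freeB homB.
have uB : B \in unitmx by rewrite -row_free_unit.
exists B, (invmx B); split; rewrite ?mulmxV ?mulVmx //.
move=> g Gg; apply: (can_inj (mulKmx uB)); rewrite !mulmxA -homB // mulmxK //.
by rewrite mulmxV // mul1mx.
Qed.

Lemma irreducible_reach (gT' : finGroupType) (G' : {group gT'}) dD
    (rD : mx_representation F G' dD) (v w : 'rV_dD) :
    mx_irreducible rD -> v != 0 ->
  exists2 Y, (Y \in enveloping_algebra_mx rD)%MS & v *m Y = w.
Proof.
case=> _ _ simD nzv; have full : (1%:M <= cyclic_mx rD v)%MS.
  by apply: simD; rewrite ?cyclic_mx_module ?submx1 ?cyclic_mx_eq0.
have /cyclic_mxP[Y EY ->] : (w <= cyclic_mx rD v)%MS by apply: submx_trans (submx1 w) full.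
by exists Y.
Qed.

(* A multiplicative map from [End rN] onto an irreducible matrix algebra is
   nonzero on maps through at most one indecomposable module. *)
Lemma simple_quotient_rsim (gT' : finGroupType) (G' : {group gT'}) dN dD
    (rN : mx_representation F G dN) (rD : mx_representation F G' dD)
    (Dfun : 'M[F]_dN -> 'M[F]_dD) d1 d2 (r1 : mx_representation F G d1)
    (r2 : mx_representation F G d2) f1 g1 f2 g2 :
    Dfun 0 = 0 ->
    (forall a b, intertwines rN rN a -> intertwines rN rN b ->
       Dfun (a *m b) = Dfun a *m Dfun b) ->
    (forall Y, (Y \in enveloping_algebra_mx rD)%MS ->
       exists2 a, intertwines rN rN a & Dfun a = Y) ->
    mx_irreducible rD -> indecomposable r1 -> indecomposable r2 ->
    intertwines rN r1 f1 -> intertwines r1 rN g1 -> Dfun (f1 *m g1) != 0 ->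
    intertwines rN r2 f2 -> intertwines r2 rN g2 -> Dfun (f2 *m g2) != 0 ->
  mx_rsim r1 r2.
Proof.
move=> D0 DM Donto irrD ind1 ind2 hf1 hg1 nz1 hf2 hg2 nz2.
have nzrow (X : 'M[F]_dD) : X != 0 -> exists2 v : 'rV_dD, v != 0 & v *m X != 0.
  move=> nzX; have /existsP[i Hi] : [exists i, row i X != 0].
    apply: contraNT nzX => /existsPn H; apply/eqP/row_matrixP=> i; rewrite row0.
    by apply/eqP; have := H i; rewrite negbK.
  exists (delta_mx 0 i); last by rewrite -rowE.
  by apply: contraNneq Hi => z; rewrite rowE z mul0mx.
have [v1 nzv1 nzw1] := nzrow _ nz1; have [v2 nzv2 nzw2] := nzrow _ nz2.
(* [Y] carries the image of [v1] under the first value to [v2], and [Y'] carries the image of [v2]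
   under the second value back to [v1]. Hence [psi] below acts on [v1] as the identity and is not
   nilpotent. *)
have [Y EY vY] := irreducible_reach v2 irrD nzw1.
have [Y' EY' vY'] := irreducible_reach v1 irrD nzw2.
have [a homa Da] := Donto _ EY; have [a' homa' Da'] := Donto _ EY'.
pose psi := f1 *m g1 *m a *m (f2 *m g2) *m a'.
have hom11 := intertwinesM hf1 hg1; have hom22 := intertwinesM hf2 hg2.
have hom1a := intertwinesM hom11 homa; have hom1a2 := intertwinesM hom1a hom22.
have hompsi : intertwines rN rN psi by apply: intertwinesM hom1a2 homa'.
have vpsi : v1 *m Dfun psi = v1.
  rewrite /psi (DM _ _ hom1a2 homa') (DM _ _ hom1a hom22) (DM _ _ hom11 homa) Da Da'.
  by rewrite !mulmxA vY vY'.
have nzpsi m : psi ^+ m.+1 != 0.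
  have : v1 *m Dfun (psi ^+ m.+1) = v1.
    elim: m => [|m IH]; first by rewrite expr1.
    by rewrite exprS DM ?mulmxA ?vpsi //; apply: intertwinesX.
  by apply: contra_eq_neq => ->; rewrite D0 mulmx0 eq_sym.
pose u := g1 *m a *m f2; pose w := g2 *m a' *m f1.
have homu : intertwines r1 r2 u by apply: intertwinesM hf2; apply: intertwinesM homa.
have homw : intertwines r2 r1 w by apply: intertwinesM hf1; apply: intertwinesM homa'.
apply: nonnilpotent_rsim ind1 ind2 homu homw _ => m.
have shift : psi ^+ m.+1 = f1 *m (u *m w) ^+ m *m (u *m (g2 *m a')).
  elim: m => [|m IH]; first by rewrite expr1 expr0 mulmx1 /psi /u !mulmxA.
  rewrite exprS IH (exprS (u *m w) m) -!mulmxE /psi /u /w !mulmxA //.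
by apply: contraNneq (nzpsi m) => z; rewrite shift z mulmx0 mul0mx.
Qed.

Section Submodules.
Variables (d : nat) (r : mx_representation F G d).

Lemma val_submod_hom (U : 'M[F]_d) (modU : mxmodule r U) :
  intertwines (submod_repr modU) r (val_submod 1%:M).
Proof.
move=> g Gg; rewrite -val_submodE -[submod_repr modU g]mul1mx.
exact: (val_submodJ modU 1%:M Gg).
Qed.

Lemma in_submod_hom (U : 'M[F]_d) (modU : mxmodule r U) (B : 'M_d) :
  (B <= U)%MS -> intertwines r r B -> intertwines r (submod_repr modU) (in_submod U B).
Proof.
move=> BU homB g Gg; rewrite -[RHS](in_submodJ modU g BU) -homB //.
by rewrite [in_submod U (_ *m _)]in_submodE [in_submod U B]in_submodE mulmxA.
Qed.

Lemma direct_components_hom k (W B : 'I_k -> 'M[F]_d) :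
    (forall i, mxmodule r (W i)) -> mxdirect (\sum_i W i)%MS ->
    (forall i, (B i <= W i)%MS) -> \sum_i B i = 1%:M ->
  forall i, intertwines r r (B i).
Proof.
move=> modW /mxdirect_sumsP dx BW sumB i g Gg.
pose E j := r g *m B j - B j *m r g.
have EW j : (E j <= W j)%MS.
  by rewrite addmx_sub ?eqmx_opp ?(mxmodule_trans (modW j) Gg (BW j)) // mulmx_sub.
have sumE : \sum_j E j = 0.
  by rewrite sumrB -mulmx_sumr -mulmx_suml sumB mulmx1 mul1mx subrr.
apply/eqP; rewrite -subr_eq0 -/(E i) -submx0 -(dx i) // sub_capmx EW /=.
move/eqP: sumE; rewrite (bigD1 i) //= addr_eq0 => /eqP ->.
by rewrite eqmx_opp summx_sub // => j ji; apply: submx_trans (EW j) (sumsmx_sup j _ _).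
Qed.
End Submodules.

Lemma summand_maps dM dY (rM : mx_representation F G dM) (rY : mx_representation F G dY) :
    is_summand rM rY ->
  exists i q, [/\ intertwines rY rM i, intertwines rM rY q & i *m q = 1%:M].
Proof.
case=> U [modU [/rsim_inverse[S [S' [homS homS' _ S'S]]] [V [modV [dx full]]]]].
have /sub_addsmxP[[u v] /= E1] : (1%:M <= U + V)%MS by case/andP: full.
have homP : intertwines rM rM (u *m U).
  move=> g Gg; apply/eqP; rewrite -subr_eq0 -submx0 -(mxdirect_addsP dx) sub_capmx.
  have sub (x : 'M_dM) Z : mxmodule rM Z -> (rM g *m (x *m Z) - x *m Z *m rM g <= Z)%MS.
    move=> modZ; apply: addmx_sub; first by rewrite mulmx_sub ?submxMl.
    by rewrite eqmx_opp -mulmxA mulmx_sub // (mxmoduleP modZ).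
  rewrite sub //=; have -> : u *m U = 1%:M - v *m V by rewrite E1 addrK.
  rewrite mulmxBr mulmxBl mulmx1 mul1mx opprB addrC subrKA -opprB.
  by rewrite eqmx_opp sub.
pose vU := val_submod (1%:M : 'M_(\rank U)).
have vP : vU *m (u *m U) = vU.
  have D1 : vU - vU *m (u *m U) = vU *m (v *m V).
    by rewrite -[X in X - _]mulmx1 E1 mulmxDr addrAC subrr add0r.
  apply/eqP; rewrite eq_sym -subr_eq0 -submx0 -(mxdirect_addsP dx) sub_capmx.
  apply/andP; split; last by rewrite D1 mulmxA submxMl.
  by apply: addmx_sub; [exact: val_submodP | rewrite eqmx_opp mulmxA submxMl].
exists (S' *m vU), (in_submod U (u *m U) *m S); split.
- exact: intertwinesM homS' (val_submod_hom modU).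
- by apply: intertwinesM homS; apply: in_submod_hom => //; apply: submxMl.
rewrite mulmxA -(mulmxA S') [in_submod U _]in_submodE (mulmxA vU) vP -in_submodE.
by rewrite val_submodK mulmx1.
Qed.

End Indecomposables.

Section SignedYoungFactor.
Variables (F : fieldType) (p n : nat) (l m : seq nat).
Variables (d : nat) (Y : mx_representation F (SymG n) d).
Variables (dN : nat) (rN : mx_representation F (SymG n) dN).
Variables (V : zmodType) (Dfun : 'M[F]_dN -> V).
Hypothesis Dfun_add : forall a b, Dfun (a + b) = Dfun a + Dfun b.

(** Splitting the middle module into indecomposables writes [f *m g] as a sum of composites. Those
    through summands other than Y factor through some strictly dominating M(a|pb), where [Dfun]
    vanishes, so a nonzero one passes through Y. *)
Lemma signedYoung_factor :
    signedYoung p l m Y ->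
    (forall a b, is_partition a -> is_partition b -> (sumn a + p * sumn b)%N = n ->
       sdom2 a (pscale p b) l (pscale p m) ->
       forall f g, intertwines rN (Mrep F n a (pscale p b)) f ->
         intertwines (Mrep F n a (pscale p b)) rN g -> Dfun (f *m g) = 0) ->
  forall f g, intertwines rN (Mrep F n l (pscale p m)) f ->
    intertwines (Mrep F n l (pscale p m)) rN g -> Dfun (f *m g) != 0 ->
  exists f1 g1, [/\ intertwines rN Y f1, intertwines Y rN g1 & Dfun (f1 *m g1) != 0].
Proof.
move=> [indY [k [W [modW [dx [full [indW [i0 [iso others]]]]]]]]] higher f g homf homg nz.
have Dfun0 : Dfun 0 = 0 by apply: (addrI (Dfun 0)); rewrite -Dfun_add !addr0.
have Dfun_sum (I : finType) (h : I -> 'M_dN) : Dfun (\sum_i h i) = \sum_i Dfun (h i).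
  exact: (big_morph Dfun Dfun_add Dfun0).
have /sub_sumsmxP[u E1] : (1%:M <= \sum_i W i)%MS by case/andP: full.
pose B i := u i *m W i.
have BW i : (B i <= W i)%MS by apply: submxMl.
have homB := direct_components_hom modW dx BW (esym E1).
pose f' i := f *m in_submod (W i) (B i).
pose g' i := val_submod (1%:M : 'M_(\rank (W i))) *m g.
have homf' i : intertwines rN (submod_repr (modW i)) (f' i).
  by apply: intertwinesM homf _; apply: in_submod_hom.
have homg' i : intertwines (submod_repr (modW i)) rN (g' i).
  by apply: intertwinesM homg; apply: val_submod_hom.
have decomp : f *m g = \sum_i f' i *m g' i.
  rewrite -[f]mulmx1 E1 mulmx_sumr mulmx_suml; apply: eq_bigr => i _.
  rewrite -/(B i) -[B i](in_submodK (BW i)) val_submodE /f' /g'.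
  by rewrite -!(mulmxA f) -(mulmxA (in_submod _ _)).
have [i nzi] : exists i, Dfun (f' i *m g' i) != 0.
  apply/existsP; apply: contraNT nz => /existsPn H.
  by rewrite decomp Dfun_sum big1 // => i _; apply/eqP; have := H i; rewrite negbK.
have [Ei|ni] := eqVneq i i0.
  rewrite {i}Ei in nzi; have [S [S' [homS homS' SS' _]]] := rsim_inverse iso.
  exists (f' i0 *m S), (S' *m g' i0); split.
  - exact: intertwinesM homS.
  - exact: intertwinesM homS' _.
  by rewrite mulmxA -(mulmxA _ S) SS' mulmx1.
have [_ [a [b [pa pb sab dab /summand_maps[io [q [homi homq iq]]]]]]] := others i ni.
case/eqP: nzi; have -> : f' i *m g' i = (f' i *m io) *m (q *m g' i).
  by rewrite mulmxA -(mulmxA _ io) iq mulmx1.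
by apply: (higher a b) => //; [apply: intertwinesM homi | apply: intertwinesM homq _].
Qed.

End SignedYoungFactor.

(** * Partitions, sign twists and the main argument *)

Section PartitionSums.
Local Open Scope nat_scope.

Lemma sumn_take s k : sumn (take k s) = \sum_(i < k) nth 0 s i.
Proof.
elim: s k => [|x s IH] [|k] /=; rewrite ?big_ord0 //.
  by rewrite big1 // => i _; rewrite nth_nil.
by rewrite big_ord_recl /= IH.
Qed.

Lemma sumn_nth s k : size s <= k -> sumn s = \sum_(i < k) nth 0 s i.
Proof. by move=> Hk; rewrite -sumn_take take_oversize. Qed.

Lemma nth_pscale p s i : nth 0 (pscale p s) i = p * nth 0 s i.
Proof.
have [Hi|Hi] := ltnP i (size s); first by rewrite (nth_map 0).
by rewrite !nth_default ?size_map // muln0.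
Qed.

Lemma sumn_pscale p s : sumn (pscale p s) = p * sumn s.
Proof. by elim: s => [|x s IH] /=; rewrite ?muln0 // IH mulnDr. Qed.

Lemma take_pscale p s k : take k (pscale p s) = pscale p (take k s).
Proof. by rewrite /pscale map_take. Qed.

Lemma drop_pscale p s k : drop k (pscale p s) = pscale p (drop k s).
Proof. by rewrite /pscale map_drop. Qed.

Lemma nth_padd s t i : nth 0 (padd s t) i = nth 0 s i + nth 0 t i.
Proof.
rewrite /padd; have [Hi|Hi] := ltnP i (maxn (size s) (size t)).
  by rewrite nth_mkseq.
move: (Hi); rewrite geq_max => /andP[Hs Ht].
by rewrite !nth_default ?size_mkseq.
Qed.

Lemma padd_gt0 s t : all (fun x => 0 < x) s -> all (fun x => 0 < x) t ->
  all (fun x => 0 < x) (padd s t).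
Proof.
move=> /allP ps /allP pt; apply/allP=> x /mapP[i]; rewrite mem_iota add0n leq_max => Hi ->.
case/orP: Hi => Hi; first by rewrite ltn_addr // ps // mem_nth.
by rewrite ltn_addl // pt // mem_nth.
Qed.

Lemma sumn_take_add l s t k : (forall i, nth 0 l i = nth 0 s i + nth 0 t i) ->
  sumn (take k l) = sumn (take k s) + sumn (take k t).
Proof. by move=> H; rewrite !sumn_take -big_split; apply: eq_bigr => i _; apply: H. Qed.

Lemma sumn_add l s t : (forall i, nth 0 l i = nth 0 s i + nth 0 t i) ->
  sumn l = sumn s + sumn t.
Proof.
move=> H; pose k := size l + size s + size t.
rewrite (@sumn_nth l k) ?(@sumn_nth s k) ?(@sumn_nth t k); try by rewrite /k; lia.
by rewrite -big_split; apply: eq_bigr => i _; apply: H.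
Qed.

Lemma eq_partition_sums s t : all (fun x => 0 < x) s -> all (fun x => 0 < x) t ->
  (forall k, sumn (take k s) = sumn (take k t)) -> s = t.
Proof.
move=> /allP ps /allP pt H.
have E i : nth 0 s i = nth 0 t i.
  by have := H i.+1; rewrite !sumn_take !big_ord_recr -!sumn_take H => /addnI.
have sz a b : {in a, forall x, 0 < x} -> (forall i, nth 0 a i = nth 0 b i) -> size a <= size b.
  move=> pa Eab; rewrite leqNgt; apply/negP => lt.
  by have := pa _ (mem_nth 0 lt); rewrite Eab nth_default.
by apply: (@eq_from_nth _ 0) => // ; apply/eqP; rewrite eqn_leq !sz // => i; rewrite E.
Qed.

(** Dominance gives the inequalities opposite to the two bounds, first for the unsigned rows and
    then, the totals being equal, for the signed ones; the pairs would coincide. *)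
Lemma sdom2_bounded p n a b l m : 0 < p ->
    is_partition a -> is_partition b -> all (fun x => 0 < x) l -> is_partition m ->
    sumn a + p * sumn b = n -> sumn l + p * sumn m = n ->
    (forall k, sumn (take k a) <= sumn (take k l)) ->
    (forall k, p * sumn (drop k m) <= sumn (drop k (pscale p b))) ->
  ~ sdom2 a (pscale p b) l (pscale p m).
Proof.
move=> p0 /andP[_ pa] /andP[_ pb] pl /andP[_ pm] Ea El H1 H2 [dom ne].
apply: ne; have split k s : sumn s = sumn (take k s) + sumn (drop k s).
  by rewrite -sumn_cat cat_take_drop.
have al : l = a.
  by apply: eq_partition_sums => // k; apply/eqP; rewrite eqn_leq H1 andbT; case: (dom k).
have mb : m = b.
  apply: eq_partition_sums => // k; have [_] := dom k; have := H2 k.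
  rewrite drop_pscale !take_pscale !sumn_pscale leq_pmul2l // al leq_add2l leq_pmul2l //.
  move=> h1 h2; move: Ea; rewrite -El al => /addnI/eqP; rewrite eqn_pmul2l // => /eqP Eb.
  by have := split k b; have := split k m; lia.
by rewrite al mb.
Qed.

End PartitionSums.

Section SignTwist.
Variables (F : fieldType) (n : nat).

Lemma sgnF_sqr (g : 'S_n) : sgnF F g * sgnF F g = 1.
Proof. by rewrite /sgnF -expr2 sqrr_sign. Qed.

Lemma intertwines_twist d1 d2 (r1 : mx_representation F (SymG n) d1)
    (r2 : mx_representation F (SymG n) d2) B :
  intertwines (sgn_twist r1) r2 B <-> intertwines r1 (sgn_twist r2) B.
Proof.
split=> homB g Gg /=; have /= := homB g Gg; rewrite -scalemxAl -scalemxAr.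
  by move=> <-; rewrite scalerA sgnF_sqr scale1r.
by move=> ->; rewrite scalerA sgnF_sqr scale1r.
Qed.

Lemma sgn_twist_rsim d1 d2 (r1 : mx_representation F (SymG n) d1)
    (r2 : mx_representation F (SymG n) d2) :
  mx_rsim r1 (sgn_twist r2) -> mx_rsim (sgn_twist r1) r2.
Proof.
by case=> B d12 freeB homB; exists B => //; apply/intertwines_twist.
Qed.

Lemma mxmodule_twist d (r : mx_representation F (SymG n) d) (U : 'M_d) :
  mxmodule (sgn_twist r) U = mxmodule r U.
Proof.
apply/mxmoduleP/mxmoduleP => H g Gg; have := H g Gg; rewrite /= -scalemxAr.
  by rewrite eqmx_scale // signr_eq0.
by rewrite eqmx_scale // signr_eq0.
Qed.

Lemma indecomposable_twist d (r : mx_representation F (SymG n) d) :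
  indecomposable r -> indecomposable (sgn_twist r).
Proof.
by case=> d0 H; split=> // U V; rewrite !mxmodule_twist; apply: H.
Qed.

Lemma sigma_twist d (r : mx_representation F (SymG n) d) (T : eqType) (row : 'I_n -> bool * T) :
  sigma_mx (swap_row row) (sgn_twist r) = sigma_mx row r.
Proof.
rewrite !sigma_mxE rowstab_swap; apply: eq_bigr => h Hh /=.
by rewrite rowsign_swap // scalerA mulrAC sgnF_sqr mul1r.
Qed.

Lemma eq_sigma d (r : mx_representation F (SymG n) d) (T : eqType)
    (row1 row2 : 'I_n -> bool * T) : row1 =1 row2 -> sigma_mx row1 r = sigma_mx row2 r.
Proof.
move=> E; rewrite !sigma_mxE (eq_rowstab E); apply: eq_bigr => h _.
by rewrite (eq_rowsign _ _ E).
Qed.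

Lemma sigma_rsim d1 d2 (r1 : mx_representation F (SymG n) d1)
    (r2 : mx_representation F (SymG n) d2) (T : eqType) (row : 'I_n -> bool * T) :
  mx_rsim r1 r2 -> sigma_mx row r1 != 0 -> sigma_mx row r2 != 0.
Proof.
case=> B _ freeB homB; apply: contraNneq => z.
have := sigma_mx_intertwines row homB; rewrite z mulmx0 => /eqP.
by rewrite mulmx_free_eq0.
Qed.

End SignTwist.

(** Stated for an arbitrary degree [k], so that it can be transported along the equality of
    [sumn nu] and [sumn rho]. *)
Definition specht_like (F : fieldType) k nu d (D : mx_representation F (SymG k) d) : Prop :=
  [/\ mx_irreducible D,
      (forall row : 'I_k -> bool * nat, sigma_mx row D != 0 ->
        forall m, (#|[set i | ((row i).1 == false) && ((row i).2 < m)%N]|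
                     <= sumn (take m nu))%N)
    & sigma_mx (fun i : 'I_k => (false, blk nu i)) D != 0].

Lemma specht_like_cast (F : fieldType) k k' nu d (e : k = k')
    (D : mx_representation F (SymG k) d) : specht_like nu D ->
  specht_like nu (eq_rect _ (fun k => mx_representation F (SymG k) d) D _ e).
Proof. by case: k' / e. Qed.

(** Here D is D_rho. The statements about signed rows are those of D_nu about unsigned rows, carried
    back through the isomorphism of D_nu with the sign twist of D. *)
Lemma mullineux_facts (F : fieldType) p rho nu :
    p \in [pchar F] -> odd p -> is_partition rho -> prestricted p rho ->
    is_partition nu -> prestricted p nu -> mullineux F rho nu ->
  sumn nu = sumn rho /\
  exists d (D : mx_representation F (SymG (sumn rho)) d),
    [/\ mx_irreducible D,
        (forall row : 'I_(sumn rho) -> bool * nat, sigma_mx row D != 0 -> forall b k,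
          (#|[set i | ((row i).1 == b) && ((row i).2 < k)%N]|
             <= sumn (take k (if b then nu else rho)))%N),
        sigma_mx (fun i : 'I_(sumn rho) => (false, blk rho i)) D != 0
      & sigma_mx (fun i : 'I_(sumn rho) => (true, blk nu i)) D != 0].
Proof.
move=> charF p_odd rho_part rho_res nu_part nu_res.
case=> e [U [modU [U' [modU' [socU [socU' iso]]]]]]; split=> //.
have [irrD dom nz] := specht_socle_facts charF p_odd rho_part rho_res modU socU.
have : specht_like nu (submod_repr modU').
  by have [? ? ?] := specht_socle_facts charF p_odd nu_part nu_res modU' socU'; split.
move/(specht_like_cast e); set D' := eq_rect _ _ _ _ _ in iso * => -[_ dom' nz'].
exists (\rank U), (submod_repr modU); split=> //.
  move=> row nzrow [] k; last exact: dom.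
  apply: leq_trans (dom' (swap_row row) _ k).
    by apply/subset_leq_card/subsetP=> i; rewrite !inE /swap_row /=; case: (row i).1.
  by apply: sigma_rsim iso _; rewrite sigma_twist.
rewrite -sigma_twist; apply: sigma_rsim (mx_rsim_sym iso) _.
by rewrite (eq_sigma _ (row2 := fun i : 'I__ => (false, blk nu i))).
Qed.

Section BlockCells.
Variables kap m : seq nat.

Definition side_shape (b : bool) := if b then m else kap.
Definition cell := ('I_(sumn kap) + 'I_(sumn m))%type.
Definition cell_side (q : cell) := if q is inr _ then true else false.
Definition cell_row (q : cell) := match q with inl i => blk kap i | inr i => blk m i end.
Definition cell_col (q : cell) := match q with inl i => colidx kap i | inr i => colidx m i end.

Lemma cell_inj x y : cell_row x = cell_row y ->
  (cell_side x, cell_col x) = (cell_side y, cell_col y) -> x = y.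
Proof. by case: x => x; case: y => y //= Er [Ec]; rewrite (specht_cell_inj Er Ec). Qed.

Lemma cell_init : is_partition kap -> is_partition m ->
  forall x i, (i <= cell_row x)%N ->
  exists2 y, (cell_side y, cell_col y) = (cell_side x, cell_col x) & cell_row y = i.
Proof.
move=> pk pm [] x i /= Hi.
  by have [y cy ry] := specht_col_init pk Hi; exists (inl y) => //=; rewrite cy.
by have [y cy ry] := specht_col_init pm Hi; exists (inr y) => //=; rewrite cy.
Qed.

Lemma card_cells b (P : pred nat) :
  #|[set q | (cell_side q == b) && P (cell_row q)]| =
  #|[set i : 'I_(sumn (side_shape b)) | P (blk (side_shape b) i)]|.
Proof.
rewrite -!sum1dep_card big_mkcond big_sumType /= -!big_mkcond /=.
case: b => /=; first by rewrite big_pred0_eq add0n.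
by rewrite addnC big_pred0_eq add0n.
Qed.

Lemma card_cell : #|{: cell}| = (sumn kap + sumn m)%N.
Proof. by rewrite card_sum !card_ord. Qed.
End BlockCells.

Section Labelled.
Variables (F : fieldType) (p n r : nat) (kap m : seq nat).
Hypotheses (charF : p \in [pchar F]).
Local Notation cell := (cell kap m).
Variables (th : 'I_r + cell * 'I_p -> 'I_n) (th' : 'I_n -> 'I_r + cell * 'I_p).
Hypotheses (thK : cancel th th') (th'K : cancel th' th).

(** Merges the rows of the free points with those of the blocks. Unsigned labels by the rows of rho
    give M(l|pm); signed labels by the rows of nu give the sign twist of M(nu+pm|p kap). *)
Definition joint_row (lab : 'I_r -> bool * nat) (i : 'I_n) : bool * nat :=
  match th' i with inl k => lab k | inr a => (cell_side a.1, cell_row a.1) end.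

Lemma joint_row_inl lab k : joint_row lab (th (inl k)) = lab k.
Proof. by rewrite /joint_row thK. Qed.

Lemma joint_row_inr lab q j : joint_row lab (th (inr (q, j))) = (cell_side q, cell_row q).
Proof. by rewrite /joint_row thK. Qed.

Lemma card_joint_row lab b j : #|[set i | joint_row lab i == (b, j)]| =
  (#|[set k | lab k == (b, j)]| + p * nth 0 (side_shape kap m b) j)%N.
Proof.
rewrite (card_blocks charF thK th'K (P := fun i => joint_row lab i == (b, j)) (s := 1%g)).
  congr (_ + _ * _)%N; first by apply: eq_card => i; rewrite !inE perm1 joint_row_inl.
  rewrite -card_blk -(card_cells kap m b (pred1 j)); apply: eq_card => q.
  by rewrite !inE perm1 joint_row_inr.
by move=> q k k'; rewrite !perm1 !joint_row_inr.
Qed.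
End Labelled.

Lemma card_const_label k nu (b b' : bool) j :
  #|[set i : 'I_k | (b, blk nu i) == (b', j)]| =
  if b == b' then #|[set i : 'I_k | blk nu i == j]| else 0%N.
Proof.
case: eqP => [->|nb]; first by apply: eq_card => i; rewrite !inE xpair_eqE eqxx.
apply/eqP; rewrite cards_eq0; apply/eqP/setP=> i; rewrite !inE xpair_eqE.
by move/eqP/negPf: nb => ->.
Qed.

Lemma card_blk_eq k c j : sumn c = k -> #|[set i : 'I_k | blk c i == j]| = nth 0%N c j.
Proof. by move=> <-; apply: card_blk. Qed.

(* (l | p m) in P^2(n); rho = l(0) (the unique p-restricted partition with
   l - rho = p kap for a partition kap); nu = m(rho) (Mullineux).
   Y1 = Y(l | p m), Y2 = Y(nu + p m | p kap) = Y(m(l(0)) + p m | l - l(0)). *)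
Theorem theorem3p17 (F : closedFieldType) (p n : nat) (l m rho kap nu : seq nat) :
  p \in [pchar F]%R -> (3 <= p)%N ->
  is_partition l -> is_partition m -> (sumn l + p * sumn m)%N = n ->
  is_partition rho -> prestricted p rho -> is_partition kap ->
  (forall i, nth 0%N l i = nth 0%N rho i + p * nth 0%N kap i)%N ->
  is_partition nu -> prestricted p nu -> mullineux F rho nu ->
  forall d1 (Y1 : mx_representation F (SymG n) d1)
         d2 (Y2 : mx_representation F (SymG n) d2),
    signedYoung p l m Y1 ->
    signedYoung p (padd nu (pscale p m)) kap Y2 ->
    mx_rsim (sgn_twist Y1) Y2.
Proof.
move=> charF p_ge3 l_part m_part size_l rho_part rho_res kap_part l_exp nu_part nu_res mul.
move=> d1 Y1 d2 Y2 sY1 sY2.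
have p_pr := pcharf_prime charF; have p_gt0 := prime_gt0 p_pr.
have p_odd : odd p by case: (even_prime p_pr) => // p2; move: p_ge3; rewrite p2.
have [size_nu [dD [D [irrD dom nz_rho nz_nu]]]] :=
  mullineux_facts charF p_odd rho_part rho_res nu_part nu_res mul.
have l_add i : nth 0%N l i = (nth 0 rho i + nth 0 (pscale p kap) i)%N.
  by rewrite nth_pscale l_exp.
have lE : sumn l = (sumn rho + p * sumn kap)%N by rewrite (sumn_add l_add) sumn_pscale.
pose l2 := padd nu (pscale p m).
have l2_add i : nth 0%N l2 i = (nth 0 nu i + nth 0 (pscale p m) i)%N by apply: nth_padd.
have l2E : sumn l2 = (sumn nu + p * sumn m)%N by rewrite (sumn_add l2_add) sumn_pscale.
have size_l2 : (sumn l2 + p * sumn kap)%N = n by rewrite l2E; lia.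
have l_gt0 : all (fun x => 0 < x)%N l by case/andP: l_part.
have l2_gt0 : all (fun x => 0 < x)%N l2.
  case/andP: nu_part => _ nu_gt0; case/andP: m_part => _ m_gt0; apply: padd_gt0 => //.
  by rewrite all_map; apply: sub_all m_gt0 => x /= x0; rewrite muln_gt0 p_gt0.
have card_pos : #|{: 'I_(sumn rho) + cell kap m * 'I_p}| = n.
  by rewrite card_sum card_prod card_cell !card_ord; lia.
pose th o : 'I_n := cast_ord card_pos (enum_rank o).
pose th' (i : 'I_n) := enum_val (cast_ord (esym card_pos) i).
have thK : cancel th th' by move=> o; rewrite /th /th' cast_ordK enum_rankK.
have th'K : cancel th' th by move=> i; rewrite /th /th' enum_valK cast_ordKV.
clearbody th th'.
have [dN [rN [vN [eN monN]]]] : exists dN (rN : mx_representation F (SymG n) dN) vN eN,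
    monomial (base_row th' (@cell_side kap m) (@cell_row kap m)) rN vN eN.
  by do 4!eexists; apply: regular_monomial.
have c_inj := @cell_inj kap m; have c_init := cell_init kap_part m_part.
pose Dm := Dmap thK th'K (@cell_side kap m) (@cell_col kap m) rN vN eN D.
have [f [g [homf homg Dfg]]] : exists f g, [/\ intertwines rN (Mrep F n l (pscale p m)) f,
    intertwines (Mrep F n l (pscale p m)) rN g & Dm (f *m g) != 0].
  have [||v [e mon]] := @Mrep_monomial F n l (pscale p m) _
    (joint_row th' (fun i => (false, blk rho i))).
  - by rewrite sumn_pscale.
  - move=> b j; rewrite (card_joint_row charF thK th'K) card_const_label.
    by case: b => /=; rewrite ?add0n ?nth_pscale // card_blk l_exp.
  have [|f [g [homf homg E]]] := Dmap_natural charF thK th'K c_inj monN D _ mon.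
    by move=> q j; apply: joint_row_inr.
  exists f, g; split=> //; rewrite /Dm E.
  by rewrite (eq_sigma D (row2 := fun i : 'I__ => (false, blk rho i))) // => i; apply: joint_row_inl.
(* The same construction for the twist of the second module; moving the twist to [rN] puts the maps
   in the form expected by [signedYoung_factor]. *)
have [f2 [g2 [homf2 homg2 Dfg2]]] : exists f g,
    [/\ intertwines (sgn_twist rN) (Mrep F n l2 (pscale p kap)) f,
        intertwines (Mrep F n l2 (pscale p kap)) (sgn_twist rN) g & Dm (f *m g) != 0].
  pose row2 := joint_row th' (fun i => (true, blk nu i)).
  have [||v [e mon]] := @Mrep_monomial F n l2 (pscale p kap) _ (swap_row row2).
  - by rewrite sumn_pscale.
  - move=> b j; have -> : #|[set i | swap_row row2 i == (b, j)]| = #|[set i | row2 i == (~~ b, j)]|.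
      apply: eq_card => i; rewrite !inE /swap_row; case: (row2 i) => c x.
      by rewrite !xpair_eqE /= (can2_eq negbK negbK).
    rewrite (card_joint_row charF thK th'K) card_const_label.
    by case: b => /=; rewrite ?add0n ?nth_pscale // card_blk_eq // l2_add nth_pscale.
  have mon2 : monomial row2 (sgn_twist (Mrep F n l2 (pscale p kap))) v e.
    apply: eq_monomial (monomial_twist mon) => i.
    by rewrite /swap_row /= negbK -surjective_pairing.
  have [|f' [g' [homf' homg' E]]] := Dmap_natural charF thK th'K c_inj monN D _ mon2.
    by move=> q j; apply: joint_row_inr.
  exists f', g'; split; [exact/intertwines_twist | exact/intertwines_twist | rewrite /Dm E].
  by rewrite (eq_sigma D (row2 := fun i : 'I__ => (true, blk nu i))) // => i; apply: joint_row_inl.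
have Dadd := Dmap_add thK th'K (@cell_side kap m) (@cell_col kap m) rN vN eN D.
have [f1 [g1 [hf1 hg1 nz1]]] : exists f1 g1,
    [/\ intertwines rN Y1 f1, intertwines Y1 rN g1 & Dm (f1 *m g1) != 0].
  apply: (signedYoung_factor Dadd sY1 _ homf homg Dfg) => a b pa pb size_ab sdom f' g' hf' hg'.
  have size_ab' : (sumn a + sumn (pscale p b))%N = n by rewrite sumn_pscale.
  have [v [e mon]] := Mrep_std_monomial F size_ab'.
  have counts f0 g0 h1 h2 := @Dmap_counts _ _ _ _ _ charF p_odd _ _ thK th'K _ _ _ c_init _ _ _ _ monN _ D
    _ _ _ _ _ f0 g0 _ mon h1 h2 dom.
  (* Initial sums of [a] are bounded on the unsigned side by rho + p kap = l, tail sums of p b on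
     the signed side by those of p m. *)
  apply/eqP; apply: contraT => nz; case: (sdom2_bounded p_gt0 pa pb l_gt0 m_part size_ab size_l _ _ sdom).
    move=> k; have [H _] := counts _ _ hf' hg' nz false k; move: H.
    rewrite (card_std_side size_ab' false (fun j => j < k)%N) card_blk_lt.
    rewrite (card_cells kap m false (fun j => j < k)%N) card_blk_lt /=.
    by rewrite (sumn_take_add k l_add) take_pscale sumn_pscale.
  move=> k; have [_ H] := counts _ _ hf' hg' nz true k; move: H.
  rewrite (card_std_side size_ab' true (fun j => k <= j)%N) card_blk_ge.
  by rewrite (card_cells kap m true (fun j => k <= j)%N) card_blk_ge.
have [f3 [g3 [hf3 hg3 nz3]]] : exists f3 g3,
    [/\ intertwines (sgn_twist rN) Y2 f3, intertwines Y2 (sgn_twist rN) g3 & Dm (f3 *m g3) != 0].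
  apply: (signedYoung_factor Dadd sY2 _ homf2 homg2 Dfg2) => a b pa pb size_ab sdom f' g'.
  move=> /intertwines_twist hf' /intertwines_twist hg'.
  have size_ab' : (sumn a + sumn (pscale p b))%N = n by rewrite sumn_pscale.
  have [v [e mon]] := Mrep_std_monomial F size_ab'.
  have mon' := monomial_twist mon.
  have counts f0 g0 h1 h2 := @Dmap_counts _ _ _ _ _ charF p_odd _ _ thK th'K _ _ _ c_init _ _ _ _ monN _ D
    _ _ _ _ _ f0 g0 _ mon' h1 h2 dom.
  have swapE c (P : pred nat) :
      [set i | ((swap_row (@std_row n a (pscale p b)) i).1 == c) && P (swap_row (@std_row n a (pscale p b)) i).2]
      =i [set i | ((@std_row n a (pscale p b) i).1 == ~~ c) && P (@std_row n a (pscale p b) i).2].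
    by move=> i; rewrite !inE /swap_row /= (can2_eq negbK negbK).
  (* The twist exchanges the sides: [a] is now compared with nu + p m on the signed side, and the
     tails of p b with those of p kap on the unsigned side. *)
  apply/eqP; apply: contraT => nz; case: (sdom2_bounded p_gt0 pa pb l2_gt0 kap_part size_ab size_l2 _ _ sdom).
    move=> k; have [H _] := counts _ _ hf' hg' nz true k; move: H.
    rewrite (eq_card (swapE true (fun j => j < k)%N)).
    rewrite (card_std_side size_ab' false (fun j => j < k)%N) card_blk_lt.
    rewrite (card_cells kap m true (fun j => j < k)%N) card_blk_lt /=.
    by rewrite (sumn_take_add k l2_add) take_pscale sumn_pscale.
  move=> k; have [_ H] := counts _ _ hf' hg' nz false k; move: H.
  rewrite (eq_card (swapE false (fun j => k <= j)%N)).
  rewrite (card_std_side size_ab' true (fun j => k <= j)%N) card_blk_ge.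
  by rewrite (card_cells kap m false (fun j => k <= j)%N) card_blk_ge.
(* Both Y1 and the twist of Y2 now carry composites N -> N with nonzero image in the same simple
   quotient of End N. *)
apply: sgn_twist_rsim; have [ind1 _] := sY1; have [ind2 _] := sY2.
apply: (@simple_quotient_rsim _ _ _ _ _ _ _ rN D Dm _ _ Y1 (sgn_twist Y2) f1 g1 f3 g3) => //.
- by have := Dmap_scale thK th'K (@cell_side kap m) (@cell_col kap m) rN vN eN D 0 0; rewrite !scale0r.
- by move=> a b homa homb; apply: (Dmap_mul charF p_odd thK th'K c_inj c_init monN).
- by move=> Y; apply: (Dmap_onto charF thK th'K c_inj monN).
- exact: indecomposable_twist.
- exact/intertwines_twist.
- exact/intertwines_twist.
Qed.
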